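(* There exists a Cantor set $X$ in $\mathbb{C}^4$ such that (i) $\widehat{X}\setminus X\neq\emptyset$; (ii) $P(X)$ has dense invertibles; (iii) every point of $\widehat{X}$ is a one-point Gleason part for $P(X)$; (iv) there are no nonzero bounded point derivations for $P(X)$.
   Context: For compact $X\subset\mathbb{C}^N$, $\widehat{X}=\{z: |p(z)|\le\max_X|p| \text{ for all polynomials } p\}$ is the polynomial hull, which is naturally identified with the maximal ideal space of $P(X)$, the uniform closure on $X$ of the polynomials in the coordinate functions. A uniform algebra has dense invertibles if its invertible elements are dense in it. For a uniform algebra $A$, the Gleason parts are the equivalence classes of the maximal ideal space under $\varphi\sim\psi$ iff $\|\varphi-\psi\|<2$ in the dual norm of $A^*$. For a multiplicative linear functional $\phi$ on $A$, a point derivation at $\phi$ is a linear functional $\psi$ with $\psi(fg)=\psi(f)\phi(g)+\phi(f)\psi(g)$ for all $f,g\in A$; it is bounded if it is continuous. *)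

(* Defs.v *)
From Stdlib Require Import Reals.
Open Scope R_scope.

Record C := mkC { re : R; im : R }.
Definition C0 : C := mkC 0 0.
Definition C1 : C := mkC 1 0.
Definition Cadd (z w : C) : C := mkC (re z + re w) (im z + im w).
Definition Copp (z : C) : C := mkC (- re z) (- im z).
Definition Csub (z w : C) : C := Cadd z (Copp w).
Definition Cmul (z w : C) : C :=
  mkC (re z * re w - im z * im w) (re z * im w + im z * re w).
Definition Cnorm (z : C) : R := sqrt (re z * re z + im z * im z).

Inductive idx4 : Type := i1 | i2 | i3 | i4.
Definition C4 : Type := idx4 -> C.

Definition dist4 (z w : C4) : R :=
  sqrt (Rsqr (Cnorm (Csub (z i1) (w i1))) + Rsqr (Cnorm (Csub (z i2) (w i2)))
      + Rsqr (Cnorm (Csub (z i3) (w i3))) + Rsqr (Cnorm (Csub (z i4) (w i4)))).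

Definition agree_upto (n : nat) (s t : nat -> bool) : Prop :=
  forall k, (k < n)%nat -> s k = t k.

Definition is_Cantor_set (X : C4 -> Prop) : Prop :=
  exists h : (nat -> bool) -> C4,
    (forall s t, h s = h t -> s = t) /\
    (forall z, X z <-> exists s, h s = z) /\
    (forall s eps, 0 < eps -> exists n, forall t,
        agree_upto n s t -> dist4 (h s) (h t) < eps) /\
    (forall s n, exists delta, 0 < delta /\ forall t,
        dist4 (h s) (h t) < delta -> agree_upto n s t).

Inductive poly4 : Type :=
| PConst : C -> poly4
| PVar : idx4 -> poly4
| PAdd : poly4 -> poly4 -> poly4
| PMul : poly4 -> poly4 -> poly4.

Fixpoint peval (p : poly4) (z : C4) : C :=
  match p with
  | PConst c => c
  | PVar i => z i
  | PAdd p q => Cadd (peval p z) (peval q z)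
  | PMul p q => Cmul (peval p z) (peval q z)
  end.

Definition poly_hull (X : C4 -> Prop) (z : C4) : Prop :=
  forall (p : poly4) (M : R),
    (forall x, X x -> Cnorm (peval p x) <= M) -> Cnorm (peval p z) <= M.

Definition PX (X : C4 -> Prop) (f : {x : C4 | X x} -> C) : Prop :=
  forall eps, 0 < eps -> exists p : poly4,
    forall x : {x : C4 | X x}, Cnorm (Csub (f x) (peval p (proj1_sig x))) < eps.

Definition normle (X : C4 -> Prop) (f : {x : C4 | X x} -> C) (M : R) : Prop :=
  forall x, Cnorm (f x) <= M.

Definition fadd {X : C4 -> Prop} (f g : {x : C4 | X x} -> C) := fun x => Cadd (f x) (g x).
Definition fmul {X : C4 -> Prop} (f g : {x : C4 | X x} -> C) := fun x => Cmul (f x) (g x).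
Definition fscal {X : C4 -> Prop} (c : C) (f : {x : C4 | X x} -> C) := fun x => Cmul c (f x).
Definition fone (X : C4 -> Prop) : {x : C4 | X x} -> C := fun _ => C1.

Definition dense_invertibles (X : C4 -> Prop) : Prop :=
  forall f, PX X f -> forall eps, 0 < eps ->
    exists g h, PX X g /\ PX X h /\ (forall x, Cmul (g x) (h x) = C1) /\
      (forall x, Cnorm (Csub (f x) (g x)) < eps).

Definition linear_on_PX (X : C4 -> Prop) (L : ({x : C4 | X x} -> C) -> C) : Prop :=
  (forall f g, PX X f -> PX X g -> L (fadd f g) = Cadd (L f) (L g)) /\
  (forall c f, PX X f -> L (fscal c f) = Cmul c (L f)).

(** Nonzero multiplicative linear functionals (points of the maximal ideal space) *)
Definition character (X : C4 -> Prop) (phi : ({x : C4 | X x} -> C) -> C) : Prop :=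
  linear_on_PX X phi /\
  (forall f g, PX X f -> PX X g -> phi (fmul f g) = Cmul (phi f) (phi g)) /\
  phi (fone X) = C1.

Definition dual_dist_lt2 (X : C4 -> Prop) (phi psi : ({x : C4 | X x} -> C) -> C) : Prop :=
  exists r, r < 2 /\ forall f, PX X f -> normle X f 1 ->
    Cnorm (Csub (phi f) (psi f)) <= r.

Definition point_derivation (X : C4 -> Prop) (phi psi : ({x : C4 | X x} -> C) -> C) : Prop :=
  linear_on_PX X psi /\
  forall f g, PX X f -> PX X g ->
    psi (fmul f g) = Cadd (Cmul (psi f) (phi g)) (Cmul (phi f) (psi g)).

Definition bounded_functional (X : C4 -> Prop) (psi : ({x : C4 | X x} -> C) -> C) : Prop :=
  exists K, forall f M, PX X f -> normle X f M -> Cnorm (psi f) <= K * M.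

(* Main.v *)
(** The set lives over a compact [K] in C^3 obtained by removing thin shells around countably many
    spheres whose squared-distance functions separate points. The removal does not shrink the
    polynomial hull: a point close to a sphere can be moved, inside the complex tangent plane of a
    concentric sphere, to a point further away without decreasing the modulus of a given polynomial.
    Along the way one adjoins functions [t_j] with [p_j t_j^2 = 1], where [p_j] runs through a dense
    sequence of polynomials in [x] and in the partial sums of [w = sum c_j t_j]; the equations are
    kept by penalizing the maximized function, and since there are three more variables than
    adjoined equations a direction of increase always exists. The fourth coordinate is [w], and for
    rapidly decreasing [c_j] each [t_j] is recovered in [P(X)] from [w] by Newton's iteration. Hence
    squares of invertible elements are dense in [P(X)]: this gives dense invertibles, kills bounded
    point derivations (the derivation of [s^2] is small where [s] is small), and isolates characters
    (iterated square roots push their separation to the maximum). The set so obtained is compact and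
    totally disconnected; discarding clopen pieces while a base point stays in the hull leaves a
    closed subset without isolated points, that is a Cantor set. *)

From Stdlib Require Import Reals Lra Lia Cantor List.
From Stdlib Require Import Classical ClassicalEpsilon FunctionalExtensionality PropExtensionality.
Require Import Defs.
Open Scope R_scope.


(** * Complex numbers *)

(** The obstacle is that [t_j], an inverse square root of [p_j], blows up near the zeros of [p_j],
    while compactness needs a bound [T_j] on it. So each finite stage imposes one more equation: a
    weighted product of [p_0, ..., p_(m-1)] keeps its value at the base point. The exponents are
    chosen so that this product drops to at most half of that value wherever some [p_j] is as small
    as [|t_j| = T_j] would force. Such points violate an equation and lose in the penalized
    maximization, so a maximum never touches [|t_j| = T_j] and these bounds do not obstruct the
    moves. In the limit set the product no longer occurs; there the bounds persist by closedness.
    All constants of a stage are measured against the value of [p_j] at the base point, which is why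
    [p_j] is perturbed until that value is nonzero. *)

Lemma C_ext (z w : C) : re z = re w -> im z = im w -> z = w.
Proof. destruct z, w; simpl; intros -> ->; reflexivity. Qed.

Ltac ceq := apply C_ext; simpl; ring.

Lemma C_ring_theory : ring_theory C0 C1 Cadd Cmul Csub Copp (@eq C).
Proof. constructor; intros; try reflexivity; ceq. Qed.
Add Ring C_ring : C_ring_theory.

Definition RtoC (r : R) : C := mkC r 0.
Definition Ci : C := mkC 0 1.
Definition Cconj (z : C) : C := mkC (re z) (- im z).
Definition n2 (z : C) : R := re z * re z + im z * im z.
Definition Cinv (z : C) : C := mkC (re z / n2 z) (- im z / n2 z).

Lemma n2_ge0 z : 0 <= n2 z.
Proof. unfold n2; nra. Qed.

Lemma n2_mul z w : n2 (Cmul z w) = n2 z * n2 w.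
Proof. unfold n2; simpl; ring. Qed.

Lemma n2_eq0 z : n2 z = 0 -> z = C0.
Proof. unfold n2; intros H; apply C_ext; simpl; nra. Qed.

Lemma n2_pos z : z <> C0 -> 0 < n2 z.
Proof.
  intros H; destruct (Rle_lt_or_eq_dec _ _ (n2_ge0 z)) as [|E]; auto.
  exfalso; apply H, n2_eq0; auto.
Qed.

Lemma Cinv_r z : z <> C0 -> Cmul z (Cinv z) = C1.
Proof.
  intros H; apply n2_pos in H; unfold n2 in H.
  apply C_ext; simpl; unfold n2; field; lra.
Qed.

Lemma Cnorm_sqrt z : Cnorm z = sqrt (n2 z).
Proof. reflexivity. Qed.

Lemma Cnorm_ge0 z : 0 <= Cnorm z.
Proof. apply sqrt_pos. Qed.

Lemma Cnorm_sqr z : Cnorm z * Cnorm z = n2 z.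
Proof. rewrite Cnorm_sqrt; apply sqrt_sqrt, n2_ge0. Qed.

Lemma Cnorm_mul z w : Cnorm (Cmul z w) = Cnorm z * Cnorm w.
Proof. rewrite !Cnorm_sqrt, n2_mul; apply sqrt_mult; apply n2_ge0. Qed.

Lemma Cnorm_le_n2 z M : 0 <= M -> n2 z <= M * M -> Cnorm z <= M.
Proof. intros HM H; rewrite <- Cnorm_sqr in H; pose proof (Cnorm_ge0 z); nra. Qed.

Lemma n2_le_Cnorm z M : Cnorm z <= M -> n2 z <= M * M.
Proof. intros H; rewrite <- Cnorm_sqr; pose proof (Cnorm_ge0 z); nra. Qed.

Lemma Cnorm_triang z w : Cnorm (Cadd z w) <= Cnorm z + Cnorm w.
Proof.
  pose proof (Cnorm_ge0 z); pose proof (Cnorm_ge0 w).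
  apply Cnorm_le_n2; [lra|].
  pose proof (Cnorm_sqr z) as Ez; pose proof (Cnorm_sqr w) as Ew.
  (* Cauchy-Schwarz, from Re(z conj w) <= |z conj w|. *)
  assert (L : re z * re w + im z * im w <= Cnorm z * Cnorm w).
  { rewrite <- Cnorm_mul.
    replace (Cnorm (Cmul z w)) with (Cnorm (Cmul z (Cconj w))).
    2:{ rewrite !Cnorm_mul; f_equal; unfold Cnorm; f_equal; simpl; ring. }
    rewrite Cnorm_sqrt.
    apply Rle_trans with (sqrt (Rsqr (re (Cmul z (Cconj w))))).
    - rewrite sqrt_Rsqr_abs; simpl.
      eapply Rle_trans; [|apply Rle_abs]; lra.
    - apply sqrt_le_1_alt; unfold n2, Rsqr.
      pose proof (Rle_0_sqr (im (Cmul z (Cconj w)))); unfold Rsqr in *; lra. }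
  unfold n2 in *; simpl; nra.
Qed.

Lemma Cnorm_opp z : Cnorm (Copp z) = Cnorm z.
Proof. unfold Cnorm; f_equal; simpl; ring. Qed.

Lemma Cnorm_sub_sym z w : Cnorm (Csub z w) = Cnorm (Csub w z).
Proof. rewrite <- Cnorm_opp; f_equal; ring. Qed.

Lemma Cnorm_sub_le z w : Cnorm (Csub z w) <= Cnorm z + Cnorm w.
Proof. unfold Csub; rewrite <- (Cnorm_opp w); apply Cnorm_triang. Qed.

Lemma Cnorm_triang_sub z w v : Cnorm (Csub z v) <= Cnorm (Csub z w) + Cnorm (Csub w v).
Proof.
  replace (Csub z v) with (Cadd (Csub z w) (Csub w v)) by ring.
  apply Cnorm_triang.
Qed.

Lemma Cnorm_le_sub z w : Cnorm z <= Cnorm w + Cnorm (Csub z w).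
Proof. replace z with (Cadd w (Csub z w)) at 1 by ring; apply Cnorm_triang. Qed.

Lemma Cnorm_0 : Cnorm C0 = 0.
Proof. unfold Cnorm; simpl; replace (0*0+0*0) with 0 by ring; apply sqrt_0. Qed.

Lemma Cnorm_1 : Cnorm C1 = 1.
Proof. unfold Cnorm; simpl; replace (1*1+0*0) with 1 by ring; apply sqrt_1. Qed.

Lemma Cnorm_pos z : z <> C0 -> 0 < Cnorm z.
Proof. intros H; apply sqrt_lt_R0, n2_pos, H. Qed.

Lemma Cnorm_RtoC r : Cnorm (RtoC r) = Rabs r.
Proof.
  unfold Cnorm; simpl; replace (r*r+0*0) with (Rsqr r) by (unfold Rsqr; ring).
  apply sqrt_Rsqr_abs.
Qed.

Lemma Cnorm_RtoC_pos r : 0 <= r -> Cnorm (RtoC r) = r.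
Proof. intros; rewrite Cnorm_RtoC; apply Rabs_pos_eq; auto. Qed.

Lemma Cnorm_inv z : z <> C0 -> Cnorm (Cinv z) = / Cnorm z.
Proof.
  intros H; pose proof (Cnorm_pos z H).
  assert (E : Cnorm z * Cnorm (Cinv z) = 1) by (rewrite <- Cnorm_mul, Cinv_r, Cnorm_1; auto).
  apply Rmult_eq_reg_l with (Cnorm z); [rewrite E; field|]; lra.
Qed.

Lemma Cmul_eq0 z w : Cmul z w = C0 -> z = C0 \/ w = C0.
Proof.
  intros H; destruct (classic (z = C0)); auto; right.
  apply n2_eq0. assert (E : n2 z * n2 w = 0) by (rewrite <- n2_mul, H; unfold n2; simpl; ring).
  pose proof (n2_pos z H0); nra.
Qed.

Lemma C1_neq0 : C1 <> C0.
Proof. intros H; injection H; lra. Qed.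

Lemma Rabs_re_le z : Rabs (re z) <= Cnorm z.
Proof.
  rewrite Cnorm_sqrt, <- sqrt_Rsqr_abs; apply sqrt_le_1_alt; unfold Rsqr, n2; nra.
Qed.

Lemma Rabs_im_le z : Rabs (im z) <= Cnorm z.
Proof.
  rewrite Cnorm_sqrt, <- sqrt_Rsqr_abs; apply sqrt_le_1_alt; unfold Rsqr, n2; nra.
Qed.

Lemma Cnorm_le_re_im z : Cnorm z <= Rabs (re z) + Rabs (im z).
Proof.
  pose proof (Rabs_pos (re z)); pose proof (Rabs_pos (im z)).
  apply Cnorm_le_n2; [lra|]. unfold n2.
  assert (E : forall r, r * r = Rabs r * Rabs r) by (intros; apply Rsqr_abs).
  rewrite (E (re z)), (E (im z)); nra.
Qed.

Lemma Rabs_le_inv a b : Rabs a <= b -> - b <= a <= b.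
Proof. unfold Rabs; destruct (Rcase_abs a); lra. Qed.

(** Half-angle formulas give the absolute values of both parts of [s]; the sign of [im z] decides
    their relative sign. *)
Lemma Csqrt_exists (z : C) : exists s, Cmul s s = z.
Proof.
  set (m := Cnorm z).
  pose proof (Cnorm_ge0 z) as Hm; pose proof (Cnorm_sqr z) as E; unfold n2 in E; fold m in Hm, E.
  pose proof (Rabs_re_le z) as Hr; fold m in Hr.
  apply Rabs_le_inv in Hr.
  set (a := sqrt ((m + re z) / 2)); set (b := sqrt ((m - re z) / 2)).
  assert (Ea : a * a = (m + re z) / 2) by (apply sqrt_sqrt; lra).
  assert (Eb : b * b = (m - re z) / 2) by (apply sqrt_sqrt; lra).
  pose proof (sqrt_pos ((m + re z) / 2)) as Ha; fold a in Ha.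
  pose proof (sqrt_pos ((m - re z) / 2)) as Hb; fold b in Hb.
  assert (Eab : (2 * a * b) * (2 * a * b) = im z * im z).
  { replace ((2 * a * b) * (2 * a * b)) with (4 * (a * a) * (b * b)) by ring. rewrite Ea, Eb; nra. }
  assert (D : 2 * a * b = im z \/ 2 * a * b = - im z).
  { assert (F : (2 * a * b - im z) * (2 * a * b + im z) = 0) by lra.
    apply Rmult_integral in F; destruct F; [left|right]; lra. }
  destruct D; [exists (mkC a b)|exists (mkC a (- b))]; apply C_ext; simpl; lra.
Qed.

Definition Csum (n : nat) (f : nat -> C) : C :=
  nat_rect (fun _ => C) C0 (fun k s => Cadd s (f k)) n.

Lemma Csum_S n f : Csum (S n) f = Cadd (Csum n f) (f n).
Proof. reflexivity. Qed.

Lemma Csum_ext n f g : (forall k, (k < n)%nat -> f k = g k) -> Csum n f = Csum n g.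
Proof.
  induction n; intros H; auto; rewrite !Csum_S, IHn, H; auto.
Qed.

Lemma Csum_add n f g : Csum n (fun k => Cadd (f k) (g k)) = Cadd (Csum n f) (Csum n g).
Proof. induction n; [simpl; ring|rewrite !Csum_S, IHn; ring]. Qed.

Lemma Csum_scal n c f : Csum n (fun k => Cmul c (f k)) = Cmul c (Csum n f).
Proof. induction n; [simpl; ring|rewrite !Csum_S, IHn; ring]. Qed.

Lemma Csum_0 n f : (forall k, (k < n)%nat -> f k = C0) -> Csum n f = C0.
Proof. induction n; intros H; auto; rewrite Csum_S, IHn, H; auto; ring. Qed.

(** * Sequential limits and compactness *)

Definition Ccv (u : nat -> C) (l : C) : Prop :=
  forall eps, 0 < eps -> exists N, forall n, (N <= n)%nat -> Cnorm (Csub (u n) l) < eps.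

Lemma Ccv_const c : Ccv (fun _ => c) c.
Proof.
  intros eps H; exists O; intros; replace (Csub c c) with C0 by ring; rewrite Cnorm_0; auto.
Qed.

Lemma Ccv_ext u v l : (forall n, u n = v n) -> Ccv u l -> Ccv v l.
Proof. intros E H eps He; destruct (H eps He) as [N HN]; exists N; intros; rewrite <- E; auto. Qed.

Lemma Ccv_add u v l m : Ccv u l -> Ccv v m -> Ccv (fun n => Cadd (u n) (v n)) (Cadd l m).
Proof.
  intros H1 H2 eps He.
  destruct (H1 (eps/2)) as [N1 K1]; [lra|]; destruct (H2 (eps/2)) as [N2 K2]; [lra|].
  exists (N1 + N2)%nat; intros n Hn.
  replace (Csub (Cadd (u n) (v n)) (Cadd l m)) with (Cadd (Csub (u n) l) (Csub (v n) m)) by ring.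
  eapply Rle_lt_trans; [apply Cnorm_triang|].
  specialize (K1 n); specialize (K2 n); assert (N1 <= n)%nat by lia; assert (N2 <= n)%nat by lia.
  pose proof (K1 H); pose proof (K2 H0); lra.
Qed.

Lemma Ccv_mul u v l m : Ccv u l -> Ccv v m -> Ccv (fun n => Cmul (u n) (v n)) (Cmul l m).
Proof.
  intros H1 H2 eps He.
  pose proof (Cnorm_ge0 l); pose proof (Cnorm_ge0 m).
  set (d := Rmin 1 (eps / (2 * (Cnorm l + Cnorm m + 2)))).
  assert (Hd : 0 < d) by (apply Rmin_pos; [lra|apply Rdiv_lt_0_compat; lra]).
  assert (Hd1 : d <= 1) by apply Rmin_l.
  assert (Hd2 : d * (Cnorm l + Cnorm m + 2) <= eps / 2).
  { apply Rle_trans with (eps / (2 * (Cnorm l + Cnorm m + 2)) * (Cnorm l + Cnorm m + 2)).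
    - apply Rmult_le_compat_r; [lra|apply Rmin_r].
    - right; field; lra. }
  destruct (H1 d Hd) as [N1 K1]; destruct (H2 d Hd) as [N2 K2].
  exists (N1 + N2)%nat; intros n Hn.
  assert (A1 : Cnorm (Csub (u n) l) < d) by (apply K1; lia).
  assert (A2 : Cnorm (Csub (v n) m) < d) by (apply K2; lia).
  replace (Csub (Cmul (u n) (v n)) (Cmul l m)) with
    (Cadd (Cmul (Csub (u n) l) (Csub (v n) m))
      (Cadd (Cmul (Csub (u n) l) m) (Cmul l (Csub (v n) m)))) by ring.
  eapply Rle_lt_trans; [apply Cnorm_triang|].
  pose proof (Cnorm_triang (Cmul (Csub (u n) l) m) (Cmul l (Csub (v n) m))) as T.
  rewrite !Cnorm_mul in *.
  pose proof (Cnorm_ge0 (Csub (u n) l)); pose proof (Cnorm_ge0 (Csub (v n) m)).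
  nra.
Qed.

Lemma Ccv_unique u l m : Ccv u l -> Ccv u m -> l = m.
Proof.
  intros H1 H2; apply NNPP; intros Hn.
  assert (P : 0 < Cnorm (Csub l m)).
  { apply Cnorm_pos; intros E; apply Hn; replace l with (Cadd (Csub l m) m) by ring; rewrite E; ring. }
  destruct (H1 (Cnorm (Csub l m) / 2)) as [N1 K1]; [lra|].
  destruct (H2 (Cnorm (Csub l m) / 2)) as [N2 K2]; [lra|].
  pose proof (K1 (N1+N2)%nat ltac:(lia)); pose proof (K2 (N1+N2)%nat ltac:(lia)).
  pose proof (Cnorm_triang_sub l (u (N1+N2)%nat) m).
  rewrite (Cnorm_sub_sym l (u _)) in *; lra.
Qed.

Lemma Ccv_sub u l phi : (forall n, (n <= phi n)%nat) -> Ccv u l -> Ccv (fun n => u (phi n)) l.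
Proof.
  intros Hp H eps He; destruct (H eps He) as [N K]; exists N; intros n Hn; apply K.
  specialize (Hp n); lia.
Qed.

Lemma Ccv_norm_le u l M : Ccv u l -> (forall n, Cnorm (u n) <= M) -> Cnorm l <= M.
Proof.
  intros H B; apply Rnot_lt_le; intros Hl.
  destruct (H (Cnorm l - M)) as [N K]; [lra|].
  pose proof (K N (le_n _)); pose proof (B N); pose proof (Cnorm_le_sub l (u N)).
  rewrite (Cnorm_sub_sym l (u N)) in *; lra.
Qed.

Lemma Ccv_n2 u l : Ccv u l -> Un_cv (fun n => n2 (u n)) (n2 l).
Proof.
  intros H.
  assert (Hc : Ccv (fun n => Cconj (u n)) (Cconj l)).
  { intros eps He; destruct (H eps He) as [N K]; exists N; intros n Hn.
    replace (Csub (Cconj (u n)) (Cconj l)) with (Cconj (Csub (u n) l)) by ceq.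
    replace (Cnorm (Cconj (Csub (u n) l))) with (Cnorm (Csub (u n) l)); auto.
    unfold Cnorm; f_equal; simpl; ring. }
  pose proof (Ccv_mul _ _ _ _ H Hc) as P.
  intros eps He; destruct (P eps He) as [N K]; exists N; intros n Hn.
  unfold Rdist. eapply Rle_lt_trans; [|apply (K n Hn)].
  eapply Rle_trans; [|apply Rabs_re_le].
  right; f_equal; unfold n2; simpl; ring.
Qed.

Lemma Ccv_re_im u l :
  Un_cv (fun n => re (u n)) (re l) -> Un_cv (fun n => im (u n)) (im l) -> Ccv u l.
Proof.
  intros H1 H2 eps He.
  destruct (H1 (eps/2)) as [N1 K1]; [lra|]; destruct (H2 (eps/2)) as [N2 K2]; [lra|].
  exists (N1+N2)%nat; intros n Hn.
  assert (A1 := K1 n ltac:(lia)); assert (A2 := K2 n ltac:(lia)); unfold Rdist in *.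
  eapply Rle_lt_trans; [apply Cnorm_le_re_im|]; simpl.
  unfold Rminus in *; lra.
Qed.

(** Subsequences are only asked to satisfy [n <= phi n], without monotonicity: this suffices for
    limits and is stable under composition. *)
Lemma bounded_subseq (u : nat -> R) M : (forall n, Rabs (u n) <= M) ->
  exists phi l, (forall n, (n <= phi n)%nat) /\ Un_cv (fun n => u (phi n)) l.
Proof.
  intros B.
  destruct (Bolzano_Weierstrass u (fun x => - M <= x <= M)) as [l Hl].
  - apply compact_P3.
  - intros n; apply Rabs_le_inv, B.
  - assert (S : forall n, exists p, (n <= p)%nat /\ Rabs (u p - l) < / (INR n + 1)).
    { intros n. pose proof (pos_INR n).
      assert (P : 0 < / (INR n + 1)) by (apply Rinv_0_lt_compat; lra).
      destruct (Hl (fun x => Rabs (x - l) < / (INR n + 1)) n) as [p [Hp1 Hp2]].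
      - exists (mkposreal _ P); intros x Hx; exact Hx.
      - exists p; auto. }
    exists (fun n => proj1_sig (constructive_indefinite_description _ (S n))), l; split.
    + intros n; destruct (constructive_indefinite_description _ (S n)) as [p [H1 H2]]; auto.
    + intros eps He.
      destruct (archimed_cor1 eps He) as [N [HN1 HN2]]; exists N; intros n Hn; unfold Rdist.
      destruct (constructive_indefinite_description _ (S n)) as [p [H1 H2]]; simpl.
      apply Rlt_trans with (1 := H2); apply Rle_lt_trans with (2 := HN1).
      apply Rinv_le_contravar; [apply lt_0_INR; lia|].
      apply le_INR in Hn; lra.
Qed.

Lemma Cbounded_subseq (u : nat -> C) M : (forall n, Cnorm (u n) <= M) ->
  exists phi l, (forall n, (n <= phi n)%nat) /\ Ccv (fun n => u (phi n)) l.
Proof.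
  intros B.
  destruct (bounded_subseq (fun n => re (u n)) M) as [p1 [l1 [A1 B1]]].
  { intros n; eapply Rle_trans; [apply Rabs_re_le|apply B]. }
  destruct (bounded_subseq (fun n => im (u (p1 n))) M) as [p2 [l2 [A2 B2]]].
  { intros n; eapply Rle_trans; [apply Rabs_im_le|apply B]. }
  exists (fun n => p1 (p2 n)), (mkC l1 l2); split.
  - intros n; specialize (A2 n); specialize (A1 (p2 n)); lia.
  - apply Ccv_re_im; simpl; auto.
    intros eps He; destruct (B1 eps He) as [N K]; exists N; intros n Hn; apply K.
    specialize (A2 n); lia.
Qed.

Definition pcv (Z : nat -> nat -> C) (z : nat -> C) : Prop :=
  forall k, Ccv (fun n => Z n k) (z k).

(* Cantor's diagonal extraction *)
Lemma product_compact (Z : nat -> nat -> C) (M : nat -> R) :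
  (forall n k, Cnorm (Z n k) <= M k) ->
  exists phi z, (forall n, (n <= phi n)%nat) /\ pcv (fun n => Z (phi n)) z.
Proof.
  intros B.
  assert (S : forall (sk : (nat -> nat) * nat), exists phi, (forall n, (n <= phi n)%nat) /\
     exists l, Ccv (fun n => Z (fst sk (phi n)) (snd sk)) l).
  { intros [s k]; destruct (Cbounded_subseq (fun n => Z (s n) k) (M k)) as [p [l [H1 H2]]]; simpl; eauto. }
  destruct (choice _ S) as [F HF].
  set (s := fix s (k : nat) : nat -> nat :=
     match k with O => fun n => n | S k => fun n => s k (F (s k, k) n) end).
  assert (Hs : forall k n, (n <= s k n)%nat).
  { induction k; intros n; simpl; auto.
    destruct (HF (s k, k)) as [H1 _]; specialize (H1 n); specialize (IHk (F (s k, k) n)); lia. }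
  assert (Hl : forall k, exists l, Ccv (fun n => Z (s (Datatypes.S k) n) k) l).
  { intros k; destruct (HF (s k, k)) as [_ H]; exact H. }
  destruct (choice _ Hl) as [z Hz].
  assert (Hd : forall k j n, exists i, (n <= i)%nat /\ s (j + k)%nat n = s k i).
  { intros k; induction j; intros n.
    - exists n; split; auto.
    - simpl. destruct (IHj (F (s (j+k)%nat, (j+k)%nat) n)) as [i [H1 H2]].
      exists i; split; auto. destruct (HF (s (j+k)%nat, (j+k)%nat)) as [H _]; specialize (H n); lia. }
  exists (fun n => s n n), z; split; auto.
  intros k eps He; destruct (Hz k eps He) as [N K].
  exists (N + Datatypes.S k)%nat; intros n Hn.
  destruct (Hd (Datatypes.S k) (n - Datatypes.S k)%nat n) as [i [H1 H2]].
  replace (n - Datatypes.S k + Datatypes.S k)%nat with n in H2 by lia.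
  rewrite H2; apply K; lia.
Qed.

(** Weierstrass' theorem with sequential hypotheses, so that no topology on the countable product
    has to be set up. *)
Lemma max_exists (A : (nat -> C) -> Prop) (M : nat -> R) (f : (nat -> C) -> R) z0 :
  A z0 -> (forall z k, A z -> Cnorm (z k) <= M k) ->
  (forall Z z, (forall n, A (Z n)) -> pcv Z z -> A z) ->
  (forall Z z, (forall n, A (Z n)) -> pcv Z z -> Un_cv (fun n => f (Z n)) (f z)) ->
  exists z, A z /\ forall y, A y -> f y <= f z.
Proof.
  intros H0 HB Hcl Hc.
  assert (Hbd : bound (fun r => exists z, A z /\ r = f z)).
  { apply NNPP; intros Hn.
    assert (S : forall n : nat, exists z, A z /\ INR n < f z).
    { intros n; apply NNPP; intros Hk; apply Hn; exists (INR n); intros r [z [Hz ->]].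
      apply Rnot_lt_le; intros Hl; apply Hk; eauto. }
    destruct (choice _ S) as [Z HZ].
    destruct (product_compact Z M) as [phi [z [Hp Hz]]].
    { intros n k; apply HB, HZ. }
    assert (HA : forall n, A (Z (phi n))) by (intros; apply HZ).
    pose proof (Hc _ _ HA Hz) as Hlim.
    destruct (Hlim 1 Rlt_0_1) as [N K].
    destruct (INR_unbounded (f z + 1)) as [m Hm].
    pose proof (K (N + m)%nat ltac:(lia)) as K1; unfold Rdist in K1.
    destruct (HZ (phi (N + m)%nat)) as [_ K2].
    pose proof (Hp (N+m)%nat) as K3; assert (K4 : (m <= phi (N + m)%nat)%nat) by lia.
    apply le_INR in K4. apply Rabs_def2 in K1; lra. }
  destruct (completeness _ Hbd) as [s [Hs1 Hs2]].
  { exists (f z0); eauto. }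
  assert (S : forall n : nat, exists z, A z /\ s - / (INR n + 1) < f z).
  { intros n; apply NNPP; intros Hk.
    assert (P : 0 < / (INR n + 1)) by (apply Rinv_0_lt_compat; pose proof (pos_INR n); lra).
    assert (s <= s - / (INR n + 1)); [|lra].
    apply Hs2; intros r [z [Hz ->]]; apply Rnot_lt_le; intros Hl; apply Hk; eauto. }
  destruct (choice _ S) as [Z HZ].
  destruct (product_compact Z M) as [phi [z [Hp Hz]]].
  { intros n k; apply HB, HZ. }
  assert (HA : forall n, A (Z (phi n))) by (intros; apply HZ).
  pose proof (Hc _ _ HA Hz) as Hlim.
  exists z; split; [exact (Hcl _ _ HA Hz)|].
  assert (E : s <= f z).
  { apply Rnot_lt_le; intros Hl.
    destruct (Hlim ((s - f z)/2)) as [N K]; [lra|].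
    destruct (archimed_cor1 ((s - f z)/2)) as [m [Hm1 Hm2]]; [lra|].
    pose proof (K (N + m)%nat ltac:(lia)) as K1; unfold Rdist in K1.
    destruct (HZ (phi (N + m)%nat)) as [_ K2].
    pose proof (Hp (N+m)%nat) as K3; assert (K4 : (m <= phi (N + m)%nat)%nat) by lia.
    apply le_INR in K4.
    assert (/ (INR (phi (N + m)%nat) + 1) <= / INR m).
    { apply Rinv_le_contravar; [apply lt_0_INR; lia|lra]. }
    apply Rabs_def2 in K1; lra. }
  intros y Hy; apply Rle_trans with s; auto; apply Hs1; eauto.
Qed.

(** * Polynomials in countably many variables *)

(** Variables 0, 1, 2 will hold the point [x] of C^3 and variable [3 + j] the value [t_j]; an
    infinite supply lets all stages share one type. *)
Inductive npoly : Type :=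
| NC : C -> npoly
| NV : nat -> npoly
| NA : npoly -> npoly -> npoly
| NM : npoly -> npoly -> npoly.

Fixpoint neval (p : npoly) (z : nat -> C) : C :=
  match p with
  | NC c => c
  | NV k => z k
  | NA p q => Cadd (neval p z) (neval q z)
  | NM p q => Cmul (neval p z) (neval q z)
  end.

Fixpoint nder (p : npoly) (z u : nat -> C) : C :=
  match p with
  | NC c => C0
  | NV k => u k
  | NA p q => Cadd (nder p z u) (nder q z u)
  | NM p q => Cadd (Cmul (neval p z) (nder q z u)) (Cmul (nder p z u) (neval q z))
  end.

Lemma neval_pcv p Z z : pcv Z z -> Ccv (fun n => neval p (Z n)) (neval p z).
Proof.
  intros H; induction p; simpl; [apply Ccv_const|apply H|apply Ccv_add|apply Ccv_mul]; auto.
Qed.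

Definition zmove (z : nat -> C) (h : C) (u : nat -> C) : nat -> C :=
  fun k => Cadd (z k) (Cmul h (u k)).

(** Taylor expansion with the [h^2] term kept apart from the cubic remainder: its cross term with
    [p(z)] has order [r^2], like the expected gain, and disappears only in the mean over rotations
    of [h]. *)
Lemma neval_zmove p z u : exists S R B, 0 <= B /\ forall h,
  neval p (zmove z h u) =
    Cadd (Cadd (neval p z) (Cmul h (nder p z u)))
         (Cadd (Cmul (Cmul h h) S) (Cmul (Cmul (Cmul h h) h) (R h)))
  /\ (Cnorm h <= 1 -> Cnorm (R h) <= B).
Proof.
  induction p as [c|k|p [S1 [R1 [B1 [P1 H1]]]] q [S2 [R2 [B2 [P2 H2]]]]
                 |p [S1 [R1 [B1 [P1 H1]]]] q [S2 [R2 [B2 [P2 H2]]]]]; simpl.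
  - exists C0, (fun _ => C0), 0; split; [lra|]; intros h; split; [ring|rewrite Cnorm_0; lra].
  - exists C0, (fun _ => C0), 0; split; [lra|]; intros h; split;
      [unfold zmove; ring|rewrite Cnorm_0; lra].
  - exists (Cadd S1 S2), (fun h => Cadd (R1 h) (R2 h)), (B1 + B2); split; [lra|].
    intros h; destruct (H1 h) as [E1 N1]; destruct (H2 h) as [E2 N2]; split.
    + rewrite E1, E2; ring.
    + intros Hh; eapply Rle_trans; [apply Cnorm_triang|]; specialize (N1 Hh); specialize (N2 Hh); lra.
  - set (a := neval p z) in *; set (a' := neval q z) in *.
    set (b := nder p z u) in *; set (b' := nder q z u) in *.
    exists (Cadd (Cadd (Cmul a S2) (Cmul b b')) (Cmul S1 a')).
    exists (fun h => Cadd (Cadd (Cadd (Cmul b S2) (Cmul S1 b')) (Cadd (Cmul a (R2 h)) (Cmul (R1 h) a')))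
      (Cadd (Cmul h (Cadd (Cmul S1 S2) (Cadd (Cmul b (R2 h)) (Cmul (R1 h) b'))))
        (Cadd (Cmul (Cmul h h) (Cadd (Cmul S1 (R2 h)) (Cmul (R1 h) S2)))
              (Cmul (Cmul (Cmul h h) h) (Cmul (R1 h) (R2 h)))))).
    exists ((Cnorm b * Cnorm S2 + Cnorm S1 * Cnorm b' + (Cnorm a * B2 + B1 * Cnorm a'))
      + (Cnorm S1 * Cnorm S2 + (Cnorm b * B2 + B1 * Cnorm b')
        + ((Cnorm S1 * B2 + B1 * Cnorm S2) + B1 * B2))).
    pose proof (Cnorm_ge0 a); pose proof (Cnorm_ge0 a'); pose proof (Cnorm_ge0 b);
    pose proof (Cnorm_ge0 b'); pose proof (Cnorm_ge0 S1); pose proof (Cnorm_ge0 S2).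
    split; [repeat apply Rplus_le_le_0_compat; apply Rmult_le_pos; auto|].
    intros h; destruct (H1 h) as [E1 N1]; destruct (H2 h) as [E2 N2]; split.
    + rewrite E1, E2; ring.
    + intros Hh; specialize (N1 Hh); specialize (N2 Hh).
      pose proof (Cnorm_ge0 (R1 h)); pose proof (Cnorm_ge0 (R2 h)); pose proof (Cnorm_ge0 h).
      assert (S : forall x y X Y, Cnorm x <= X -> Cnorm y <= Y -> Cnorm (Cadd x y) <= X + Y)
        by (intros; eapply Rle_trans; [apply Cnorm_triang|lra]).
      assert (P : forall x y X Y, Cnorm x <= X -> Cnorm y <= Y -> Cnorm (Cmul x y) <= X * Y)
        by (intros; rewrite Cnorm_mul; apply Rmult_le_compat; auto using Cnorm_ge0).
      assert (P1h : forall x X, Cnorm x <= X -> Cnorm (Cmul h x) <= X)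
        by (intros x X Hx; pose proof (Cnorm_ge0 x); rewrite Cnorm_mul; nra).
      repeat apply S; try (apply P; auto; lra).
      * apply P1h; repeat apply S; apply P; auto; lra.
      * replace (Cmul (Cmul h h) (Cadd (Cmul S1 (R2 h)) (Cmul (R1 h) S2)))
          with (Cmul h (Cmul h (Cadd (Cmul S1 (R2 h)) (Cmul (R1 h) S2)))) by ring.
        do 2 apply P1h; apply S; apply P; auto; lra.
      * replace (Cmul (Cmul (Cmul h h) h) (Cmul (R1 h) (R2 h)))
          with (Cmul h (Cmul h (Cmul h (Cmul (R1 h) (R2 h))))) by ring.
        do 3 apply P1h; apply P; auto.
Qed.

(** A finite substitute for the circle mean of a subharmonic function: over these four points both
    [h] and [h^2] sum to zero. *)
Definition sum4 (f : C -> R) (r : R) : R :=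
  f (mkC r 0) + f (mkC 0 r) + f (mkC (- r) 0) + f (mkC 0 (- r)).

Lemma sum4_quadratic a b S r :
  sum4 (fun h => n2 (Cadd (Cadd a (Cmul h b)) (Cmul (Cmul h h) S))) r
  = 4 * n2 a + 4 * (r * r) * n2 b + 4 * (r * r) * (r * r) * n2 S.
Proof. unfold sum4, n2; simpl; ring. Qed.

Lemma n2_add_diff v e V E : Cnorm v <= V -> Cnorm e <= E ->
  Rabs (n2 (Cadd v e) - n2 v) <= E * (2 * V + E).
Proof.
  intros Hv He; rewrite <- !Cnorm_sqr.
  pose proof (Cnorm_ge0 v); pose proof (Cnorm_ge0 e); pose proof (Cnorm_ge0 (Cadd v e)).
  pose proof (Cnorm_triang v e).
  assert (Cnorm v <= Cnorm (Cadd v e) + Cnorm e).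
  { replace v with (Cadd (Cadd v e) (Copp e)) at 1 by ring.
    eapply Rle_trans; [apply Cnorm_triang|rewrite Cnorm_opp; lra]. }
  set (s := Cnorm (Cadd v e)) in *; set (t := Cnorm v) in *; set (w := Cnorm e) in *.
  assert (Rabs (s - t) <= E) by (apply Rabs_le; lra).
  replace (s * s - t * t) with ((s - t) * (s + t)) by ring.
  rewrite Rabs_mult; apply Rmult_le_compat; try apply Rabs_pos; auto.
  rewrite Rabs_pos_eq; lra.
Qed.

Lemma sum4_n2_neval p z u : exists K, 0 <= K /\ forall r, 0 < r <= 1 ->
  Rabs (sum4 (fun h => n2 (neval p (zmove z h u))) r
        - (4 * n2 (neval p z) + 4 * (r * r) * n2 (nder p z u))) <= K * (r * r * r).
Proof.
  destruct (neval_zmove p z u) as [S [Rm [B [HB H]]]].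
  set (a := neval p z) in *; set (b := nder p z u) in *.
  set (V := Cnorm a + Cnorm b + Cnorm S).
  pose proof (Cnorm_ge0 a); pose proof (Cnorm_ge0 b); pose proof (Cnorm_ge0 S).
  assert (HV : 0 <= V) by (unfold V; lra).
  pose proof (n2_ge0 S) as HS.
  assert (Q : 0 <= B * (2 * V + B)) by (apply Rmult_le_pos; lra).
  exists (4 * (B * (2 * V + B)) + 4 * n2 S); split; [lra|].
  intros r Hr.
  assert (Key : forall h, Cnorm h = r ->
    Rabs (n2 (neval p (zmove z h u)) - n2 (Cadd (Cadd a (Cmul h b)) (Cmul (Cmul h h) S)))
      <= B * (2 * V + B) * (r * r * r)).
  { intros h Eh; destruct (H h) as [E N]; rewrite E.
    assert (Hh : Cnorm h <= 1) by lra. specialize (N Hh).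
    replace (Cadd (Cadd a (Cmul h b)) (Cadd (Cmul (Cmul h h) S) (Cmul (Cmul (Cmul h h) h) (Rm h))))
      with (Cadd (Cadd (Cadd a (Cmul h b)) (Cmul (Cmul h h) S)) (Cmul (Cmul (Cmul h h) h) (Rm h))) by ring.
    assert (r3 : 0 <= r * r * r <= 1) by (split; [repeat apply Rmult_le_pos; lra|]; assert (r * r <= 1) by nra; nra).
    eapply Rle_trans; [apply n2_add_diff with (V := V) (E := B * (r * r * r))|].
    - unfold V; repeat (eapply Rle_trans; [apply Cnorm_triang|]).
      pose proof (Cnorm_triang a (Cmul h b)); rewrite !Cnorm_mul, Eh in *.
      assert (r * r <= 1) by nra. nra.
    - rewrite !Cnorm_mul, Eh; pose proof (Cnorm_ge0 (Rm h)); nra.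
    - assert (B * (r * r * r) <= B) by nra.
      assert (0 <= B * (r * r * r)) by nra.
      replace (B * (2 * V + B) * (r * r * r)) with (B * (r * r * r) * (2 * V + B)) by ring.
      apply Rmult_le_compat_l; lra. }
  assert (sq : forall x, x = r * r -> sqrt x = r) by (intros x ->; apply sqrt_square; lra).
  assert (N1 : Cnorm (mkC r 0) = r) by (apply sq; simpl; ring).
  assert (N2 : Cnorm (mkC 0 r) = r) by (apply sq; simpl; ring).
  assert (N3 : Cnorm (mkC (- r) 0) = r) by (apply sq; simpl; ring).
  assert (N4 : Cnorm (mkC 0 (- r)) = r) by (apply sq; simpl; ring).
  apply Key in N1; apply Key in N2; apply Key in N3; apply Key in N4.
  pose proof (sum4_quadratic a b S r) as E4; unfold sum4 in *.
  apply Rabs_le_inv in N1; apply Rabs_le_inv in N2; apply Rabs_le_inv in N3; apply Rabs_le_inv in N4.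
  assert (rr : 4 * (r * r) * (r * r) * n2 S <= 4 * n2 S * (r * r * r)).
  { replace (4 * (r * r) * (r * r) * n2 S) with (4 * n2 S * (r * r * r) * r) by ring.
    rewrite <- (Rmult_1_r (4 * n2 S * (r * r * r))) at 2.
    apply Rmult_le_compat_l; [|lra]. repeat apply Rmult_le_pos; lra. }
  assert (0 <= 4 * (r * r) * (r * r) * n2 S) by (repeat apply Rmult_le_pos; lra).
  apply Rabs_le; lra.
Qed.

(** * Penalized maximization *)

Definition penalty (Fs : list npoly) (z : nat -> C) : R :=
  fold_right (fun F s => n2 (neval F z) + s) 0 Fs.

Definition sqnorm (N : nat) (z : nat -> C) : R :=
  nat_rect (fun _ => R) 0 (fun k s => s + n2 (z k)) N.

(** Along a direction [|g|^2] alone need not increase strictly; the multiple of [|z|^2] supplies the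
    strict gain, and [e] is later taken so small that this term costs at most [1/(m+1)]. *)
Definition phi (g : npoly) (e L : R) (N : nat) (Fs : list npoly) (z : nat -> C) : R :=
  n2 (neval g z) + e * sqnorm N z - L * penalty Fs z.

Lemma penalty_ge0 Fs z : 0 <= penalty Fs z.
Proof. induction Fs; simpl; [lra|pose proof (n2_ge0 (neval a z)); lra]. Qed.

Lemma penalty_In Fs F z : In F Fs -> n2 (neval F z) <= penalty Fs z.
Proof.
  induction Fs; simpl; [tauto|]; intros [->|H].
  - pose proof (penalty_ge0 Fs z); lra.
  - pose proof (n2_ge0 (neval a z)); specialize (IHFs H); lra.
Qed.

Lemma sqnorm_ge0 N z : 0 <= sqnorm N z.
Proof. induction N; simpl; [lra|pose proof (n2_ge0 (z N)); lra]. Qed.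

Lemma sqnorm_ge N z k : (k < N)%nat -> n2 (z k) <= sqnorm N z.
Proof.
  induction N; [lia|]; intros H; simpl.
  destruct (Nat.eq_dec k N) as [->|Hn].
  - pose proof (sqnorm_ge0 N z); lra.
  - pose proof (n2_ge0 (z N)); assert (k < N)%nat by lia; specialize (IHN H1); lra.
Qed.

Lemma sqnorm_bound N z M : (forall k, Cnorm (z k) <= M k) ->
  sqnorm N z <= nat_rect (fun _ => R) 0 (fun k s => s + M k * M k) N.
Proof.
  intros H; induction N; simpl; [lra|]; pose proof (n2_le_Cnorm _ _ (H N)); lra.
Qed.

Lemma Un_cv_const c : Un_cv (fun _ => c) c.
Proof. intros eps He; exists O; intros; unfold Rdist; rewrite Rminus_diag, Rabs_R0; auto. Qed.

Lemma penalty_pcv Fs Z z : pcv Z z -> Un_cv (fun n => penalty Fs (Z n)) (penalty Fs z).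
Proof.
  intros H; induction Fs; simpl; [apply Un_cv_const|].
  apply CV_plus; auto; apply Ccv_n2, neval_pcv; auto.
Qed.

Lemma sqnorm_pcv N Z z : pcv Z z -> Un_cv (fun n => sqnorm N (Z n)) (sqnorm N z).
Proof.
  intros H; induction N; simpl; [apply Un_cv_const|].
  apply CV_plus; auto; apply Ccv_n2, H.
Qed.

Lemma phi_pcv g e L N Fs Z z : pcv Z z -> Un_cv (fun n => phi g e L N Fs (Z n)) (phi g e L N Fs z).
Proof.
  intros H; unfold phi; apply CV_minus; [apply CV_plus|].
  - apply Ccv_n2, neval_pcv; auto.
  - apply CV_mult; [apply Un_cv_const|apply sqnorm_pcv; auto].
  - apply CV_mult; [apply Un_cv_const|apply penalty_pcv; auto].
Qed.

Lemma sum4_penalty Fs z u : (forall F, In F Fs -> nder F z u = C0) ->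
  exists K, 0 <= K /\ forall r, 0 < r <= 1 ->
  Rabs (sum4 (fun h => penalty Fs (zmove z h u)) r - 4 * penalty Fs z) <= K * (r * r * r).
Proof.
  induction Fs as [|F Fs IH]; intros H.
  - exists 0; split; [lra|]; intros r Hr; unfold sum4; simpl.
    apply Rabs_le; lra.
  - destruct IH as [K1 [P1 H1]]; [intros; apply H; right; auto|].
    destruct (sum4_n2_neval F z u) as [K2 [P2 H2]].
    rewrite (H F) in H2 by (left; auto).
    assert (E0 : n2 C0 = 0) by (unfold n2; simpl; ring); rewrite E0 in H2.
    exists (K1 + K2); split; [lra|]; intros r Hr.
    specialize (H1 r Hr); specialize (H2 r Hr).
    apply Rabs_le_inv in H1; apply Rabs_le_inv in H2.
    unfold sum4 in *; simpl in *; apply Rabs_le; lra.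
Qed.

Lemma sum4_sqnorm N z u r :
  sum4 (fun h => sqnorm N (zmove z h u)) r = 4 * sqnorm N z + 4 * (r * r) * sqnorm N u.
Proof.
  induction N; unfold sum4 in *; simpl; [ring|].
  unfold zmove, n2 in *; simpl in *; lra.
Qed.

(* Averaged over the four points h with h^4 = r^4, |g|^2 does not decrease and |F|^2 changes by O(r^3) when
   the derivative of F along u vanishes, whereas |z|^2 gains r^2|u|^2. *)
Lemma phi_no_local_max g e L N Fs z u k :
  0 < e -> 0 <= L -> (k < N)%nat -> u k <> C0 ->
  (forall F, In F Fs -> nder F z u = C0) ->
  exists r0, 0 < r0 /\ forall r, 0 < r < r0 -> exists h, Cnorm h <= r /\
    phi g e L N Fs z < phi g e L N Fs (zmove z h u).
Proof.
  intros He HL Hk Hu HF.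
  destruct (sum4_n2_neval g z u) as [K1 [P1 H1]].
  destruct (sum4_penalty Fs z u HF) as [K2 [P2 H2]].
  assert (Hs : 0 < sqnorm N u).
  { eapply Rlt_le_trans; [apply (n2_pos _ Hu)|apply sqnorm_ge; auto]. }
  set (K := K1 + L * K2 + 1).
  assert (HK : 0 < K) by (unfold K; pose proof (Rmult_le_pos _ _ HL P2); lra).
  exists (Rmin 1 (e * sqnorm N u / K)); split.
  { apply Rmin_pos; [lra|]; apply Rdiv_lt_0_compat; auto; apply Rmult_lt_0_compat; auto. }
  intros r [Hr0 Hr].
  assert (Hr1 : 0 < r <= 1) by (split; auto; apply Rlt_le; eapply Rlt_le_trans; [apply Hr|apply Rmin_l]).
  assert (Hr2 : r * K < e * sqnorm N u).
  { apply Rlt_le_trans with (e * sqnorm N u / K * K); [|right; field; lra].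
    apply Rmult_lt_compat_r; auto; eapply Rlt_le_trans; [apply Hr|apply Rmin_r]. }
  specialize (H1 r Hr1); specialize (H2 r Hr1).
  pose proof (sum4_sqnorm N z u r) as H3.
  apply Rabs_le_inv in H1; apply Rabs_le_inv in H2.
  pose proof (n2_ge0 (nder g z u)) as Hb.
  assert (Tot : 4 * phi g e L N Fs z < sum4 (fun h => phi g e L N Fs (zmove z h u)) r).
  { replace (sum4 (fun h => phi g e L N Fs (zmove z h u)) r) with
      (sum4 (fun h => n2 (neval g (zmove z h u))) r + e * sum4 (fun h => sqnorm N (zmove z h u)) r
       - L * sum4 (fun h => penalty Fs (zmove z h u)) r) by (unfold sum4, phi; ring).
    rewrite H3. unfold phi.
    assert (Hrr : 0 < r * r) by nra.
    assert (A : L * sum4 (fun h => penalty Fs (zmove z h u)) r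
       <= L * (4 * penalty Fs z + K2 * (r * r * r))) by (apply Rmult_le_compat_l; lra).
    assert (B : 0 <= 4 * (r * r) * n2 (nder g z u)) by (apply Rmult_le_pos; lra).
    assert (D : (r * r) * (r * K) < (r * r) * (e * sqnorm N u)) by (apply Rmult_lt_compat_l; auto).
    assert (E : (r*r) * (r * K) = (K1 + L * K2 + 1) * (r * r * r)) by (unfold K; ring).
    assert (F : 0 < r * r * r) by nra.
    assert (G : 0 <= (r * r) * (e * sqnorm N u)) by nra.
    nra. }
  assert (sq : forall x, x = r * r -> sqrt x <= r) by (intros x ->; right; apply sqrt_square; lra).
  unfold sum4 in Tot.
  destruct (Rlt_le_dec (phi g e L N Fs z) (phi g e L N Fs (zmove z (mkC r 0) u))) as [|T1].
  { eexists; split; [|eassumption]; apply sq; simpl; ring. }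
  destruct (Rlt_le_dec (phi g e L N Fs z) (phi g e L N Fs (zmove z (mkC 0 r) u))) as [|T2].
  { eexists; split; [|eassumption]; apply sq; simpl; ring. }
  destruct (Rlt_le_dec (phi g e L N Fs z) (phi g e L N Fs (zmove z (mkC (-r) 0) u))) as [|T3].
  { eexists; split; [|eassumption]; apply sq; simpl; ring. }
  destruct (Rlt_le_dec (phi g e L N Fs z) (phi g e L N Fs (zmove z (mkC 0 (-r)) u))) as [|T4].
  { eexists; split; [|eassumption]; apply sq; simpl; ring. }
  lra.
Qed.

(** * Linear algebra: directions annihilated by few derivatives *)

Lemma homogeneous_system N : forall rows : list (nat -> C), (length rows < N)%nat ->
  exists u : nat -> C, (exists k, (k < N)%nat /\ u k <> C0) /\ (forall k, (N <= k)%nat -> u k = C0) /\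
    forall r, In r rows -> Csum N (fun k => Cmul (r k) (u k)) = C0.
Proof.
  induction N; intros rows Hl; [lia|].
  (* Gaussian elimination of the last unknown: a row with a nonzero entry there is solved for it; if
     there is none, the last unit vector is a solution. *)
  destruct (classic (exists r, In r rows /\ r N <> C0)) as [[r [Hr Hn]]|Hn].
  - apply in_split in Hr; destruct Hr as [l1 [l2 ->]].
    set (elim := fun (r' : nat -> C) k => Csub (r' k) (Cmul (Cmul (r' N) (Cinv (r N))) (r k))).
    destruct (IHN (map elim (l1 ++ l2))) as [u [[k [Hk Huk]] [Hsup Hz]]].
    { rewrite length_map; rewrite length_app in *; simpl in *; lia. }
    set (uN := Copp (Cmul (Cinv (r N)) (Csum N (fun k => Cmul (r k) (u k))))).
    set (v := fun k => if Nat.eq_dec k N then uN else u k).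
    assert (Ev : forall f, Csum (S N) (fun k => Cmul (f k) (v k))
       = Cadd (Csum N (fun k => Cmul (f k) (u k))) (Cmul (f N) uN)).
    { intros f; rewrite Csum_S; unfold v at 2; destruct (Nat.eq_dec N N); [|congruence].
      f_equal; apply Csum_ext; intros j Hj; unfold v; destruct (Nat.eq_dec j N); [lia|reflexivity]. }
    assert (Ei : Cmul (r N) (Cinv (r N)) = C1) by (apply Cinv_r; auto).
    exists v; repeat split.
    + exists k; split; [lia|]; unfold v; destruct (Nat.eq_dec k N); [lia|auto].
    + intros j Hj; unfold v; destruct (Nat.eq_dec j N); [lia|apply Hsup; lia].
    + intros r' Hr'; rewrite Ev.
      assert (D : r' = r \/ In r' (l1 ++ l2)).
      { apply in_app_or in Hr'; destruct Hr' as [|[|]]; auto; right; apply in_or_app; auto. }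
      destruct D as [->|D].
      * unfold uN.
        transitivity (Csub (Csum N (fun k => Cmul (r k) (u k)))
          (Cmul (Cmul (r N) (Cinv (r N))) (Csum N (fun k => Cmul (r k) (u k))))); [ring|].
        rewrite Ei; ring.
      * assert (E := Hz (elim r') (in_map elim _ _ D)).
        transitivity (Csum N (fun k => Cmul (elim r' k) (u k))); [|exact E].
        unfold uN, elim.
        rewrite (Csum_ext _ (fun k => Cmul (Csub (r' k) (Cmul (Cmul (r' N) (Cinv (r N))) (r k))) (u k))
          (fun k => Cadd (Cmul (r' k) (u k))
              (Cmul (Copp (Cmul (r' N) (Cinv (r N)))) (Cmul (r k) (u k))))) by (intros; ring).
        rewrite Csum_add, Csum_scal; ring.
  - exists (fun k => if Nat.eq_dec k N then C1 else C0); repeat split.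
    + exists N; split; [lia|]; destruct (Nat.eq_dec N N); [apply C1_neq0|congruence].
    + intros k Hk; destruct (Nat.eq_dec k N); [lia|reflexivity].
    + intros r Hr; rewrite Csum_S, Csum_0.
      * destruct (Nat.eq_dec N N); [|congruence].
        replace (r N) with C0; [ring|].
        apply NNPP; intros Hc; apply Hn; exists r; split; auto.
      * intros k Hk; destruct (Nat.eq_dec k N); [lia|ring].
Qed.

Definition unit_at (k : nat) : nat -> C := fun j => if Nat.eq_dec j k then C1 else C0.

Lemma Csum_unit N n u : (n < N)%nat -> Csum N (fun k => Cmul (unit_at k n) (u k)) = u n.
Proof.
  induction N; [lia|]; intros Hn; rewrite Csum_S; unfold unit_at at 2.
  destruct (Nat.eq_dec n N) as [->|Hne].
  - rewrite Csum_0; [ring|].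
    intros k Hk; unfold unit_at; destruct (Nat.eq_dec N k); [lia|ring].
  - rewrite IHN by lia; ring.
Qed.

(** Linearity in [u] turns the vanishing of a directional derivative into one row for
    [homogeneous_system]. *)
Lemma nder_row N p z u : (forall k, (N <= k)%nat -> u k = C0) ->
  nder p z u = Csum N (fun k => Cmul (nder p z (unit_at k)) (u k)).
Proof.
  intros Hu; induction p; simpl.
  - rewrite Csum_0; auto; intros; ring.
  - destruct (Nat.lt_ge_cases n N) as [Hn|Hn].
    + symmetry; apply Csum_unit; auto.
    + rewrite Hu by auto; rewrite Csum_0; auto.
      intros k Hk; unfold unit_at; destruct (Nat.eq_dec n k); [lia|ring].
  - rewrite IHp1, IHp2, <- Csum_add; apply Csum_ext; intros; ring.
  - rewrite IHp1, IHp2, <- Csum_scal.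
    transitivity (Cadd (Csum N (fun k => Cmul (neval p1 z) (Cmul (nder p2 z (unit_at k)) (u k))))
      (Cmul (neval p2 z) (Csum N (fun k => Cmul (nder p1 z (unit_at k)) (u k))))); [ring|].
    rewrite <- Csum_scal, <- Csum_add; apply Csum_ext; intros; ring.
Qed.

(** * Spherical walls in C^3 *)

(** The origin for [c = 0], then each unit vector and its multiple by the imaginary unit. Comparing
    squared distances with that to the origin yields the real and imaginary parts of all
    coordinates. From [c = 7] on the centre is the origin again. *)
Definition center (c i : nat) : C :=
  if Nat.eq_dec c (2 * i + 1) then C1 else if Nat.eq_dec c (2 * i + 2) then Ci else C0.

Definition Qd (c : nat) (z : nat -> C) : R :=
  n2 (Csub (z 0%nat) (center c 0)) + n2 (Csub (z 1%nat) (center c 1)) + n2 (Csub (z 2%nat) (center c 2)).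

Lemma center_norm c i : Cnorm (center c i) <= 1.
Proof.
  unfold center; destruct (Nat.eq_dec _ _); [rewrite Cnorm_1; lra|].
  destruct (Nat.eq_dec _ _); [|rewrite Cnorm_0; lra].
  apply Cnorm_le_n2; unfold n2; simpl; lra.
Qed.

Lemma Qd_injective z z' : (forall c, Qd c z = Qd c z') -> forall i, (i < 3)%nat -> z i = z' i.
Proof.
  intros H.
  pose proof (H 0%nat) as H0; pose proof (H 1%nat) as H1; pose proof (H 2%nat) as H2;
  pose proof (H 3%nat) as H3; pose proof (H 4%nat) as H4; pose proof (H 5%nat) as H5; pose proof (H 6%nat) as H6.
  unfold Qd, center, n2 in *; simpl in *.
  intros i Hi; assert (D : i = 0%nat \/ i = 1%nat \/ i = 2%nat) by lia.
  destruct D as [->|[->| ->]]; apply C_ext; lra.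
Qed.

Definition wall_center (n : nat) : nat := fst (of_nat n).
(** Every pair of a centre index and a nonnegative rational level occurs. Wall 0 has centre 0 and
    level 0, which keeps [K] away from the origin, hence the base point out of the final set. *)
Definition wall_level (n : nat) : R :=
  let k := of_nat (snd (of_nat n)) in INR (fst k) / (INR (snd k) + 1).

(** The divisor 200 serves two purposes. The moves at the walls from [n] on have total length at
    most [2 * weps n]. And the moves after wall [n] change the squared distance to its centre by at
    most [21 * 2 * weps (S n)], which is 42/200 of [weps n] squared and so less than the quarter by
    which the gap may shrink, from one half to one fourth. *)
Fixpoint weps (n : nat) : R :=
  match n with O => 1 | S n => weps n * weps n / 200 end.

Definition inK (z : nat -> C) : Prop :=
  (forall i, (i < 3)%nat -> Cnorm (z i) <= 2) /\
  forall n, weps n * weps n / 4 <= Rabs (Qd (wall_center n) z - wall_level n).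

Lemma weps_bounds n : 0 < weps n <= 1.
Proof. induction n; simpl; [lra|]. split; [apply Rdiv_lt_0_compat; nra|]. nra. Qed.

Lemma wall_exists c r1 r2 : 0 <= r1 < r2 ->
  exists n, wall_center n = c /\ r1 < wall_level n < r2.
Proof.
  intros Hr.
  destruct (archimed_cor1 (r2 - r1)) as [j [Hj1 Hj2]]; [lra|].
  assert (Pj : 0 < INR j) by (apply lt_0_INR; auto).
  destruct (archimed (r1 * INR j)) as [U1 U2].
  assert (Hup : (0 <= up (r1 * INR j))%Z).
  { apply le_IZR; simpl; assert (0 <= r1 * INR j) by (apply Rmult_le_pos; lra); lra. }
  set (i := Z.to_nat (up (r1 * INR j))).
  assert (Ei : INR i = IZR (up (r1 * INR j))) by (rewrite INR_IZR_INZ; f_equal; unfold i; lia).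
  exists (to_nat (c, to_nat (i, pred j))); unfold wall_center, wall_level.
  rewrite cancel_of_to; cbn [fst snd]; rewrite cancel_of_to; cbn [fst snd].
  replace (INR (pred j) + 1) with (INR j) by (rewrite <- S_INR; f_equal; lia).
  split; auto. rewrite Ei; split.
  - apply Rmult_lt_reg_r with (INR j); auto. unfold Rdiv; rewrite Rmult_assoc, Rinv_l; lra.
  - apply Rmult_lt_reg_r with (INR j); auto. unfold Rdiv; rewrite Rmult_assoc, Rinv_l by lra.
    assert (/ INR j * INR j < (r2 - r1) * INR j) by (apply Rmult_lt_compat_r; auto).
    rewrite Rinv_l in H by lra. lra.
Qed.

Lemma Qd_lipschitz c z z' d : 0 <= d <= 1 ->
  (forall i, (i < 3)%nat -> Cnorm (z i) <= 2) -> (forall i, (i < 3)%nat -> Cnorm (Csub (z' i) (z i)) <= d) ->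
  Rabs (Qd c z' - Qd c z) <= 21 * d.
Proof.
  intros Hd Hz Hzz.
  assert (K : forall i, (i < 3)%nat ->
     Rabs (n2 (Csub (z' i) (center c i)) - n2 (Csub (z i) (center c i))) <= 7 * d).
  { intros i Hi.
    replace (Csub (z' i) (center c i)) with
      (Cadd (Csub (z i) (center c i)) (Csub (z' i) (z i))) by ring.
    (* Here [|z_i| + |center| <= 2 + 1 = 3], and [d * (2 * 3 + d) <= 7 * d]. *)
    eapply Rle_trans; [apply n2_add_diff with (V := 3) (E := d); auto|nra].
    eapply Rle_trans; [apply Cnorm_sub_le|]. pose proof (center_norm c i); specialize (Hz i Hi); lra. }
  pose proof (K 0%nat ltac:(lia)) as A0; pose proof (K 1%nat ltac:(lia)) as A1; pose proof (K 2%nat ltac:(lia)) as A2.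
  apply Rabs_le_inv in A0; apply Rabs_le_inv in A1; apply Rabs_le_inv in A2.
  unfold Qd; apply Rabs_le; lra.
Qed.

Lemma Un_cv_le u l M : Un_cv u l -> (forall n, u n <= M) -> l <= M.
Proof.
  intros H B; apply Rnot_lt_le; intros Hl.
  destruct (H (l - M)) as [N K]; [lra|].
  pose proof (K N (le_n _)) as K1; pose proof (B N); unfold Rdist in K1; apply Rabs_def2 in K1; lra.
Qed.

Lemma Un_cv_lt u l M : Un_cv u l -> l < M -> exists N, forall n, (N <= n)%nat -> u n < M.
Proof.
  intros H Hl; destruct (H (M - l)) as [N K]; [lra|].
  exists N; intros n Hn; pose proof (K n Hn) as K1; unfold Rdist in K1; apply Rabs_def2 in K1; lra.
Qed.

Lemma Ccv_Cnorm_lt u l M : Ccv u l -> Cnorm l < M -> exists N, forall n, (N <= n)%nat -> Cnorm (u n) < M.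
Proof.
  intros H Hl; destruct (H (M - Cnorm l)) as [N K]; [lra|].
  exists N; intros n Hn; pose proof (K n Hn) as K1; pose proof (Cnorm_le_sub (u n) l); lra.
Qed.

Lemma zmove_pcv z u h : Ccv h C0 -> pcv (fun n => zmove z (h n) u) z.
Proof.
  intros H k; unfold zmove.
  cut (Ccv (fun n => Cadd (z k) (Cmul (h n) (u k))) (Cadd (z k) (Cmul C0 (u k)))).
  { replace (Cadd (z k) (Cmul C0 (u k))) with (z k) by ring; auto. }
  apply Ccv_add; [apply Ccv_const|apply Ccv_mul; [auto|apply Ccv_const]].
Qed.

(* The margin [2 * weps n] leaves room for all later moves, whose lengths sum to at most that. *)
Definition admissible (f : (nat -> C) -> R) (v0 : R) (m : nat) (T : nat -> R) (n : nat) (z : nat -> C) : Prop :=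
  (forall i, (i < 3)%nat -> Cnorm (z i) + 2 * weps n <= 2) /\
  (forall j, (j < m)%nat -> Cnorm (z (3 + j)%nat) <= T j) /\
  (forall k, (3 + m <= k)%nat -> z k = C0) /\ v0 <= f z.

(** [row] leaves room for one linear condition imposed by the wall, the tangency to its sphere; the
    penalized equations are hidden in the choice of [u]. *)
Definition steerable (f : (nat -> C) -> R) (m : nat) : Prop :=
  forall z row, exists u, (forall k, (3 + m <= k)%nat -> u k = C0) /\
    Csum (3 + m) (fun k => Cmul (row k) (u k)) = C0 /\
    exists r0, 0 < r0 /\ forall r, 0 < r < r0 -> exists h, Cnorm h <= r /\ f z < f (zmove z h u).

(* A point too close to the n-th sphere is moved inside the complex tangent plane of the concentric
   sphere through it: there the squared distance to the centre grows by exactly eps^2. *)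
Lemma wall_step f v0 m T n z :
  (forall Z z, pcv Z z -> Un_cv (fun n => f (Z n)) (f z)) ->
  steerable f m ->
  (forall z, (forall i, (i < 3)%nat -> Cnorm (z i) <= 2) -> (forall j, (j < m)%nat -> Cnorm (z (3 + j)%nat) <= T j) ->
     (forall k, (3 + m <= k)%nat -> z k = C0) -> v0 <= f z -> forall j, (j < m)%nat -> Cnorm (z (3 + j)%nat) < T j) ->
  admissible f v0 m T n z ->
  exists z', admissible f v0 m T (S n) z' /\
    (forall i, (i < 3)%nat -> Cnorm (Csub (z' i) (z i)) <= weps n) /\
    weps n * weps n / 2 <= Rabs (Qd (wall_center n) z' - wall_level n).
Proof.
  intros Hcont Hdir Htest [Hx [Ht [Hsup Hv]]].
  pose proof (weps_bounds n) as He.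
  set (e := weps n) in *.
  assert (He' : weps n + 2 * weps (S n) <= 2 * weps n) by (simpl; fold e; nra).
  fold e in He'.
  destruct (Rle_lt_dec (e * e / 2) (Rabs (Qd (wall_center n) z - wall_level n))) as [Hw|Hw].
  { exists z; repeat split; auto.
    - intros i Hi; specialize (Hx i Hi); lra.
    - intros i Hi; replace (Csub (z i) (z i)) with C0 by ring; rewrite Cnorm_0; lra. }
  set (c := wall_center n) in *.
  set (d := fun y : nat -> C => n2 (Csub (y 0%nat) (z 0%nat)) + n2 (Csub (y 1%nat) (z 1%nat)) + n2 (Csub (y 2%nat) (z 2%nat))).
  set (row := fun k => if Nat.ltb k 3 then Cconj (Csub (z k) (center c k)) else C0).
  (* In the [x]-coordinates this is the ball of radius [e] about [z] in the complex tangent plane;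
     the [t]-coordinates are free within their bounds, so they may follow [x]. *)
  set (A := fun y : nat -> C =>
     Csum 3 (fun k => Cmul (row k) (Csub (y k) (z k))) = C0 /\ d y <= e * e /\
     (forall j, (j < m)%nat -> Cnorm (y (3 + j)%nat) <= T j) /\ (forall k, (3 + m <= k)%nat -> y k = C0)).
  assert (Ad : forall y, A y -> forall i, (i < 3)%nat -> Cnorm (Csub (y i) (z i)) <= e).
  { intros y [_ [Hd _]] i Hi; apply Cnorm_le_n2; [lra|].
    unfold d in Hd.
    pose proof (n2_ge0 (Csub (y 0%nat) (z 0%nat))); pose proof (n2_ge0 (Csub (y 1%nat) (z 1%nat)));
    pose proof (n2_ge0 (Csub (y 2%nat) (z 2%nat))).
    assert (D : i = 0%nat \/ i = 1%nat \/ i = 2%nat) by lia.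
    destruct D as [->|[->| ->]]; lra. }
  assert (A2 : forall y, A y -> forall i, (i < 3)%nat -> Cnorm (y i) + e <= 2).
  { intros y Hy i Hi; pose proof (Ad y Hy i Hi); pose proof (Cnorm_le_sub (y i) (z i)); specialize (Hx i Hi); lra. }
  assert (n20 : n2 C0 = 0) by (unfold n2; simpl; ring).
  assert (Az : A z).
  { split; [|split; [|split]]; auto.
    - apply Csum_0; intros; ring.
    - unfold d; assert (E : forall w, Csub w w = C0) by (intros; ring); rewrite !E, n20; nra. }
  assert (dcv : forall Z y, pcv Z y -> Un_cv (fun n => d (Z n)) (d y)).
  { intros Z y HZ; assert (B : forall i, Un_cv (fun n => n2 (Csub (Z n i) (z i))) (n2 (Csub (y i) (z i)))).
    { intros i; apply Ccv_n2; unfold Csub; apply Ccv_add; [apply HZ|apply Ccv_const]. }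
    unfold d; apply CV_plus; [apply CV_plus|]; apply B. }
  destruct (max_exists A (fun k => if Nat.ltb k 3 then 2 else Rabs (T (k - 3)%nat)) f z Az) as [y [Ay Hmax]].
  { intros y k Hy; destruct (Nat.ltb_spec k 3).
    - pose proof (A2 y Hy k H); lra.
    - destruct Hy as [_ [_ [Hy1 Hy2]]]; destruct (Nat.lt_ge_cases k (3 + m)) as [Hk|Hk].
      + specialize (Hy1 (k - 3)%nat ltac:(lia)); replace (3 + (k - 3))%nat with k in Hy1 by lia.
        eapply Rle_trans; [apply Hy1|apply Rle_abs].
      + rewrite Hy2 by auto; rewrite Cnorm_0; apply Rabs_pos. }
  { intros Z y HZ Hcv; split; [|split; [|split]].
    - apply (Ccv_unique (fun _ : nat => C0)); [|apply Ccv_const].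
      apply (Ccv_ext (fun n => Csum 3 (fun k => Cmul (row k) (Csub (Z n k) (z k))))).
      + intros p; apply HZ.
      + simpl; repeat apply Ccv_add; try apply Ccv_const; (apply Ccv_mul; [apply Ccv_const|]);
          unfold Csub; apply Ccv_add; try apply Ccv_const; apply Hcv.
    - apply (Un_cv_le (fun n => d (Z n))); [apply dcv; auto|intros p; apply HZ].
    - intros j Hj; apply (Ccv_norm_le (fun n => Z n (3 + j)%nat)); [apply Hcv|intros p; apply HZ; auto].
    - intros k Hk; apply (Ccv_unique (fun n => Z n k)); [apply Hcv|].
      apply (Ccv_ext (fun _ => C0)); [|apply Ccv_const].
      intros p; symmetry; apply HZ; auto. }
  { intros Z y HZ Hcv; apply Hcont; auto. }
  assert (Hvy : v0 <= f y) by (eapply Rle_trans; [apply Hv|apply Hmax; auto]).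
  assert (Hty : forall j, (j < m)%nat -> Cnorm (y (3 + j)%nat) < T j).
  { apply Htest; auto.
    - intros i Hi; pose proof (A2 y Ay i Hi); lra.
    - apply Ay.
    - apply Ay. }
  (* A maximum with [d y < e * e] would be interior to [A] along tangent directions, the bounds on
     [t] being strict by [Hty]; a steerable direction would then increase [f] inside [A]. *)
  assert (Hrim : d y = e * e).
  { apply Rle_antisym; [apply Ay|]; apply Rnot_lt_le; intros Hlt.
    destruct (Hdir y row) as [u [Hu1 [Hu2 [r0 [Hr0 Hh]]]]].
    assert (Sh : forall p : nat, exists h, Cnorm h <= / (INR p + 1) /\ f y < f (zmove y h u)).
    { intros p.
      assert (P : 0 < / (INR p + 1)) by (apply Rinv_0_lt_compat; pose proof (pos_INR p); lra).
      destruct (Hh (Rmin (r0 / 2) (/ (INR p + 1)))) as [h [H1 H2]].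
      - split; [apply Rmin_pos; lra|eapply Rle_lt_trans; [apply Rmin_l|lra]].
      - exists h; split; auto; eapply Rle_trans; [apply H1|apply Rmin_r]. }
    destruct (choice _ Sh) as [h Hhh].
    assert (Hh0 : Ccv h C0).
    { intros eps Heps; destruct (archimed_cor1 eps Heps) as [N [HN1 HN2]]; exists N; intros p Hp.
      replace (Csub (h p) C0) with (h p) by ring.
      eapply Rle_lt_trans; [apply Hhh|]; apply Rle_lt_trans with (2 := HN1).
      apply Rinv_le_contravar; [apply lt_0_INR; lia|]; apply le_INR in Hp; lra. }
    pose proof (zmove_pcv y u h Hh0) as Hcv.
    destruct (Un_cv_lt _ _ _ (dcv _ _ Hcv) Hlt) as [N1 K1].
    assert (Q : forall q, (q <= m)%nat -> exists N, forall p, (N <= p)%nat -> forall j, (j < q)%nat ->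
       Cnorm (zmove y (h p) u (3 + j)%nat) < T j).
    { induction q; intros Hq; [exists O; intros; lia|].
      destruct IHq as [N2 K2]; [lia|].
      destruct (Ccv_Cnorm_lt _ _ _ (Hcv (3 + q)%nat) (Hty q ltac:(lia))) as [N3 K3].
      exists (N2 + N3)%nat; intros p Hp j Hj.
      destruct (Nat.eq_dec j q) as [->|]; [apply K3; lia|apply K2; lia]. }
    destruct (Q m (le_n _)) as [N2 K2].
    set (p := (N1 + N2)%nat).
    assert (Am : A (zmove y (h p) u)).
    { split; [|split; [|split]].
      - assert (E : Csum 3 (fun k => Cmul (row k) (u k)) = C0).
        { rewrite <- Hu2.
          assert (G : forall q, Csum (3 + q) (fun k => Cmul (row k) (u k)) = Csum 3 (fun k => Cmul (row k) (u k))).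
          { induction q; [f_equal; lia|]; replace (3 + S q)%nat with (S (3 + q)) by lia; rewrite Csum_S, IHq.
            unfold row at 2; destruct (Nat.ltb_spec (3 + q) 3); [lia|]. ring. }
          symmetry; apply G. }
        destruct Ay as [Ay0 _].
        transitivity (Cadd (Csum 3 (fun k => Cmul (row k) (Csub (y k) (z k))))
           (Cmul (h p) (Csum 3 (fun k => Cmul (row k) (u k))))).
        + unfold zmove; simpl; ring.
        + rewrite Ay0, E; ring.
      - apply Rlt_le, K1; lia.
      - intros j Hj; apply Rlt_le, K2; auto; lia.
      - intros k Hk; unfold zmove; rewrite Hu1 by auto; destruct Ay as [_ [_ [_ Ay4]]]; rewrite Ay4 by auto; ring. }
    pose proof (Hmax _ Am); destruct (Hhh p) as [_ Hgt]; lra. }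
  (* Pythagoras: [y - z] is Hermitian-orthogonal to [z - centre]. Since [Qd c z] was within
     [e * e / 2] of the level, [Qd c y] exceeds the level by more than [e * e / 2]. *)
  assert (HQ : Qd c y = Qd c z + e * e).
  { rewrite <- Hrim; destruct Ay as [Ay0 _].
    assert (E : re (Csum 3 (fun k => Cmul (row k) (Csub (y k) (z k)))) = 0) by (rewrite Ay0; reflexivity).
    unfold Qd, d, row, n2 in *; simpl in *; lra. }
  exists y; repeat split; auto.
  - intros i Hi; pose proof (Ad y Ay i Hi) as B1; pose proof (Cnorm_le_sub (y i) (z i)); specialize (Hx i Hi); lra.
  - apply Ay.
  - apply Ay.
  - apply Rabs_def2 in Hw; rewrite HQ; eapply Rle_trans; [|apply Rle_abs]; lra.
Qed.

(** All walls are treated in turn and a limit is taken. Only the [x]-coordinates move by summable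
    amounts; the [t]-coordinates may jump, so the limit is along a subsequence. This is enough
    because [inK] depends on [x] alone and the remaining conditions are closed. *)
Lemma wall_chain f v0 m T z0 :
  (forall Z z, pcv Z z -> Un_cv (fun n => f (Z n)) (f z)) ->
  steerable f m ->
  (forall z, (forall i, (i < 3)%nat -> Cnorm (z i) <= 2) -> (forall j, (j < m)%nat -> Cnorm (z (3 + j)%nat) <= T j) ->
     (forall k, (3 + m <= k)%nat -> z k = C0) -> v0 <= f z -> forall j, (j < m)%nat -> Cnorm (z (3 + j)%nat) < T j) ->
  admissible f v0 m T 0 z0 ->
  exists z, inK z /\ (forall j, (j < m)%nat -> Cnorm (z (3 + j)%nat) <= T j) /\
    (forall k, (3 + m <= k)%nat -> z k = C0) /\ v0 <= f z.
Proof.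
  intros Hcont Hdir Htest H0.
  assert (S1 : forall p : nat * (nat -> C), exists z', admissible f v0 m T (fst p) (snd p) ->
    admissible f v0 m T (S (fst p)) z' /\
    (forall i, (i < 3)%nat -> Cnorm (Csub (z' i) (snd p i)) <= weps (fst p)) /\
    weps (fst p) * weps (fst p) / 2 <= Rabs (Qd (wall_center (fst p)) z' - wall_level (fst p))).
  { intros [n z]; simpl; destruct (classic (admissible f v0 m T n z)) as [Ha|Ha].
    - destruct (wall_step f v0 m T n z Hcont Hdir Htest Ha) as [z' Hz']; exists z'; auto.
    - exists z; tauto. }
  destruct (choice _ S1) as [F HF].
  set (zs := nat_rect (fun _ => nat -> C) z0 (fun n z => F (n, z))).
  assert (Ha : forall n, admissible f v0 m T n (zs n)).
  { induction n; auto. apply (HF (n, zs n)); auto. }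
  assert (Hs : forall n, (forall i, (i < 3)%nat -> Cnorm (Csub (zs (S n) i) (zs n i)) <= weps n) /\
     weps n * weps n / 2 <= Rabs (Qd (wall_center n) (zs (S n)) - wall_level n)).
  { intros n; apply (HF (n, zs n)); apply Ha. }
  assert (Ht : forall q n i, (i < 3)%nat -> Cnorm (Csub (zs (q + n)%nat i) (zs n i)) + 2 * weps (q + n) <= 2 * weps n).
  { induction q; intros n i Hi.
    - simpl; replace (Csub (zs n i) (zs n i)) with C0 by ring; rewrite Cnorm_0; lra.
    - pose proof (IHq n i Hi) as A1; destruct (Hs (q + n)%nat) as [A2 _]; specialize (A2 i Hi).
      pose proof (Cnorm_triang_sub (zs (S q + n)%nat i) (zs (q + n)%nat i) (zs n i)) as A3.
      change (S q + n)%nat with (S (q + n)) in *. pose proof (weps_bounds (q + n)).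
      assert (weps (S (q + n)) <= weps (q + n) / 2) by (simpl; nra). lra. }
  destruct (product_compact zs (fun k => if Nat.ltb k 3 then 2 else Rabs (T (k - 3)%nat))) as [s [z [Hs1 Hz]]].
  { intros n k; destruct (Ha n) as [B1 [B2 [B3 _]]]; destruct (Nat.ltb_spec k 3).
    - pose proof (B1 k H); pose proof (weps_bounds n); lra.
    - destruct (Nat.lt_ge_cases k (3 + m)) as [Hk|Hk].
      + specialize (B2 (k - 3)%nat ltac:(lia)); replace (3 + (k - 3))%nat with k in B2 by lia.
        eapply Rle_trans; [apply B2|apply Rle_abs].
      + rewrite B3 by auto; rewrite Cnorm_0; apply Rabs_pos. }
  assert (Hb : forall n i, (i < 3)%nat -> Cnorm (zs n i) <= 2).
  { intros n i Hi; destruct (Ha n) as [B1 _]; specialize (B1 i Hi); pose proof (weps_bounds n); lra. }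
  exists z; split; [split|split; [|split]].
  - intros i Hi; apply (Ccv_norm_le (fun n => zs (s n) i)); [apply Hz|intros; apply Hb; auto].
  - intros n.
    assert (Hlim : forall i, (i < 3)%nat -> Cnorm (Csub (z i) (zs (S n) i)) <= 2 * weps (S n)).
    { intros i Hi.
      apply (Ccv_norm_le (fun p => Csub (zs (s (p + S n)%nat) i) (zs (S n) i))).
      - unfold Csub; apply Ccv_add; [|apply Ccv_const].
        apply (Ccv_sub (fun p => zs (s p) i) _ (fun p => (p + S n)%nat)); [intros; lia|apply Hz].
      - intros p; specialize (Hs1 (p + S n)%nat).
        pose proof (Ht (s (p + S n) - S n)%nat (S n) i Hi) as B.
        replace (s (p + S n) - S n + S n)%nat with (s (p + S n)%nat) in B by lia.
        pose proof (weps_bounds (s (p + S n)%nat)); lra. }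
    destruct (Hs n) as [_ Hw].
    pose proof (weps_bounds n) as We.
    assert (L : Rabs (Qd (wall_center n) z - Qd (wall_center n) (zs (S n))) <= 21 * (2 * weps (S n))).
    { apply Qd_lipschitz; auto. simpl; nra. }
    apply Rabs_le_inv in L; change (weps (S n)) with (weps n * weps n / 200) in L.
    assert (D : weps n * weps n / 4 <= weps n * weps n / 2 - 21 * (2 * (weps n * weps n / 200))) by nra.
    revert Hw; unfold Rabs; destruct (Rcase_abs _); destruct (Rcase_abs _); lra.
  - intros j Hj; apply (Ccv_norm_le (fun n => zs (s n) (3 + j)%nat)); [apply Hz|].
    intros n; apply (Ha (s n)); auto.
  - intros k Hk; apply (Ccv_unique (fun n => zs (s n) k)); [apply Hz|].
    apply (Ccv_ext (fun _ => C0)); [|apply Ccv_const].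
    intros n; symmetry; apply (Ha (s n)); auto.
  - pose proof (Hcont _ _ Hz) as Hf; apply Rnot_lt_le; intros Hl.
    destruct (Un_cv_lt _ _ _ Hf Hl) as [N K]; specialize (K N (le_n _)).
    destruct (Ha (s N)) as [_ [_ [_ B]]]; lra.
Qed.

(** * A countable dense family of polynomials *)

(** Valid on the polydisc of radius 3, which contains all points in question since [|x_i| <= 2] and
    [|w| <= 1]. *)
Fixpoint pbound (p : poly4) : R :=
  match p with
  | PConst c => Cnorm c
  | PVar _ => 3
  | PAdd p q => pbound p + pbound q
  | PMul p q => pbound p * pbound q
  end.

Fixpoint plip (p : poly4) : R :=
  match p with
  | PConst c => 0
  | PVar _ => 1
  | PAdd p q => plip p + plip q
  | PMul p q => pbound p * plip q + plip p * pbound q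
  end.

Lemma pbound_ge0 p : 0 <= pbound p.
Proof. induction p; simpl; [apply Cnorm_ge0|lra|lra|apply Rmult_le_pos; auto]. Qed.

Lemma plip_ge0 p : 0 <= plip p.
Proof.
  induction p; simpl; try lra.
  apply Rplus_le_le_0_compat; apply Rmult_le_pos; auto using pbound_ge0.
Qed.

Lemma peval_bound p (z : C4) : (forall i, Cnorm (z i) <= 3) -> Cnorm (peval p z) <= pbound p.
Proof.
  intros H; induction p; simpl; auto; try lra.
  - eapply Rle_trans; [apply Cnorm_triang|lra].
  - rewrite Cnorm_mul; apply Rmult_le_compat; auto using Cnorm_ge0.
Qed.

Lemma Cmul_diff_le a b a' b' A B da db :
  Cnorm a <= A -> Cnorm b' <= B -> Cnorm (Csub a a') <= da -> Cnorm (Csub b b') <= db ->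
  Cnorm (Csub (Cmul a b) (Cmul a' b')) <= A * db + da * B.
Proof.
  intros H1 H2 H3 H4.
  replace (Csub (Cmul a b) (Cmul a' b')) with
    (Cadd (Cmul a (Csub b b')) (Cmul (Csub a a') b')) by ring.
  eapply Rle_trans; [apply Cnorm_triang|]; rewrite !Cnorm_mul.
  apply Rplus_le_compat; apply Rmult_le_compat; auto using Cnorm_ge0.
Qed.

Lemma peval_lip p (z z' : C4) d : 0 <= d ->
  (forall i, Cnorm (z i) <= 3) -> (forall i, Cnorm (z' i) <= 3) ->
  (forall i, Cnorm (Csub (z i) (z' i)) <= d) ->
  Cnorm (Csub (peval p z) (peval p z')) <= plip p * d.
Proof.
  intros Hd H H' Hzz; induction p; simpl.
  - replace (Csub c c) with C0 by ring; rewrite Cnorm_0; lra.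
  - rewrite Rmult_1_l; auto.
  - replace (Csub _ _) with (Cadd (Csub (peval p1 z) (peval p1 z')) (Csub (peval p2 z) (peval p2 z'))) by ring.
    eapply Rle_trans; [apply Cnorm_triang|lra].
  - eapply Rle_trans.
    + eapply Cmul_diff_le; [apply peval_bound, H|apply peval_bound, H'|apply IHp1|apply IHp2].
    + right; ring.
Qed.

Definition rdec (n : nat) : R :=
  let ab := of_nat n in let ij := of_nat (fst ab) in
  (INR (fst ij) - INR (snd ij)) / (INR (snd ab) + 1).

Definition cdec (n : nat) : C := mkC (rdec (fst (of_nat n))) (rdec (snd (of_nat n))).

Lemma rdec_between r1 r2 : r1 < r2 -> exists n, r1 < rdec n < r2.
Proof.
  intros Hr.
  destruct (archimed_cor1 (r2 - r1)) as [j [Hj1 Hj2]]; [lra|].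
  assert (Pj : 0 < INR j) by (apply lt_0_INR; auto).
  destruct (archimed (r1 * INR j)) as [U1 U2].
  set (z := up (r1 * INR j)) in *.
  assert (Ez : INR (Z.to_nat z) - INR (Z.to_nat (- z)) = IZR z).
  { rewrite !INR_IZR_INZ, <- minus_IZR; f_equal; lia. }
  exists (to_nat (to_nat (Z.to_nat z, Z.to_nat (- z)), pred j)); unfold rdec.
  rewrite cancel_of_to; cbn [fst snd]; rewrite cancel_of_to; cbn [fst snd].
  replace (INR (pred j) + 1) with (INR j) by (rewrite <- S_INR; f_equal; lia).
  rewrite Ez; split.
  - apply Rmult_lt_reg_r with (INR j); auto. unfold Rdiv; rewrite Rmult_assoc, Rinv_l; lra.
  - apply Rmult_lt_reg_r with (INR j); auto. unfold Rdiv; rewrite Rmult_assoc, Rinv_l by lra.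
    assert (H : / INR j * INR j < (r2 - r1) * INR j) by (apply Rmult_lt_compat_r; auto).
    rewrite Rinv_l in H by lra. lra.
Qed.

Lemma cdec_dense c eps : 0 < eps -> exists n, Cnorm (Csub c (cdec n)) <= eps.
Proof.
  intros He.
  destruct (rdec_between (re c - eps/2) (re c + eps/2)) as [a Ha]; [lra|].
  destruct (rdec_between (im c - eps/2) (im c + eps/2)) as [b Hb]; [lra|].
  exists (to_nat (a, b)); unfold cdec; rewrite cancel_of_to; cbn [fst snd].
  eapply Rle_trans; [apply Cnorm_le_re_im|]; simpl.
  assert (Rabs (re c + - rdec a) <= eps/2) by (apply Rabs_le; lra).
  assert (Rabs (im c + - rdec b) <= eps/2) by (apply Rabs_le; lra). lra.
Qed.

Definition idx_dec (m : nat) : idx4 :=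
  match m with 0%nat => i1 | 1%nat => i2 | 2%nat => i3 | _ => i4 end.

(** Decoding is not structural in [n], hence the fuel; without fuel it yields the zero
    polynomial. *)
Fixpoint pdec (fuel n : nat) : poly4 :=
  match fuel with
  | O => PConst C0
  | S f =>
    let m := snd (of_nat n) in
    match fst (of_nat n) with
    | 0%nat => PConst (cdec m)
    | 1%nat => PVar (idx_dec m)
    | 2%nat => PAdd (pdec f (fst (of_nat m))) (pdec f (snd (of_nat m)))
    | _ => PMul (pdec f (fst (of_nat m))) (pdec f (snd (of_nat m)))
    end
  end.

Lemma pdec_to_nat f tag m : pdec (S f) (to_nat (tag, m)) =
    match tag with
    | 0%nat => PConst (cdec m)
    | 1%nat => PVar (idx_dec m)
    | 2%nat => PAdd (pdec f (fst (of_nat m))) (pdec f (snd (of_nat m)))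
    | _ => PMul (pdec f (fst (of_nat m))) (pdec f (snd (of_nat m)))
    end.
Proof. cbn [pdec]; rewrite cancel_of_to; reflexivity. Qed.

(** Asserted for all sufficiently large fuel, so that two subterms with different needs can be
    decoded with a common one. *)
Lemma pdec_dense p : forall eps, 0 < eps -> exists f0 n, forall f, (f0 <= f)%nat ->
  forall z : C4, (forall i, Cnorm (z i) <= 3) -> Cnorm (Csub (peval p z) (peval (pdec f n) z)) <= eps.
Proof.
  induction p as [c|i|p IHp q IHq|p IHp q IHq]; intros eps He.
  - destruct (cdec_dense c eps He) as [m Hm].
    exists 1%nat, (to_nat (0%nat, m)); intros [|f] Hf z Hz; [lia|].
    rewrite pdec_to_nat; auto.
  - exists 1%nat, (to_nat (1%nat, match i with i1 => 0 | i2 => 1 | i3 => 2 | i4 => 3 end)%nat).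
    intros [|f] Hf z Hz; [lia|]. rewrite pdec_to_nat.
    replace (idx_dec _) with i by (destruct i; reflexivity).
    simpl; replace (Csub (z i) (z i)) with C0 by ring; rewrite Cnorm_0; lra.
  - destruct (IHp (eps/2)) as [f1 [n1 H1]]; [lra|]; destruct (IHq (eps/2)) as [f2 [n2' H2]]; [lra|].
    exists (S (f1 + f2)), (to_nat (2%nat, to_nat (n1, n2'))); intros [|f] Hf z Hz; [lia|].
    rewrite pdec_to_nat, cancel_of_to; simpl.
    replace (Csub _ _) with (Cadd (Csub (peval p z) (peval (pdec f n1) z))
       (Csub (peval q z) (peval (pdec f n2') z))) by ring.
    eapply Rle_trans; [apply Cnorm_triang|].
    assert (A := H1 f ltac:(lia) z Hz); assert (B := H2 f ltac:(lia) z Hz); lra.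
  - pose proof (pbound_ge0 p); pose proof (pbound_ge0 q).
    set (d := Rmin 1 (eps / (pbound p + pbound q + 1))).
    assert (Hd : 0 < d) by (apply Rmin_pos; [lra|apply Rdiv_lt_0_compat; lra]).
    assert (Hd2 : d * (pbound p + pbound q + 1) <= eps).
    { apply Rle_trans with (eps / (pbound p + pbound q + 1) * (pbound p + pbound q + 1)).
      - apply Rmult_le_compat_r; [lra|apply Rmin_r].
      - right; field; lra. }
    assert (Hd1 : d <= 1) by apply Rmin_l.
    destruct (IHp d Hd) as [f1 [n1 H1]]; destruct (IHq d Hd) as [f2 [n2' H2]].
    exists (S (f1 + f2)), (to_nat (3%nat, to_nat (n1, n2'))); intros [|f] Hf z Hz; [lia|].
    rewrite pdec_to_nat, cancel_of_to; cbn [fst snd peval].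
    assert (A := H1 f ltac:(lia) z Hz); assert (B := H2 f ltac:(lia) z Hz).
    eapply Rle_trans; [eapply Cmul_diff_le with (A := pbound p) (B := pbound q + d)|].
    + apply peval_bound; auto.
    + pose proof (Cnorm_le_sub (peval (pdec f n2') z) (peval q z)).
      rewrite Cnorm_sub_sym in B; pose proof (peval_bound q z Hz); lra.
    + apply A.
    + apply B.
    + nra.
Qed.

(** An index codes a tolerance, a fuel and a polynomial independently, so each decoded polynomial
    recurs with arbitrarily small tolerance. *)
Definition tol (j : nat) : R := / (INR (fst (of_nat j)) + 1).
Definition qpoly (j : nat) : poly4 :=
  pdec (fst (of_nat (snd (of_nat j)))) (snd (of_nat (snd (of_nat j)))).

Lemma tol_pos j : 0 < tol j.
Proof. apply Rinv_0_lt_compat; pose proof (pos_INR (fst (of_nat j))); lra. Qed.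

Lemma qpoly_dense p eps : 0 < eps -> exists j, tol j <= eps /\
  forall z : C4, (forall i, Cnorm (z i) <= 3) -> Cnorm (Csub (peval p z) (peval (qpoly j) z)) <= eps.
Proof.
  intros He; destruct (pdec_dense p eps He) as [f [n H]].
  destruct (archimed_cor1 eps He) as [k [Hk1 Hk2]].
  exists (to_nat (k, to_nat (f, n))); unfold tol, qpoly.
  rewrite cancel_of_to; cbn [fst snd]; rewrite cancel_of_to; cbn [fst snd]; split; [|auto].
  apply Rle_trans with (/ INR k); [|lra].
  apply Rinv_le_contravar; [apply lt_0_INR; auto|lra].
Qed.

(** * Adjoining inverse square roots *)

Definition mk4 (z : nat -> C) (w : C) : C4 :=
  fun i => match i with i1 => z 0%nat | i2 => z 1%nat | i3 => z 2%nat | i4 => w end.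

Definition czero : nat -> C := fun _ => C0.

(* [tr j] is the value at the base point of the j-th adjoined function, an inverse square root of
   [tp j] evaluated at (x, w_j), where w_j is the sum of [tc i] times the i-th function, i < j. *)
Record tower := {
  tp : nat -> poly4; tc : nat -> R; tT : nat -> R; tr : nat -> C; tnu : nat -> nat;
  tB : nat -> R; tw : nat -> C; te : nat -> R;
  tw_0 : tw 0 = C0; tw_S : forall j, tw (S j) = Cadd (tw j) (Cmul (RtoC (tc j)) (tr j));
  tB_0 : tB 0 = 1;
  tB_S : forall j, tB (S j) = tB j ^ tnu j * (pbound (tp j) / Cnorm (peval (tp j) (mk4 czero (tw j))));
  te_0 : te 0 = 1; te_S : forall j, te (S j) = tc j / (8 * (1 + pbound (tp j)));
  tp_approx : forall j z, Cnorm (Csub (peval (tp j) z) (peval (qpoly j) z)) <= tol j;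
  tr_root : forall j, Cmul (peval (tp j) (mk4 czero (tw j))) (Cmul (tr j) (tr j)) = C1;
  tnu_large : forall j, 2 * pbound (tp j) <= 2 ^ tnu j * Cnorm (peval (tp j) (mk4 czero (tw j)));
  tT_ge1 : forall j, 1 <= tT j;
  tT_large : forall j, 3 * tB j ^ tnu j <= tT j * tT j * Cnorm (peval (tp j) (mk4 czero (tw j)));
  tc_pos : forall j, 0 < tc j;
  tc_small : forall j, tc j * tT j <= te j / 4;
  tc_lip : forall j, tc j * tT j * plip (tp j) <= tol j;
  tr_lt : forall j, Cnorm (tr j) < tT j;
  te_pos : forall j, 0 < te j;
  tw_bound : forall j, Cnorm (tw j) + te j <= 1;
  tB_ge1 : forall j, 1 <= tB j }.

(** The order of choice matters: [p] nonzero at the base point, its root [t], the exponent [nu],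
    then [T], which depends on [nu], and last the weight [c], which must beat [T]. *)
Lemma tower_step j w B e : Cnorm w + e <= 1 -> 0 < e -> 1 <= B ->
  exists (d : poly4 * R * R * C * nat), let '(p, c, T, t, nu) := d in
    let b := peval p (mk4 czero w) in
    (forall z, Cnorm (Csub (peval p z) (peval (qpoly j) z)) <= tol j) /\
    Cmul b (Cmul t t) = C1 /\ 2 * pbound p <= 2 ^ nu * Cnorm b /\ 1 <= T /\
    3 * B ^ nu <= T * T * Cnorm b /\ 0 < c /\ c * T <= e / 4 /\ c * T * plip p <= tol j /\ Cnorm t < T.
Proof.
  intros Hw He HB.
  (* A polynomial vanishing at the base point is shifted by the constant [tol j], exactly the error
     allowed. *)
  assert (Hp : exists p, (forall z, Cnorm (Csub (peval p z) (peval (qpoly j) z)) <= tol j) /\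
    peval p (mk4 czero w) <> C0).
  { pose proof (tol_pos j) as Ht.
    destruct (classic (peval (qpoly j) (mk4 czero w) = C0)) as [E|E].
    - exists (PAdd (qpoly j) (PConst (RtoC (tol j)))); split; simpl.
      + intros z. replace (Csub _ _) with (RtoC (tol j)) by ring.
        rewrite Cnorm_RtoC_pos; lra.
      + rewrite E; intros F; apply (f_equal re) in F; simpl in F; lra.
    - exists (qpoly j); split; auto.
      intros z; replace (Csub _ _) with C0 by ring; rewrite Cnorm_0; lra. }
  destruct Hp as [p [Hp1 Hp2]].
  set (b := peval p (mk4 czero w)) in *.
  pose proof (Cnorm_pos b Hp2) as Hb.
  destruct (Csqrt_exists (Cinv b)) as [t Ht].
  destruct (Pow_x_infinity 2) with (b := 2 * pbound p / Cnorm b) as [nu Hnu].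
  { rewrite Rabs_pos_eq; lra. }
  specialize (Hnu nu (le_n _)).
  assert (P2 : 0 < 2 ^ nu) by (apply pow_lt; lra).
  rewrite Rabs_pos_eq in Hnu by lra.
  (* One summand for each demand: [1 <= T], [|t| < T], and
     [3 * B ^ nu <= T * |b| <= T * T * |b|]. *)
  set (T := 1 + Cnorm t + 3 * B ^ nu / Cnorm b).
  assert (PB : 0 < B ^ nu) by (apply pow_lt; lra).
  assert (PBb : 0 < 3 * B ^ nu / Cnorm b) by (apply Rdiv_lt_0_compat; lra).
  pose proof (Cnorm_ge0 t) as Htt.
  assert (HT : 1 <= T) by (unfold T; lra).
  pose proof (plip_ge0 p) as Hl; pose proof (tol_pos j) as Hto.
  set (m := Rmin (e / 4) (tol j / (1 + plip p))).
  assert (Hm : 0 < m) by (apply Rmin_pos; [lra|apply Rdiv_lt_0_compat; lra]).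
  exists (p, m / T, T, t, nu); fold b; repeat split; auto.
  - rewrite Ht; apply Cinv_r; auto.
  - apply Rle_trans with (2 * pbound p / Cnorm b * Cnorm b); [right; field; lra|].
    apply Rmult_le_compat_r; lra.
  - apply Rle_trans with (3 * B ^ nu / Cnorm b * Cnorm b); [right; field; lra|].
    apply Rmult_le_compat_r; [lra|]. apply Rle_trans with (1 * T); [unfold T; lra|].
    apply Rmult_le_compat_r; lra.
  - apply Rdiv_lt_0_compat; lra.
  - replace (m / T * T) with m by (field; lra); apply Rmin_l.
  - replace (m / T * T) with m by (field; lra).
    apply Rle_trans with (m * (1 + plip p)); [nra|].
    apply Rle_trans with (tol j / (1 + plip p) * (1 + plip p)).
    + apply Rmult_le_compat_r; [lra|apply Rmin_r].
    + right; field; lra.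
  - unfold T; lra.
Qed.

(** Stage [j] can be built only if the running [w], [B], [e] satisfy their invariants. To apply
    choice to a total relation, [step] is conditional on them; [Inv] then discharges the condition
    by induction. *)
Lemma tower_exists : inhabited tower.
Proof.
  set (step := fun (js : nat * (C * R * R)) (d : poly4 * R * R * C * nat) =>
    let '(j, (w, B, e)) := js in let '(p, c, T, t, nu) := d in
    let b := peval p (mk4 czero w) in
    Cnorm w + e <= 1 /\ 0 < e /\ 1 <= B ->
    (forall z, Cnorm (Csub (peval p z) (peval (qpoly j) z)) <= tol j) /\
    Cmul b (Cmul t t) = C1 /\ 2 * pbound p <= 2 ^ nu * Cnorm b /\ 1 <= T /\
    3 * B ^ nu <= T * T * Cnorm b /\ 0 < c /\ c * T <= e / 4 /\ c * T * plip p <= tol j /\ Cnorm t < T).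
  assert (Hst : forall js, exists d, step js d).
  { intros [j [[w B] e]]; destruct (classic (Cnorm w + e <= 1 /\ 0 < e /\ 1 <= B)) as [[H1 [H2 H3]]|H].
    - destruct (tower_step j w B e H1 H2 H3) as [[[[[p c] T] t] nu] Hd].
      exists (p, c, T, t, nu); simpl in *; intros; exact Hd.
    - exists (PConst C0, 0, 0, C0, O); simpl; tauto. }
  destruct (choice _ Hst) as [F HF].
  set (next := fun (js : nat * (C * R * R)) => let '(p, c, T, t, nu) := F js in
    let '(_, (w, B, e)) := js in
    (Cadd w (Cmul (RtoC c) t), B ^ nu * (pbound p / Cnorm (peval p (mk4 czero w))), c / (8 * (1 + pbound p)))).
  set (st := nat_rect (fun _ => (C * R * R)%type) (C0, 1, 1) (fun j s => next (j, s))).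
  set (D := fun j => F (j, st j)).
  set (w := fun j => fst (fst (st j))); set (B := fun j => snd (fst (st j))); set (e := fun j => snd (st j)).
  set (p := fun j => fst (fst (fst (fst (D j))))); set (c := fun j => snd (fst (fst (fst (D j)))));
  set (T := fun j => snd (fst (fst (D j)))); set (t := fun j => snd (fst (D j))); set (nu := fun j => snd (D j)).
  assert (Est : forall j, st j = (w j, B j, e j)).
  { intros j; unfold w, B, e; destruct (st j) as [[? ?] ?]; reflexivity. }
  assert (ED : forall j, D j = (p j, c j, T j, t j, nu j)).
  { intros j; unfold p, c, T, t, nu; destruct (D j) as [[[[? ?] ?] ?] ?]; reflexivity. }
  assert (EF : forall j, F (j, (w j, B j, e j)) = (p j, c j, T j, t j, nu j)).
  { intros j; rewrite <- ED, <- Est; reflexivity. }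
  assert (Enx : forall j, st (S j) = (Cadd (w j) (Cmul (RtoC (c j)) (t j)),
     B j ^ nu j * (pbound (p j) / Cnorm (peval (p j) (mk4 czero (w j)))), c j / (8 * (1 + pbound (p j))))).
  { intros j; change (st (S j)) with (next (j, st j)); rewrite Est; unfold next; rewrite EF; reflexivity. }
  assert (Hw : forall j, w (S j) = Cadd (w j) (Cmul (RtoC (c j)) (t j))).
  { intros j; unfold w at 1; rewrite Enx; reflexivity. }
  assert (HBS : forall j, B (S j) = B j ^ nu j * (pbound (p j) / Cnorm (peval (p j) (mk4 czero (w j))))).
  { intros j; unfold B at 1; rewrite Enx; reflexivity. }
  assert (HeS : forall j, e (S j) = c j / (8 * (1 + pbound (p j)))).
  { intros j; unfold e at 1; rewrite Enx; reflexivity. }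
  assert (HS : forall j, Cnorm (w j) + e j <= 1 /\ 0 < e j /\ 1 <= B j ->
    (forall z, Cnorm (Csub (peval (p j) z) (peval (qpoly j) z)) <= tol j) /\
    Cmul (peval (p j) (mk4 czero (w j))) (Cmul (t j) (t j)) = C1 /\
    2 * pbound (p j) <= 2 ^ nu j * Cnorm (peval (p j) (mk4 czero (w j))) /\ 1 <= T j /\
    3 * B j ^ nu j <= T j * T j * Cnorm (peval (p j) (mk4 czero (w j))) /\ 0 < c j /\ c j * T j <= e j / 4 /\
    c j * T j * plip (p j) <= tol j /\ Cnorm (t j) < T j).
  { intros j Hj; pose proof (HF (j, (w j, B j, e j))) as H; rewrite EF in H; exact (H Hj). }
  assert (Inv : forall j, Cnorm (w j) + e j <= 1 /\ 0 < e j /\ 1 <= B j).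
  { induction j.
    - change (Cnorm C0 + 1 <= 1 /\ 0 < 1 /\ 1 <= 1); rewrite Cnorm_0; lra.
    - destruct (HS j IHj) as [_ [Hr [_ [HT1 [_ [Hc [HcT [_ Htl]]]]]]]].
      destruct IHj as [I1 [I2 I3]].
      pose proof (pbound_ge0 (p j)) as Hpb.
      assert (De : c j / (8 * (1 + pbound (p j))) <= c j * T j).
      { apply Rle_trans with (c j); [|nra].
        apply Rmult_le_reg_r with (8 * (1 + pbound (p j))); [lra|].
        replace (c j / (8 * (1 + pbound (p j))) * (8 * (1 + pbound (p j)))) with (c j) by (field; lra). nra. }
      rewrite Hw, HBS, HeS; repeat split.
      + pose proof (Cnorm_triang (w j) (Cmul (RtoC (c j)) (t j))) as Tr.
        rewrite Cnorm_mul, Cnorm_RtoC_pos in Tr by lra.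
        assert (c j * Cnorm (t j) <= c j * T j) by (apply Rmult_le_compat_l; lra). lra.
      + apply Rdiv_lt_0_compat; lra.
      + assert (Hb : peval (p j) (mk4 czero (w j)) <> C0).
        { intros E; rewrite E in Hr; apply C1_neq0; rewrite <- Hr; ring. }
        apply Cnorm_pos in Hb.
        assert (1 <= pbound (p j) / Cnorm (peval (p j) (mk4 czero (w j)))).
        { apply Rmult_le_reg_r with (Cnorm (peval (p j) (mk4 czero (w j)))); auto.
          unfold Rdiv; rewrite Rmult_assoc, Rinv_l, Rmult_1_r, Rmult_1_l by lra.
          apply peval_bound; intros [| | |]; simpl; unfold czero; try (rewrite Cnorm_0; lra); lra. }
        assert (1 <= B j ^ nu j) by (apply pow_R1_Rle; lra). nra. }
  constructor.
  refine (Build_tower p c T t nu B w e eq_refl Hw eq_refl HBS eq_refl HeS _ _ _ _ _ _ _ _ _ _ _ _);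
    intros j; destruct (HS j (Inv j)) as [A1 [A2 [A3 [A4 [A5 [A6 [A7 [A8 A9]]]]]]]];
    destruct (Inv j) as [I1 [I2 I3]]; auto.
Qed.

(** * The tower as polynomial equations, and the bounds they imply *)

Fixpoint sub4 (W : npoly) (p : poly4) : npoly :=
  match p with
  | PConst c => NC c
  | PVar i => match i with i1 => NV 0 | i2 => NV 1 | i3 => NV 2 | i4 => W end
  | PAdd p q => NA (sub4 W p) (sub4 W q)
  | PMul p q => NM (sub4 W p) (sub4 W q)
  end.

Lemma neval_sub4 W p z : neval (sub4 W p) z = peval p (mk4 z (neval W z)).
Proof. induction p; simpl; try rewrite IHp1, IHp2; auto; destruct i; reflexivity. Qed.

Fixpoint npow (p : npoly) (k : nat) : npoly :=
  match k with O => NC C1 | S k => NM p (npow p k) end.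

Lemma Cnorm_npow p k z : Cnorm (neval (npow p k) z) = Cnorm (neval p z) ^ k.
Proof. induction k; simpl; [apply Cnorm_1|rewrite Cnorm_mul, IHk; auto]. Qed.

Fixpoint wpoly (D : tower) (j : nat) : npoly :=
  match j with O => NC C0 | S j => NA (wpoly D j) (NM (NC (RtoC (tc D j))) (NV (3 + j))) end.

Definition phat (D : tower) (j : nat) : npoly := sub4 (wpoly D j) (tp D j).

Definition Epoly (D : tower) (j : nat) : npoly :=
  NA (NM (phat D j) (NM (NV (3 + j)) (NV (3 + j)))) (NC (Copp C1)).

(** The weighted product that is held at its base value. The previous product enters with exponent
    [tnu D m], so that once it has lost a factor 2 the new factor [p_m] cannot make up for the
    loss. *)
Fixpoint PP (D : tower) (m : nat) : npoly :=
  match m with O => NC C1 | S m => NM (npow (PP D m) (tnu D m)) (phat D m) end.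

Definition zbase (D : tower) (m : nat) : nat -> C :=
  fun k => if Nat.ltb k 3 then C0 else if Nat.ltb k (3 + m) then tr D (k - 3) else C0.

Definition tbounded (D : tower) (z : nat -> C) : Prop :=
  (forall i, (i < 3)%nat -> Cnorm (z i) <= 2) /\ forall j, Cnorm (z (3 + j)%nat) <= tT D j.

Lemma zbase_x D m i : (i < 3)%nat -> zbase D m i = C0.
Proof. intros H; unfold zbase; destruct (Nat.ltb_spec i 3); [auto|lia]. Qed.

Lemma zbase_t D m j : (j < m)%nat -> zbase D m (3 + j) = tr D j.
Proof.
  intros H; unfold zbase; destruct (Nat.ltb_spec (3 + j) 3); [lia|].
  destruct (Nat.ltb_spec (3 + j) (3 + m)); [f_equal; lia|lia].
Qed.

Lemma zbase_0 D m k : (3 + m <= k)%nat -> zbase D m k = C0.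
Proof.
  intros H; unfold zbase; destruct (Nat.ltb_spec k 3); auto; destruct (Nat.ltb_spec k (3 + m)); [lia|auto].
Qed.

Lemma zbase_tbounded D m : tbounded D (zbase D m).
Proof.
  split.
  - intros i Hi; rewrite zbase_x, Cnorm_0 by auto; lra.
  - intros j; pose proof (tT_ge1 D j); destruct (Nat.lt_ge_cases j m).
    + rewrite zbase_t by auto; pose proof (tr_lt D j); lra.
    + rewrite zbase_0, Cnorm_0 by lia; lra.
Qed.

Lemma te_decr D j : te D (S j) <= tc D j * tT D j.
Proof.
  rewrite te_S; pose proof (pbound_ge0 (tp D j)) as Hpb; pose proof (tc_pos D j); pose proof (tT_ge1 D j).
  apply Rle_trans with (tc D j); [|nra].
  apply Rmult_le_reg_r with (8 * (1 + pbound (tp D j))); [lra|].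
  replace (tc D j / (8 * (1 + pbound (tp D j))) * (8 * (1 + pbound (tp D j)))) with (tc D j) by (field; lra). nra.
Qed.

Lemma te_quarter D j : te D (S j) <= te D j / 4.
Proof. eapply Rle_trans; [apply te_decr|apply tc_small]. Qed.

Lemma te_small D j : te D j <= (/ 4) ^ j.
Proof.
  induction j; [rewrite te_0; simpl; lra|]; pose proof (te_quarter D j); simpl; lra.
Qed.

Lemma te_cv D eps : 0 < eps -> exists j, te D j < eps.
Proof.
  intros He; destruct (pow_lt_1_zero (/4)) with (y := eps) as [N K]; auto.
  { rewrite Rabs_pos_eq; lra. }
  exists N; pose proof (K N (le_n _)) as H; pose proof (te_small D N).
  rewrite Rabs_pos_eq in H; [lra|apply pow_le; lra].
Qed.

(** [te j / 2] is a budget for everything added to [w_j]: the next term takes at most [te j / 4],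
    and the budget [te (S j) / 2] of the rest is at most [te j / 8]. *)
Lemma wpoly_tail D z : tbounded D z -> forall q j,
  Cnorm (Csub (neval (wpoly D (q + j)) z) (neval (wpoly D j) z)) + te D (q + j) / 2 <= te D j / 2.
Proof.
  intros [_ Hz]; induction q; intros j.
  - simpl; replace (Csub _ _) with C0 by ring; rewrite Cnorm_0; lra.
  - specialize (IHq j). change (S q + j)%nat with (S (q + j)).
    cbn [wpoly neval].
    replace (Csub _ _) with (Cadd (Csub (neval (wpoly D (q + j)) z) (neval (wpoly D j) z))
      (Cmul (RtoC (tc D (q + j))) (z (3 + (q + j))%nat))) by ring.
    pose proof (tc_pos D (q + j)) as Hc; specialize (Hz (q + j)%nat).
    pose proof (Cnorm_triang (Csub (neval (wpoly D (q + j)) z) (neval (wpoly D j) z))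
      (Cmul (RtoC (tc D (q + j))) (z (3 + (q + j))%nat))) as T.
    rewrite Cnorm_mul, (Cnorm_RtoC_pos (tc D _)) in T by lra.
    assert (tc D (q + j) * Cnorm (z (3 + (q + j))%nat) <= tc D (q + j) * tT D (q + j))
      by (apply Rmult_le_compat_l; lra).
    pose proof (tc_small D (q + j)); pose proof (te_quarter D (q + j)); pose proof (te_pos D (q + j)).
    lra.
Qed.

Lemma wpoly_bound D z j : tbounded D z -> Cnorm (neval (wpoly D j) z) <= 1.
Proof.
  intros Hz; pose proof (wpoly_tail D z Hz j 0) as H; rewrite Nat.add_0_r, te_0 in H.
  pose proof (te_pos D j); pose proof (Cnorm_le_sub (neval (wpoly D j) z) (neval (wpoly D 0) z)) as T.
  simpl (neval (wpoly D 0) z) in *; rewrite Cnorm_0 in T; lra.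
Qed.

Lemma mk4_bound (z : nat -> C) w : (forall i, (i < 3)%nat -> Cnorm (z i) <= 2) -> Cnorm w <= 1 ->
  forall i, Cnorm (mk4 z w i) <= 3.
Proof.
  intros H Hw i; pose proof (H 0%nat ltac:(lia)); pose proof (H 1%nat ltac:(lia)); pose proof (H 2%nat ltac:(lia)).
  destruct i; simpl; lra.
Qed.

Lemma phat_bound D z j : tbounded D z -> Cnorm (neval (phat D j) z) <= pbound (tp D j).
Proof.
  intros Hz; unfold phat; rewrite neval_sub4; apply peval_bound, mk4_bound; [apply Hz|apply wpoly_bound; auto].
Qed.

Lemma mk4_ext z z' w : (forall i, (i < 3)%nat -> z i = z' i) -> mk4 z w = mk4 z' w.
Proof. intros H; apply functional_extensionality; intros []; simpl; auto. Qed.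

Lemma wpoly_zbase D m j : (j <= m)%nat -> neval (wpoly D j) (zbase D m) = tw D j.
Proof.
  induction j; intros H; [rewrite tw_0; reflexivity|].
  cbn [wpoly neval]; rewrite IHj, zbase_t, tw_S by lia; reflexivity.
Qed.

Lemma phat_zbase D m j : (j <= m)%nat ->
  neval (phat D j) (zbase D m) = peval (tp D j) (mk4 czero (tw D j)).
Proof.
  intros H; unfold phat; rewrite neval_sub4, wpoly_zbase by auto.
  f_equal; apply functional_extensionality; intros []; reflexivity.
Qed.

Lemma beta_pos D j : 0 < Cnorm (peval (tp D j) (mk4 czero (tw D j))).
Proof.
  apply Cnorm_pos; intros E; pose proof (tr_root D j) as H; rewrite E in H.
  apply C1_neq0; rewrite <- H; ring.
Qed.

Lemma Epoly_zbase D m j : (j < m)%nat -> neval (Epoly D j) (zbase D m) = C0.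
Proof.
  intros H; unfold Epoly; cbn [neval]; rewrite phat_zbase, zbase_t by lia.
  rewrite tr_root; ring.
Qed.

Lemma PP_zbase_S D n m : (m < n)%nat -> Cnorm (neval (PP D (S m)) (zbase D n)) =
  Cnorm (neval (PP D m) (zbase D n)) ^ tnu D m * Cnorm (peval (tp D m) (mk4 czero (tw D m))).
Proof.
  intros H; cbn [PP neval]; rewrite Cnorm_mul, Cnorm_npow, phat_zbase by lia; reflexivity.
Qed.

Lemma PP_zbase_pos D n m : (m <= n)%nat -> 0 < Cnorm (neval (PP D m) (zbase D n)).
Proof.
  induction m; intros H; [simpl; rewrite Cnorm_1; lra|].
  rewrite PP_zbase_S by lia; apply Rmult_lt_0_compat; [apply pow_lt, IHm; lia|apply beta_pos].
Qed.

(** This is the meaning of [tB]: the ratio of a bound for [PP m] over all bounded points to its size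
    at the base point. *)
Lemma PP_bound D n m z : tbounded D z -> (m <= n)%nat ->
  Cnorm (neval (PP D m) z) <= tB D m * Cnorm (neval (PP D m) (zbase D n)).
Proof.
  intros Hz; induction m; intros H; [simpl; rewrite tB_0; lra|].
  rewrite PP_zbase_S, tB_S by lia; cbn [PP neval]; rewrite Cnorm_mul, Cnorm_npow.
  pose proof (beta_pos D m) as Hb; set (b := Cnorm (peval _ _)) in *.
  replace (tB D m ^ tnu D m * (pbound (tp D m) / b) * (Cnorm (neval (PP D m) (zbase D n)) ^ tnu D m * b))
    with ((tB D m * Cnorm (neval (PP D m) (zbase D n))) ^ tnu D m * pbound (tp D m))
    by (rewrite Rpow_mult_distr; field; lra).
  apply Rmult_le_compat; [apply pow_le, Cnorm_ge0|apply Cnorm_ge0| |apply phat_bound; auto].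
  apply pow_incr; split; [apply Cnorm_ge0|apply IHm; lia].
Qed.

(* The exponents make a small value of one factor halve the whole product. *)
Lemma PP_half D n j z : tbounded D z ->
  Cnorm (neval (phat D j) z) * (tT D j * tT D j) <= 3 / 2 ->
  forall m, (j < m)%nat -> (m <= n)%nat ->
  Cnorm (neval (PP D m) z) <= Cnorm (neval (PP D m) (zbase D n)) / 2.
Proof.
  intros Hz Hj; induction m; intros H1 H2; [lia|].
  rewrite PP_zbase_S by lia; cbn [PP neval]; rewrite Cnorm_mul, Cnorm_npow.
  pose proof (PP_zbase_pos D n m ltac:(lia)) as Hc; set (c := Cnorm (neval (PP D m) (zbase D n))) in *.
  pose proof (beta_pos D m) as Hb.
  assert (Hcn : 0 < c ^ tnu D m) by (apply pow_lt; auto).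
  pose proof (Cnorm_ge0 (neval (phat D m) z)) as Hp0.
  (* If the small factor is the last one, [tT_large] offsets the possible excess [tB ^ tnu] of the
     others. If it is an earlier one, the halved product is raised to the power [tnu], and [2 ^ tnu]
     is at least [2 * pbound / b]. *)
  destruct (Nat.eq_dec j m) as [->|Hne].
  - pose proof (PP_bound D n m z Hz ltac:(lia)) as HB; fold c in HB.
    pose proof (tT_large D m) as HT; pose proof (tB_ge1 D m) as HB1; pose proof (tT_ge1 D m) as HT1.
    set (b := Cnorm (peval _ _)) in *.
    assert (HBn : 0 < tB D m ^ tnu D m) by (apply pow_lt; lra).
    assert (K : tB D m ^ tnu D m * Cnorm (neval (phat D m) z) <= b / 2).
    { assert (TT : 0 < tT D m * tT D m) by nra.
      apply Rmult_le_reg_l with (tT D m * tT D m); auto.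
      apply Rle_trans with (tB D m ^ tnu D m * (3 / 2)); [|lra].
      replace (tT D m * tT D m * (tB D m ^ tnu D m * Cnorm (neval (phat D m) z))) with
        (tB D m ^ tnu D m * (Cnorm (neval (phat D m) z) * (tT D m * tT D m))) by ring.
      apply Rmult_le_compat_l; lra. }
    apply Rle_trans with ((tB D m * c) ^ tnu D m * Cnorm (neval (phat D m) z)).
    + apply Rmult_le_compat_r; auto; apply pow_incr; split; [apply Cnorm_ge0|auto].
    + rewrite Rpow_mult_distr. nra.
  - specialize (IHm ltac:(lia) ltac:(lia)).
    pose proof (phat_bound D z m Hz) as Hpb; pose proof (tnu_large D m) as Hnu.
    set (b := Cnorm (peval _ _)) in *.
    assert (P2 : 0 < 2 ^ tnu D m) by (apply pow_lt; lra).
    apply Rle_trans with ((c / 2) ^ tnu D m * pbound (tp D m)).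
    + apply Rmult_le_compat; auto; [apply pow_le, Cnorm_ge0|].
      apply pow_incr; split; [apply Cnorm_ge0|auto].
    + unfold Rdiv at 1; rewrite Rpow_mult_distr, pow_inv.
      apply Rmult_le_reg_l with (2 ^ tnu D m); auto.
      replace (2 ^ tnu D m * (c ^ tnu D m * / 2 ^ tnu D m * pbound (tp D m)))
        with (c ^ tnu D m * pbound (tp D m)) by (field; lra). nra.
Qed.

Lemma neval_bounded g M : exists G, 0 <= G /\
  forall z : nat -> C, (forall k, Cnorm (z k) <= M k) -> Cnorm (neval g z) <= G.
Proof.
  induction g as [c|k|p [A [HA HA']] q [B [HB HB']]|p [A [HA HA']] q [B [HB HB']]].
  - exists (Cnorm c); split; [apply Cnorm_ge0|simpl; intros; lra].
  - exists (Rabs (M k)); split; [apply Rabs_pos|simpl; intros z Hz].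
    eapply Rle_trans; [apply Hz|apply Rle_abs].
  - exists (A + B); split; [lra|]; intros z Hz; simpl.
    eapply Rle_trans; [apply Cnorm_triang|]; specialize (HA' z Hz); specialize (HB' z Hz); lra.
  - exists (A * B); split; [apply Rmult_le_pos; auto|]; intros z Hz; simpl; rewrite Cnorm_mul.
    apply Rmult_le_compat; auto using Cnorm_ge0.
Qed.

Definition eqs (D : tower) (m : nat) : list npoly :=
  NA (PP D m) (NC (Copp (neval (PP D m) (zbase D m)))) :: map (Epoly D) (seq 0 m).

(** The [m + 1] equations ([m] roots and the product) and the tangency row are [m + 2] linear
    conditions on [3 + m] unknowns. This count is what three [x]-coordinates are needed for. *)
Lemma phi_steerable g e L D m : 0 < e -> 0 <= L -> steerable (phi g e L (3 + m) (eqs D m)) m.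
Proof.
  intros He HL z row.
  destruct (homogeneous_system (3 + m) (row :: map (fun F k => nder F z (unit_at k)) (eqs D m)))
    as [u [[k [Hk Huk]] [Hsup Hz]]].
  { simpl; rewrite !length_map, length_seq; lia. }
  exists u; split; [auto|split; [apply Hz; left; auto|]].
  apply (phi_no_local_max g e L (3 + m) (eqs D m) z u k); auto.
  intros F HF; rewrite (nder_row (3 + m)) by auto.
  apply (Hz (fun k => nder F z (unit_at k))); right.
  apply (in_map (fun F k => nder F z (unit_at k))); auto.
Qed.

Lemma hull_approx D g m : exists z, inK z /\ tbounded D z /\
  (forall j, (j < m)%nat -> n2 (neval (Epoly D j) z) <= / (INR m + 1)) /\
  n2 (neval g (zbase D m)) <= n2 (neval g z) + / (INR m + 1).
Proof.
  set (M := fun k => if Nat.ltb k 3 then 2 else tT D (k - 3)%nat).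
  assert (HM : forall z, tbounded D z -> forall k, Cnorm (z k) <= M k).
  { intros z [Hz1 Hz2] k; unfold M; destruct (Nat.ltb_spec k 3); [auto|].
    specialize (Hz2 (k - 3)%nat); replace (3 + (k - 3))%nat with k in Hz2 by lia; auto. }
  destruct (neval_bounded g M) as [G [HG0 HG]].
  set (S2 := nat_rect (fun _ => R) 0 (fun k s => s + M k * M k) (3 + m)).
  assert (HS2 : forall z, tbounded D z -> sqnorm (3 + m) z <= S2).
  { intros z Hz; apply sqnorm_bound, HM; auto. }
  assert (HS0 : 0 <= S2).
  { eapply Rle_trans; [apply (sqnorm_ge0 (3 + m) (zbase D m))|apply HS2, zbase_tbounded]. }
  set (im := / (INR m + 1)).
  assert (Him : 0 < im <= 1).
  { pose proof (pos_INR m); unfold im; split; [apply Rinv_0_lt_compat; lra|].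
    rewrite <- Rinv_1; apply Rinv_le_contravar; lra. }
  set (e := im / (1 + S2)).
  assert (He : 0 < e) by (apply Rdiv_lt_0_compat; lra).
  assert (HeS : e * S2 <= im).
  { apply Rle_trans with (e * (1 + S2)); [nra|right; unfold e; field; lra]. }
  set (c := Cnorm (neval (PP D m) (zbase D m))).
  assert (Hc : 0 < c) by (apply PP_zbase_pos; auto).
  (* A lower bound for the penalty wherever some [|t_j| = T_j]: either [|E_j| >= 1/2], or the
     product has dropped by at least [c / 2]. *)
  set (eta := Rmin (1/4) (c * c / 4)).
  assert (Heta : 0 < eta) by (apply Rmin_pos; nra).
  (* The first summand makes [f] negative wherever the penalty reaches [eta]; the second forces the
     penalty below [im] wherever [f] is nonnegative. *)
  set (L := (G * G + 2) / eta + (G * G + 1) / im).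
  assert (L1 : (G * G + 1) / im <= L).
  { assert (0 < (G * G + 2) / eta) by (apply Rdiv_lt_0_compat; nra). unfold L; lra. }
  assert (L2 : G * G + 2 <= L * eta).
  { apply Rle_trans with ((G * G + 2) / eta * eta); [right; field; lra|].
    apply Rmult_le_compat_r; [lra|]. assert (0 < (G * G + 1) / im) by (apply Rdiv_lt_0_compat; nra). unfold L; lra. }
  assert (L3 : G * G + 1 <= L * im).
  { apply Rle_trans with ((G * G + 1) / im * im); [right; field; lra|]. apply Rmult_le_compat_r; lra. }
  assert (HL : 0 <= L) by (assert (0 < (G * G + 1) / im) by (apply Rdiv_lt_0_compat; nra); lra).
  set (f := phi g e L (3 + m) (eqs D m)).
  assert (Hpen0 : penalty (eqs D m) (zbase D m) = 0).
  { assert (H0 : n2 C0 = 0) by (unfold n2; simpl; ring).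
    assert (G0 : forall l, (forall F, In F l -> neval F (zbase D m) = C0) -> penalty l (zbase D m) = 0).
    { induction l; simpl; intros Hl; auto; rewrite (Hl a), IHl, H0 by auto; ring. }
    apply G0; intros F [<-|HF].
    - simpl; ring.
    - apply in_map_iff in HF; destruct HF as [j [<- Hj]]; apply in_seq in Hj; apply Epoly_zbase; lia. }
  assert (Hf0 : n2 (neval g (zbase D m)) <= f (zbase D m)).
  { unfold f, phi; rewrite Hpen0; pose proof (sqnorm_ge0 (3 + m) (zbase D m)); nra. }
  assert (Hgz : forall z, tbounded D z -> n2 (neval g z) <= G * G).
  { intros z Hz; apply n2_le_Cnorm, HG, HM; auto. }
  assert (Htrunc : forall z, (forall i, (i < 3)%nat -> Cnorm (z i) <= 2) ->
     (forall j, (j < m)%nat -> Cnorm (z (3 + j)%nat) <= tT D j) ->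
     (forall k, (3 + m <= k)%nat -> z k = C0) -> tbounded D z).
  { intros z H1 H2 H3; split; auto; intros j; destruct (Nat.lt_ge_cases j m); auto.
    rewrite H3, Cnorm_0 by lia; pose proof (tT_ge1 D j); lra. }
  destruct (wall_chain f (f (zbase D m)) m (tT D) (zbase D m)) as [z [Hz1 [Hz2 [Hz3 Hz4]]]].
  - intros Z z HZ; apply phi_pcv; auto.
  - apply phi_steerable; auto.
  - intros z H1 H2 H4 H3 j Hj; specialize (H2 j Hj) as H2j; destruct (Rle_lt_or_eq_dec _ _ H2j) as [|E]; auto.
    exfalso.
    assert (Hz : tbounded D z) by (apply Htrunc; auto).
    assert (Hpen : eta <= penalty (eqs D m) z).
    (* With [|t_j| = T_j] and [|p_j t_j^2 - 1| < 1/2] one gets [|p_j| * T_j^2 <= 3/2], the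
       hypothesis of [PP_half]. *)
    { destruct (Rle_lt_dec (1/2) (Cnorm (neval (Epoly D j) z))) as [HE|HE].
      - apply Rle_trans with (n2 (neval (Epoly D j) z)).
        + apply Rle_trans with (1/4); [apply Rmin_l|]; rewrite <- Cnorm_sqr; nra.
        + apply penalty_In; right; apply in_map, in_seq; lia.
      - assert (Hhalf : Cnorm (neval (PP D m) z) <= c / 2).
        { apply (PP_half D m j z Hz); auto.
          unfold Epoly in HE; cbn [neval] in HE.
          rewrite <- E, <- !Cnorm_mul.
          pose proof (Cnorm_le_sub (Cmul (neval (phat D j) z) (Cmul (z (3 + j)%nat) (z (3 + j)%nat))) C1) as T.
          rewrite Cnorm_1 in T. unfold Csub in T; lra. }
        apply Rle_trans with (n2 (neval (NA (PP D m) (NC (Copp (neval (PP D m) (zbase D m))))) z));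
          [|apply penalty_In; left; auto].
        apply Rle_trans with (c * c / 4); [apply Rmin_r|]; rewrite <- Cnorm_sqr; cbn [neval].
        pose proof (Cnorm_le_sub (neval (PP D m) (zbase D m)) (neval (PP D m) z)) as T; fold c in T.
        rewrite Cnorm_sub_sym in T; unfold Csub in T. nra. }
    assert (Hg0 : 0 <= n2 (neval g (zbase D m))) by apply n2_ge0.
    assert (Hfz : f z <= G * G + im - L * eta).
    { unfold f, phi; specialize (HS2 z Hz); specialize (Hgz z Hz).
      assert (e * sqnorm (3 + m) z <= e * S2) by (apply Rmult_le_compat_l; lra).
      assert (L * eta <= L * penalty (eqs D m) z) by (apply Rmult_le_compat_l; auto). lra. }
    lra.
  - split; [|split; [|split]].
    (* The starting margin [2 * weps 0 = 2] is the whole radius of the polydisc, available because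
       the base point has [x = 0]. *)
    + intros i Hi; rewrite zbase_x, Cnorm_0 by auto; simpl; lra.
    + intros; apply zbase_tbounded.
    + intros; apply zbase_0; auto.
    + lra.
  - exists z.
    assert (Hz : tbounded D z) by (apply Htrunc; auto; apply Hz1).
    assert (Hfz : f z <= n2 (neval g z) + im - L * penalty (eqs D m) z).
    { unfold f, phi; specialize (HS2 z Hz).
      assert (e * sqnorm (3 + m) z <= e * S2) by (apply Rmult_le_compat_l; lra). lra. }
    pose proof (penalty_ge0 (eqs D m) z) as Hp0.
    repeat split; auto; try apply Hz1; try apply Hz.
    + intros j Hj.
      assert (n2 (neval (Epoly D j) z) <= penalty (eqs D m) z).
      { apply penalty_In; right; apply in_map, in_seq; lia. }
      assert (LP : L * penalty (eqs D m) z <= L * im).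
      { pose proof (n2_ge0 (neval g (zbase D m))); pose proof (Hgz z Hz); nra. }
      assert (0 < L) by nra.
      assert (penalty (eqs D m) z <= im) by (apply Rmult_le_reg_l with L; auto). lra.
    + assert (0 <= L * penalty (eqs D m) z) by (apply Rmult_le_pos; auto). fold im; lra.
Qed.

(** * The compact set and its hull *)

Definition solves (D : tower) (z : nat -> C) : Prop :=
  inK z /\ tbounded D z /\ forall j, neval (Epoly D j) z = C0.

Definition wlim (D : tower) (z : nat -> C) (w : C) : Prop :=
  Ccv (fun j => neval (wpoly D j) z) w.

Definition Xfull (D : tower) (xi : C4) : Prop :=
  exists z w, solves D z /\ wlim D z w /\ xi = mk4 z w.

Lemma wpoly_tail_le D z j n : tbounded D z -> (j <= n)%nat ->
  Cnorm (Csub (neval (wpoly D n) z) (neval (wpoly D j) z)) <= te D j / 2.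
Proof.
  intros Hz Hn; pose proof (wpoly_tail D z Hz (n - j) j) as H; pose proof (te_pos D (n - j + j)).
  replace (n - j + j)%nat with n in * by lia; lra.
Qed.

Lemma wlim_tail D z w j : tbounded D z -> wlim D z w ->
  Cnorm (Csub w (neval (wpoly D j) z)) <= te D j / 2.
Proof.
  intros Hz Hw.
  apply (Ccv_norm_le (fun n => Csub (neval (wpoly D (n + j)) z) (neval (wpoly D j) z))).
  - unfold Csub; apply Ccv_add; [|apply Ccv_const].
    apply (Ccv_sub (fun n => neval (wpoly D n) z) w (fun n => (n + j)%nat)); [intros; lia|auto].
  - intros n; apply wpoly_tail_le; auto; lia.
Qed.

Lemma wlim_exists D z : tbounded D z -> exists w, wlim D z w.
Proof.
  intros Hz; destruct (Cbounded_subseq (fun j => neval (wpoly D j) z) 1) as [s [w [Hs Hw]]].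
  { intros n; apply wpoly_bound; auto. }
  exists w; intros eps He.
  destruct (te_cv D (eps/2)) as [j Hj]; [lra|].
  destruct (Hw (eps/4)) as [N K]; [lra|].
  exists j; intros n Hn.
  pose proof (K (N + j)%nat ltac:(lia)) as A1; pose proof (Hs (N + j)%nat).
  pose proof (wpoly_tail_le D z j n Hz Hn) as A2.
  pose proof (wpoly_tail_le D z j (s (N + j)%nat) Hz ltac:(lia)) as A3.
  pose proof (Cnorm_triang_sub (neval (wpoly D n) z) (neval (wpoly D j) z) w) as T1.
  pose proof (Cnorm_triang_sub (neval (wpoly D j) z) (neval (wpoly D (s (N + j)%nat)) z) w) as T2.
  rewrite (Cnorm_sub_sym (neval (wpoly D j) z) (neval (wpoly D (s (N + j)%nat)) z)) in T2. lra.
Qed.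

Lemma wlim_bound D z w : tbounded D z -> wlim D z w -> Cnorm w <= 1.
Proof. intros Hz Hw; apply (Ccv_norm_le _ _ _ Hw); intros; apply wpoly_bound; auto. Qed.

(** The tails are uniform in the point, so the limits in [n] and [j] may be exchanged. The
    hypothesis on [v] covers both the full sums at [Z n] and partial sums whose length grows with
    [n]. *)
Lemma wlim_cv D Z z w v : tbounded D z -> pcv Z z -> wlim D z w ->
  (forall n j, (j <= n)%nat -> Cnorm (Csub (v n) (neval (wpoly D j) (Z n))) <= te D j / 2) -> Ccv v w.
Proof.
  intros Hz HZ Hw Hv eps He.
  destruct (te_cv D (eps/2)) as [j Hj]; [lra|].
  destruct (neval_pcv (wpoly D j) Z z HZ (eps/2)) as [N K]; [lra|].
  exists (N + j)%nat; intros n Hn.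
  pose proof (Hv n j ltac:(lia)) as A1; pose proof (K n ltac:(lia)) as A2.
  pose proof (wlim_tail D z w j Hz Hw) as A3; rewrite Cnorm_sub_sym in A3.
  pose proof (Cnorm_triang_sub (v n) (neval (wpoly D j) (Z n)) w) as T1.
  pose proof (Cnorm_triang_sub (neval (wpoly D j) (Z n)) (neval (wpoly D j) z) w) as T2. lra.
Qed.

Lemma Qd_pcv c Z z : pcv Z z -> Un_cv (fun n => Qd c (Z n)) (Qd c z).
Proof.
  intros H; assert (B : forall i, Un_cv (fun n => n2 (Csub (Z n i) (center c i))) (n2 (Csub (z i) (center c i)))).
  { intros i; apply Ccv_n2; unfold Csub; apply Ccv_add; [apply H|apply Ccv_const]. }
  unfold Qd; apply CV_plus; [apply CV_plus|]; apply B.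
Qed.

Lemma inK_closed Z z : (forall n, inK (Z n)) -> pcv Z z -> inK z.
Proof.
  intros HZ Hcv; split.
  - intros i Hi; apply (Ccv_norm_le (fun n => Z n i)); [apply Hcv|intros n; apply HZ; auto].
  - intros n; apply Rnot_lt_le; intros Hl.
    set (gap := weps n * weps n / 4 - Rabs (Qd (wall_center n) z - wall_level n)).
    destruct (Qd_pcv (wall_center n) Z z Hcv gap) as [N K]; [unfold gap; lra|].
    specialize (K N (le_n _)); destruct (HZ N) as [_ HK]; specialize (HK n); unfold Rdist, gap in *.
    pose proof (Rabs_triang (Qd (wall_center n) (Z N) - Qd (wall_center n) z) (Qd (wall_center n) z - wall_level n)) as T.
    replace (Qd (wall_center n) (Z N) - Qd (wall_center n) z + (Qd (wall_center n) z - wall_level n))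
      with (Qd (wall_center n) (Z N) - wall_level n) in T by ring. lra.
Qed.

Lemma tbounded_closed D Z z : (forall n, tbounded D (Z n)) -> pcv Z z -> tbounded D z.
Proof.
  intros HZ Hcv; split.
  - intros i Hi; apply (Ccv_norm_le (fun n => Z n i)); [apply Hcv|intros n; apply HZ; auto].
  - intros j; apply (Ccv_norm_le (fun n => Z n (3 + j)%nat)); [apply Hcv|intros n; apply HZ].
Qed.

Lemma tbounded_subseq D Z : (forall n, tbounded D (Z n)) ->
  exists s z, (forall n, (n <= s n)%nat) /\ pcv (fun n => Z (s n)) z.
Proof.
  intros HZ; apply (product_compact Z (fun k => if Nat.ltb k 3 then 2 else tT D (k - 3)%nat)).
  intros n k; destruct (HZ n) as [H1 H2]; destruct (Nat.ltb_spec k 3); auto.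
  specialize (H2 (k - 3)%nat); replace (3 + (k - 3))%nat with k in H2 by lia; auto.
Qed.

Definition cv4 (X : nat -> C4) (x : C4) : Prop := forall i, Ccv (fun n => X n i) (x i).

Lemma peval_cv4 p X x : cv4 X x -> Ccv (fun n => peval p (X n)) (peval p x).
Proof.
  intros H; induction p; simpl; [apply Ccv_const|apply H|apply Ccv_add|apply Ccv_mul]; auto.
Qed.

Lemma mk4_cv4 Z z v w : pcv Z z -> Ccv v w -> cv4 (fun n => mk4 (Z n) (v n)) (mk4 z w).
Proof. intros HZ Hv []; simpl; auto; apply HZ. Qed.

Lemma Xfull_bound D xi : Xfull D xi -> forall i, Cnorm (xi i) <= 3.
Proof.
  intros [z [w [[H1 [H2 _]] [H3 ->]]]]; apply mk4_bound; [apply H2|eapply wlim_bound; eauto].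
Qed.

(** The subsequence is chosen for lifts [(x, t)], where all conditions are closed, and then
    projected; continuity of [t] on the set is not yet available. *)
Lemma Xfull_compact D (X : nat -> C4) : (forall n, Xfull D (X n)) ->
  exists s x, (forall n, (n <= s n)%nat) /\ Xfull D x /\ cv4 (fun n => X (s n)) x.
Proof.
  intros HX.
  destruct (choice _ HX) as [Z HZ]; destruct (choice _ HZ) as [v Hv].
  destruct (tbounded_subseq D Z) as [s [z [Hs Hz]]]; [intros; apply Hv|].
  assert (Hzb : tbounded D z) by (apply (tbounded_closed D (fun n => Z (s n))); auto; intros; apply Hv).
  destruct (wlim_exists D z Hzb) as [w Hw].
  exists s, (mk4 z w); split; [auto|split].
  - exists z, w; split; [split; [|split]|split]; auto.
    + apply (inK_closed (fun n => Z (s n))); auto; intros; apply Hv.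
    + intros j; apply (Ccv_unique (fun n => neval (Epoly D j) (Z (s n)))); [apply neval_pcv; auto|].
      apply (Ccv_ext (fun _ => C0)); [|apply Ccv_const]; intros n; symmetry; apply Hv.
  - intros i.
    assert (Hm : cv4 (fun n => mk4 (Z (s n)) (v (s n))) (mk4 z w)).
    { apply mk4_cv4; auto. apply (wlim_cv D (fun n => Z (s n)) z); auto.
      intros n j Hj; apply wlim_tail; apply Hv. }
    apply (Ccv_ext (fun n => mk4 (Z (s n)) (v (s n)) i)); [|apply Hm].
    intros n; destruct (Hv (s n)) as [_ [_ ->]]; reflexivity.
Qed.

Definition zinf (D : tower) : nat -> C := fun k => if Nat.ltb k 3 then C0 else tr D (k - 3).

Lemma zinf_tbounded D : tbounded D (zinf D).
Proof.
  split.
  - intros i Hi; unfold zinf; destruct (Nat.ltb_spec i 3); [rewrite Cnorm_0; lra|lia].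
  - intros j; unfold zinf; destruct (Nat.ltb_spec (3 + j) 3); [lia|].
    replace (3 + j - 3)%nat with j by lia; apply Rlt_le, tr_lt.
Qed.

Lemma wpoly_zinf D j : neval (wpoly D j) (zinf D) = tw D j.
Proof.
  induction j; [rewrite tw_0; reflexivity|].
  cbn [wpoly neval]; rewrite IHj, tw_S; unfold zinf.
  destruct (Nat.ltb_spec (3 + j) 3); [lia|]; replace (3 + j - 3)%nat with j by lia; reflexivity.
Qed.

(** At stage [m] the test polynomial is [p] with its last variable replaced by [w_m]. The points
    found violate the first [m] equations by at most [1/(m+1)] in squared modulus, so a limit of
    them lies in the set and [|p|] there is at least its base value. *)
Lemma base_in_hull D w : wlim D (zinf D) w -> poly_hull (Xfull D) (mk4 czero w).
Proof.
  intros Hw p M HM.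
  assert (S1 : forall m, exists z, inK z /\ tbounded D z /\
    (forall j, (j < m)%nat -> n2 (neval (Epoly D j) z) <= / (INR m + 1)) /\
    n2 (peval p (mk4 czero (tw D m))) <= n2 (peval p (mk4 z (neval (wpoly D m) z))) + / (INR m + 1)).
  { intros m; destruct (hull_approx D (sub4 (wpoly D m) p) m) as [z [H1 [H2 [H3 H4]]]].
    exists z; rewrite !neval_sub4, wpoly_zbase in H4 by auto.
    split; [exact H1|split; [exact H2|split; [exact H3|exact H4]]]. }
  destruct (choice _ S1) as [Z HZ].
  destruct (tbounded_subseq D Z) as [s [z [Hs Hz]]]; [intros; apply HZ|].
  assert (Hinv : forall eps, 0 < eps -> exists N, forall n, (N <= n)%nat -> / (INR (s n) + 1) < eps).
  { intros eps He; destruct (archimed_cor1 eps He) as [N [HN1 HN2]]; exists N; intros n Hn.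
    apply Rle_lt_trans with (2 := HN1), Rinv_le_contravar; [apply lt_0_INR; auto|].
    specialize (Hs n); assert (HNn : (N <= s n)%nat) by lia; apply le_INR in HNn; lra. }
  assert (Hzb : tbounded D z) by (apply (tbounded_closed D (fun n => Z (s n))); auto; intros; apply HZ).
  destruct (wlim_exists D z Hzb) as [v Hv].
  assert (HX : Xfull D (mk4 z v)).
  { exists z, v; split; [split; [|split]|split]; auto.
    - apply (inK_closed (fun n => Z (s n))); auto; intros; apply HZ.
    - intros j; apply n2_eq0, Rle_antisym; [|apply n2_ge0].
      apply Rnot_lt_le; intros Hpos.
      pose proof (Ccv_n2 _ _ (neval_pcv (Epoly D j) _ _ Hz)) as Hcv.
      destruct (Hcv (n2 (neval (Epoly D j) z) / 2)) as [N1 K1]; [lra|].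
      destruct (Hinv (n2 (neval (Epoly D j) z) / 2)) as [N2 K2]; [lra|].
      set (n := (N1 + N2 + S j)%nat).
      pose proof (K1 n ltac:(lia)) as A1; pose proof (K2 n ltac:(lia)) as A2.
      pose proof (Hs n) as A3.
      destruct (HZ (s n)) as [_ [_ [A4 _]]]; specialize (A4 j ltac:(lia)).
      unfold Rdist in A1; apply Rabs_def2 in A1; lra. }
  apply Rle_trans with (2 := HM _ HX).
  assert (Hn2 : n2 (peval p (mk4 czero w)) <= n2 (peval p (mk4 z v))).
  { apply Rnot_lt_le; intros Hl.
    assert (C1' : Un_cv (fun n => n2 (peval p (mk4 czero (tw D (s n))))) (n2 (peval p (mk4 czero w)))).
    { apply Ccv_n2, peval_cv4; intros []; simpl; try apply Ccv_const.
      apply (Ccv_sub (fun n => tw D n) w s Hs).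
      apply (Ccv_ext (fun j => neval (wpoly D j) (zinf D))); auto; intros; apply wpoly_zinf. }
    assert (C2' : Un_cv (fun n => n2 (peval p (mk4 (Z (s n)) (neval (wpoly D (s n)) (Z (s n)))))) (n2 (peval p (mk4 z v)))).
    { apply Ccv_n2, peval_cv4, mk4_cv4; auto.
      apply (wlim_cv D (fun n => Z (s n)) z); auto.
      intros n j Hj; apply wpoly_tail_le; [apply HZ|specialize (Hs n); lia]. }
    set (g := n2 (peval p (mk4 czero w)) - n2 (peval p (mk4 z v))) in *.
    destruct (C1' (g/3)) as [N1 K1]; [unfold g; lra|]; destruct (C2' (g/3)) as [N2 K2]; [unfold g; lra|].
    destruct (Hinv (g/3)) as [N3 K3]; [unfold g; lra|].
    set (n := (N1 + N2 + N3)%nat).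
    pose proof (K1 n ltac:(lia)) as A1; pose proof (K2 n ltac:(lia)) as A2; pose proof (K3 n ltac:(lia)) as A3.
    destruct (HZ (s n)) as [_ [_ [_ A4]]].
    unfold Rdist, g in *; apply Rabs_def2 in A1; apply Rabs_def2 in A2; lra. }
  rewrite !Cnorm_sqrt; apply sqrt_le_1_alt; auto.
Qed.

Lemma inK_neq0 z : inK z -> (forall i, (i < 3)%nat -> z i = C0) -> False.
Proof.
  intros [_ H] H0; specialize (H 0%nat).
  replace (Qd (wall_center 0) z - wall_level 0) with 0 in H.
  - rewrite Rabs_R0 in H; simpl in H; lra.
  - unfold Qd; rewrite !H0 by lia.
    change (wall_center 0) with 0%nat; change (wall_level 0) with (0 / (0 + 1)).
    unfold n2; simpl; lra.
Qed.

Lemma base_notin_X D w : ~ Xfull D (mk4 czero w).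
Proof.
  intros [z [v [[H _] [_ E]]]]; apply (inK_neq0 z H); intros i Hi.
  assert (F : forall i, mk4 czero w i = mk4 z v i) by (rewrite E; auto).
  assert (Di : i = 0%nat \/ i = 1%nat \/ i = 2%nat) by lia.
  destruct Di as [->|[->| ->]]; [specialize (F i1)|specialize (F i2)|specialize (F i3)]; auto.
Qed.

(** * The uniform algebra P(X) *)

Definition bounded3 (Y : C4 -> Prop) : Prop := forall xi, Y xi -> forall i, Cnorm (xi i) <= 3.

Lemma PX_poly Y p : PX Y (fun x => peval p (proj1_sig x)).
Proof.
  intros eps He; exists p; intros x; replace (Csub _ _) with C0 by ring; rewrite Cnorm_0; auto.
Qed.

Lemma PX_const Y c : PX Y (fun _ => c).
Proof. apply (PX_poly Y (PConst c)). Qed.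

Lemma PX_add Y f g : PX Y f -> PX Y g -> PX Y (fadd f g).
Proof.
  intros Hf Hg eps He; destruct (Hf (eps/2)) as [p Hp]; [lra|]; destruct (Hg (eps/2)) as [q Hq]; [lra|].
  exists (PAdd p q); intros x; unfold fadd; simpl.
  replace (Csub _ _) with (Cadd (Csub (f x) (peval p (proj1_sig x))) (Csub (g x) (peval q (proj1_sig x)))) by ring.
  eapply Rle_lt_trans; [apply Cnorm_triang|]; specialize (Hp x); specialize (Hq x); lra.
Qed.

Lemma PX_bounded Y f : bounded3 Y -> PX Y f -> exists A, 0 < A /\ forall x, Cnorm (f x) <= A.
Proof.
  intros HB Hf; destruct (Hf 1 Rlt_0_1) as [p Hp].
  exists (pbound p + 1); split; [pose proof (pbound_ge0 p); lra|]; intros [x Hx]; specialize (Hp (exist _ x Hx)); simpl in Hp.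
  pose proof (Cnorm_le_sub (f (exist _ x Hx)) (peval p x)); pose proof (peval_bound p x (HB x Hx)); lra.
Qed.

Lemma PX_mul Y f g : bounded3 Y -> PX Y f -> PX Y g -> PX Y (fmul f g).
Proof.
  intros HB Hf Hg eps He.
  destruct (PX_bounded Y f HB Hf) as [A [HA0 HA]]; destruct (PX_bounded Y g HB Hg) as [B [HB0 HBg]].
  set (d := Rmin 1 (eps / (A + B + 2))).
  assert (Hd : 0 < d) by (apply Rmin_pos; [lra|apply Rdiv_lt_0_compat; lra]).
  assert (Hd2 : d * (A + B + 2) <= eps).
  { apply Rle_trans with (eps / (A + B + 2) * (A + B + 2)).
    - apply Rmult_le_compat_r; [lra|apply Rmin_r].
    - right; field; lra. }
  assert (Hd1 : d <= 1) by apply Rmin_l.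
  destruct (Hf d Hd) as [p Hp]; destruct (Hg d Hd) as [q Hq].
  exists (PMul p q); intros x; unfold fmul; simpl; specialize (Hp x); specialize (Hq x).
  eapply Rle_lt_trans; [apply Cmul_diff_le with (A := A) (B := B + 1) (da := d) (db := d); auto; try lra|nra].
  rewrite Cnorm_sub_sym in Hq.
  pose proof (Cnorm_le_sub (peval q (proj1_sig x)) (g x)); specialize (HBg x); lra.
Qed.

Lemma PX_scal Y c f : bounded3 Y -> PX Y f -> PX Y (fscal c f).
Proof. intros HB Hf; apply (PX_mul Y (fun _ => c) f HB (PX_const Y c) Hf). Qed.

Lemma PX_closed Y f : (forall eps, 0 < eps -> exists g, PX Y g /\ forall x, Cnorm (Csub (f x) (g x)) <= eps) -> PX Y f.
Proof.
  intros H eps He; destruct (H (eps/2)) as [g [Hg Hfg]]; [lra|]; destruct (Hg (eps/2)) as [p Hp]; [lra|].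
  exists p; intros x; specialize (Hfg x); specialize (Hp x).
  pose proof (Cnorm_triang_sub (f x) (g x) (peval p (proj1_sig x))); lra.
Qed.

Lemma PX_peval Y p (F : idx4 -> {x | Y x} -> C) : bounded3 Y -> (forall i, PX Y (F i)) ->
  PX Y (fun x => peval p (fun i => F i x)).
Proof.
  intros HB HF; induction p; simpl; auto.
  - apply PX_const.
  - apply (PX_add _ _ _ IHp1 IHp2).
  - apply (PX_mul _ _ _ HB IHp1 IHp2).
Qed.

(** * The adjoined functions belong to P(X) *)

Definition lifts (D : tower) (Y : C4 -> Prop) (zs : {x | Y x} -> nat -> C) : Prop :=
  forall x, solves D (zs x) /\ exists w, wlim D (zs x) w /\ proj1_sig x = mk4 (zs x) w.

Lemma lifts_exist D Y : (forall xi, Y xi -> Xfull D xi) -> exists zs, lifts D Y zs.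
Proof.
  intros H; apply (choice (fun (x : {x | Y x}) z => solves D z /\ exists w, wlim D z w /\ proj1_sig x = mk4 z w)).
  intros [x Hx]; destruct (H x Hx) as [z [w [H1 [H2 H3]]]]; exists z; simpl; eauto.
Qed.

Lemma solves_root D z j : solves D z ->
  Cmul (neval (phat D j) z) (Cmul (z (3 + j)%nat) (z (3 + j)%nat)) = C1.
Proof.
  intros [_ [_ H]]; specialize (H j); unfold Epoly in H; cbn [neval] in H.
  replace C1 with (Cadd C0 C1) by ring; rewrite <- H; ring.
Qed.

Lemma PX_wpoly D Y zs j : bounded3 Y -> (forall i, (i < j)%nat -> PX Y (fun x => zs x (3 + i)%nat)) ->
  PX Y (fun x => neval (wpoly D j) (zs x)).
Proof.
  intros HB; induction j; intros H; [apply (PX_const Y C0)|].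
  cbn [wpoly neval].
  apply (PX_add Y (fun x => neval (wpoly D j) (zs x)) (fscal (RtoC (tc D j)) (fun x => zs x (3 + j)%nat))).
  - apply IHj; intros; apply H; lia.
  - apply PX_scal; auto.
Qed.

Lemma lifts_coord D Y zs (x : {x | Y x}) i : lifts D Y zs -> i <> i4 -> proj1_sig x i = mk4 (zs x) C0 i.
Proof.
  intros H Hi; destruct (H x) as [_ [w [_ E]]]; rewrite E; destruct i; try reflexivity; congruence.
Qed.

Lemma PX_phat D Y zs j : bounded3 Y -> lifts D Y zs ->
  (forall i, (i < j)%nat -> PX Y (fun x => zs x (3 + i)%nat)) ->
  PX Y (fun x => neval (phat D j) (zs x)).
Proof.
  intros HB Hl H; unfold phat.
  replace (fun x => neval (sub4 (wpoly D j) (tp D j)) (zs x))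
    with (fun x => peval (tp D j) (fun i => mk4 (zs x) (neval (wpoly D j) (zs x)) i)).
  2:{ apply functional_extensionality; intros x; rewrite neval_sub4; reflexivity. }
  apply (PX_peval Y (tp D j) (fun i x => mk4 (zs x) (neval (wpoly D j) (zs x)) i) HB).
  assert (G : forall i, i <> i4 -> PX Y (fun x => mk4 (zs x) (neval (wpoly D j) (zs x)) i)).
  { intros i Hi; replace (fun x => mk4 (zs x) (neval (wpoly D j) (zs x)) i) with (fun x : {x | Y x} => peval (PVar i) (proj1_sig x)).
    - apply PX_poly.
    - apply functional_extensionality; intros x; simpl; rewrite (lifts_coord D Y zs x i Hl Hi).
      destruct i; try reflexivity; congruence. }
  intros i; destruct i; try (apply G; discriminate).
  apply PX_wpoly; auto.
Qed.

(* Newton's iteration for the inverse square root *)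
Fixpoint newton (q f : C) (n : nat) : C :=
  match n with
  | O => f
  | S n => Cmul (RtoC (1/2)) (Cmul (newton q f n)
             (Csub (RtoC 3) (Cmul q (Cmul (newton q f n) (newton q f n)))))
  end.

(** In the relative error [e] the iteration reads [e -> -(3/2 e^2 + 1/2 e^3)]; starting from [1/8]
    it at least halves the error, which is all that is used of its quadratic speed. *)
Lemma newton_cv q f t : Cmul q (Cmul t t) = C1 ->
  Cnorm (Csub f t) <= Cnorm t / 8 -> forall n, exists e,
  newton q f n = Cmul t (Cadd C1 e) /\ Cnorm e <= / 8 * (/ 2) ^ n.
Proof.
  intros Hq Hf.
  assert (Ht : t <> C0) by (intros ->; apply C1_neq0; rewrite <- Hq; ring).
  pose proof (Cnorm_pos t Ht) as Htp.
  induction n.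
  - exists (Cmul (Csub f t) (Cinv t)); split.
    + simpl. transitivity (Cadd t (Cmul (Csub f t) (Cmul t (Cinv t)))); [rewrite Cinv_r by auto; ring|ring].
    + rewrite Cnorm_mul, Cnorm_inv by auto; simpl.
      apply Rmult_le_reg_r with (Cnorm t); auto.
      rewrite Rmult_assoc, Rinv_l by lra. lra.
  - destruct IHn as [e [E He]].
    exists (Copp (Cadd (Cmul (RtoC (3/2)) (Cmul e e)) (Cmul (RtoC (1/2)) (Cmul e (Cmul e e))))); split.
    + cbn [newton]; rewrite E.
      replace (Cmul q (Cmul (Cmul t (Cadd C1 e)) (Cmul t (Cadd C1 e)))) with
        (Cmul (Cmul q (Cmul t t)) (Cmul (Cadd C1 e) (Cadd C1 e))) by ring.
      rewrite Hq. apply C_ext; simpl; field.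
    + rewrite Cnorm_opp. pose proof (Cnorm_ge0 e) as He0.
      assert (P : 0 < (/ 2) ^ n <= 1).
      { split; [apply pow_lt; lra|]. rewrite pow_inv. rewrite <- Rinv_1; apply Rinv_le_contravar; [lra|apply pow_R1_Rle; lra]. }
      eapply Rle_trans; [apply Cnorm_triang|]; rewrite !Cnorm_mul, !Cnorm_RtoC_pos by lra.
      simpl. assert (Cnorm e <= / 8) by nra.
      assert (Cnorm e * Cnorm e <= / 8 * Cnorm e) by nra.
      assert (Cnorm e * (Cnorm e * Cnorm e) <= / 8 * Cnorm e) by nra. nra.
Qed.

(** Strong induction: once the earlier [t_i] are in the algebra, so are [w_j] and [p_j(x, w_j)], and
    [(w - w_j) / c_j] is close enough to [t_j] to select the right root in Newton's iteration. The
    lift [zs] is arbitrary, so its continuity in each coordinate is a consequence. *)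
Lemma PX_tfun D Y zs : bounded3 Y -> lifts D Y zs -> forall j, PX Y (fun x => zs x (3 + j)%nat).
Proof.
  intros HB Hl j; induction j as [j IH] using (well_founded_induction Wf_nat.lt_wf).
  set (q := fun x => neval (phat D j) (zs x)).
  assert (Hq : PX Y q) by (apply (PX_phat D Y zs j HB Hl); auto).
  set (tau := fun x : {x | Y x} => Cmul (RtoC (/ tc D j)) (Csub (proj1_sig x i4) (neval (wpoly D j) (zs x)))).
  assert (Htau : PX Y tau).
  { apply (PX_scal Y (RtoC (/ tc D j)) (fun x => Csub (proj1_sig x i4) (neval (wpoly D j) (zs x))) HB).
    assert (Hw : PX Y (fun x => neval (wpoly D j) (zs x))) by (apply PX_wpoly; auto).
    replace (fun x : {x | Y x} => Csub (proj1_sig x i4) (neval (wpoly D j) (zs x))) with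
      (fadd (fun x : {x | Y x} => peval (PVar i4) (proj1_sig x)) (fscal (Copp C1) (fun x => neval (wpoly D j) (zs x)))).
    - apply PX_add; [apply PX_poly|apply PX_scal; auto].
    - apply functional_extensionality; intros x; unfold fadd, fscal; simpl; ring. }
  assert (Hn : forall n, PX Y (fun x => newton (q x) (tau x) n)).
  { induction n; auto. cbn [newton].
    apply (PX_scal Y (RtoC (1/2)) (fmul (fun x => newton (q x) (tau x) n)
       (fun x => Csub (RtoC 3) (Cmul (q x) (Cmul (newton (q x) (tau x) n) (newton (q x) (tau x) n))))) HB).
    apply PX_mul; auto.
    replace (fun x => Csub (RtoC 3) (Cmul (q x) (Cmul (newton (q x) (tau x) n) (newton (q x) (tau x) n))))
      with (fadd (fun _ => RtoC 3) (fscal (Copp C1) (fmul q (fmul (fun x => newton (q x) (tau x) n) (fun x => newton (q x) (tau x) n))))).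
    - apply PX_add; [apply PX_const|]; apply PX_scal; auto; apply PX_mul; auto; apply PX_mul; auto.
    - apply functional_extensionality; intros x; unfold fadd, fscal, fmul; ring. }
  pose proof (tc_pos D j) as Hc; pose proof (pbound_ge0 (tp D j)) as Hpb; pose proof (tT_ge1 D j) as HT.
  assert (Hclose : forall x, Cnorm (Csub (tau x) (zs x (3 + j)%nat)) <= Cnorm (zs x (3 + j)%nat) / 8).
  { intros x; destruct (Hl x) as [Hs [w [Hw E]]].
    set (t := zs x (3 + j)%nat).
    assert (Hb : tbounded D (zs x)) by apply Hs.
    (* The error is the tail beyond [w_(j+1)] divided by [c_j]; the definition of [te (S j)] was
       made for this estimate. *)
    assert (A1 : Cnorm (Csub (tau x) t) <= / (16 * (1 + pbound (tp D j)))).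
    { pose proof (wlim_tail D (zs x) w (S j) Hb Hw) as A; cbn [wpoly neval] in A; fold t in A.
      assert (E1 : Csub (tau x) t = Cmul (RtoC (/ tc D j))
         (Csub w (Cadd (neval (wpoly D j) (zs x)) (Cmul (RtoC (tc D j)) t)))).
      { unfold tau; rewrite E; simpl (mk4 _ _ i4).
        apply C_ext; simpl; field; lra. }
      rewrite E1, Cnorm_mul, Cnorm_RtoC_pos by (apply Rlt_le, Rinv_0_lt_compat; lra).
      rewrite te_S in A. apply Rmult_le_reg_l with (tc D j); auto.
      rewrite <- Rmult_assoc, Rinv_r, Rmult_1_l by lra.
      eapply Rle_trans; [apply A|right; field; lra]. }
    pose proof (solves_root D (zs x) j Hs) as Hr; fold t in Hr.
    pose proof (phat_bound D (zs x) j Hb) as Hpb2.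
    assert (Hr' : Cnorm (neval (phat D j) (zs x)) * (Cnorm t * Cnorm t) = 1) by (rewrite <- !Cnorm_mul, Hr, Cnorm_1; auto).
    pose proof (Cnorm_ge0 t) as Ht0; pose proof (Cnorm_ge0 (neval (phat D j) (zs x))) as Hp0.
    (* A root cannot be small, since [|p_j| |t_j|^2 = 1] with [p_j] bounded. With [A1] the relative
       error is at most 1/16. *)
    assert (A2 : / (1 + pbound (tp D j)) <= Cnorm t).
    { apply Rnot_lt_le; intros Hlt.
      assert (B : Cnorm t * (1 + pbound (tp D j)) < 1).
      { apply Rlt_le_trans with (/ (1 + pbound (tp D j)) * (1 + pbound (tp D j))); [apply Rmult_lt_compat_r; lra|].
        right; field; lra. }
      assert (Cnorm t <= 1) by nra.
      assert (Cnorm (neval (phat D j) (zs x)) * (Cnorm t * Cnorm t) <= pbound (tp D j) * Cnorm t).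
      { apply Rmult_le_compat; auto; nra. }
      nra. }
    eapply Rle_trans; [apply A1|].
    replace (/ (16 * (1 + pbound (tp D j)))) with (/ (1 + pbound (tp D j)) / 16) by (field; lra). lra. }
  apply PX_closed; intros eps He.
  destruct (pow_lt_1_zero (/2)) with (y := eps / tT D j) as [N K].
  { rewrite Rabs_pos_eq; lra. }
  { apply Rdiv_lt_0_compat; lra. }
  specialize (K N (le_n _)); rewrite Rabs_pos_eq in K by (apply pow_le; lra).
  exists (fun x => newton (q x) (tau x) N); split; auto.
  intros x; destruct (Hl x) as [Hs _].
  destruct (newton_cv (q x) (tau x) (zs x (3 + j)%nat) (solves_root D (zs x) j Hs) (Hclose x) N) as [e [E Hee]].
  rewrite E.
  replace (Csub _ _) with (Copp (Cmul (zs x (3 + j)%nat) e)) by ring.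
  rewrite Cnorm_opp, Cnorm_mul.
  assert (Hb : Cnorm (zs x (3 + j)%nat) <= tT D j) by apply Hs.
  pose proof (Cnorm_ge0 (zs x (3 + j)%nat)); pose proof (Cnorm_ge0 e).
  apply Rle_trans with (tT D j * (eps / tT D j)); [|right; field; lra].
  apply Rmult_le_compat; auto; nra.
Qed.

Definition dense_squares (Y : C4 -> Prop) : Prop := forall p eps, 0 < eps -> exists s t,
  PX Y s /\ PX Y t /\ (forall x, Cmul (s x) (t x) = C1) /\
  forall x, Cnorm (Csub (peval p (proj1_sig x)) (Cmul (s x) (s x))) < eps.

Lemma Xfull_dense_squares D Y : (forall xi, Y xi -> Xfull D xi) -> dense_squares Y.
Proof.
  intros HY p eps He.
  assert (HB : bounded3 Y) by (intros xi H; apply (Xfull_bound D); auto).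
  destruct (lifts_exist D Y HY) as [zs Hl].
  destruct (qpoly_dense p (eps/8)) as [j [Hj1 Hj2]]; [lra|].
  set (t := fun x => zs x (3 + j)%nat); set (q := fun x => neval (phat D j) (zs x)).
  assert (Ht : PX Y t) by (apply (PX_tfun D); auto).
  assert (Hq : PX Y q) by (apply (PX_phat D Y zs j HB Hl); intros; apply (PX_tfun D); auto).
  (* From [q t t = 1]: the element [q t] has inverse [t] and square [q (q t t) = q]. *)
  exists (fmul q t), t; split; [apply PX_mul; auto|split; [auto|]].
  assert (Hr : forall x, Cmul (q x) (Cmul (t x) (t x)) = C1).
  { intros x; apply solves_root, Hl. }
  split; intros x; unfold fmul.
  - rewrite <- (Hr x); ring.
  - replace (Cmul (Cmul (q x) (t x)) (Cmul (q x) (t x))) with (Cmul (q x) (Cmul (q x) (Cmul (t x) (t x)))) by ring.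
    rewrite Hr; replace (Cmul (q x) C1) with (q x) by ring.
    destruct (Hl x) as [Hs [w [Hw E]]].
    assert (Hb : tbounded D (zs x)) by apply Hs.
    assert (Hxb : forall i, Cnorm (proj1_sig x i) <= 3) by (apply HB, proj2_sig).
    (* Three errors: from [p] to [qpoly j], from there to [tp j], and from [w] to [w_j] inside
       [tp j]; they are at most 2/16, 2/16 and 3/16 of [eps]. *)
    pose proof (Hj2 _ Hxb) as A1.
    pose proof (tp_approx D j (proj1_sig x)) as A2; rewrite Cnorm_sub_sym in A2.
    pose proof (tc_pos D j) as Hc; pose proof (tT_ge1 D j) as HT.
    assert (A3 : Cnorm (Csub w (neval (wpoly D j) (zs x))) <= 3/2 * (tc D j * tT D j)).
    { pose proof (wlim_tail D (zs x) w (S j) Hb Hw) as A.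
      pose proof (te_decr D j).
      pose proof (Cnorm_triang_sub w (neval (wpoly D (S j)) (zs x)) (neval (wpoly D j) (zs x))) as T.
      assert (B : Cnorm (Csub (neval (wpoly D (S j)) (zs x)) (neval (wpoly D j) (zs x))) <= tc D j * tT D j).
      { cbn [wpoly neval]. replace (Csub _ _) with (Cmul (RtoC (tc D j)) (zs x (3 + j)%nat)) by ring.
        rewrite Cnorm_mul, Cnorm_RtoC_pos by lra. apply Rmult_le_compat_l; [lra|apply Hb]. }
      lra. }
    assert (A4 : Cnorm (Csub (peval (tp D j) (proj1_sig x)) (q x)) <= plip (tp D j) * (3/2 * (tc D j * tT D j))).
    { unfold q, phat; rewrite neval_sub4; apply peval_lip; auto.
      - assert (0 < tc D j * tT D j) by (apply Rmult_lt_0_compat; lra). lra.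
      - apply mk4_bound; [apply Hb|apply wpoly_bound; auto].
      - assert (0 < tc D j * tT D j) by (apply Rmult_lt_0_compat; lra).
        intros i; rewrite E; destruct i; simpl; auto;
          (replace (Csub _ _) with C0 by ring; rewrite Cnorm_0; lra). }
    pose proof (tc_lip D j) as A5.
    pose proof (Cnorm_triang_sub (peval p (proj1_sig x)) (peval (qpoly j) (proj1_sig x)) (q x)) as T1.
    pose proof (Cnorm_triang_sub (peval (qpoly j) (proj1_sig x)) (peval (tp D j) (proj1_sig x)) (q x)) as T2.
    nra.
Qed.

(** * Consequences of the density of squares of invertible elements *)

Lemma dense_squares_fun Y f eps : dense_squares Y -> PX Y f -> 0 < eps -> exists s t,
  PX Y s /\ PX Y t /\ (forall x, Cmul (s x) (t x) = C1) /\
  forall x, Cnorm (Csub (f x) (Cmul (s x) (s x))) < eps.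
Proof.
  intros HD Hf He; destruct (Hf (eps/2)) as [p Hp]; [lra|].
  destruct (HD p (eps/2)) as [s [t [Hs [Ht [Hst Hps]]]]]; [lra|].
  exists s, t; repeat split; auto; intros x; specialize (Hp x); specialize (Hps x).
  pose proof (Cnorm_triang_sub (f x) (peval p (proj1_sig x)) (Cmul (s x) (s x))); lra.
Qed.

Lemma dense_squares_invertibles Y : bounded3 Y -> dense_squares Y -> dense_invertibles Y.
Proof.
  intros HB HD f Hf eps He.
  destruct (dense_squares_fun Y f eps HD Hf He) as [s [t [Hs [Ht [Hst Hps]]]]].
  exists (fmul s s), (fmul t t); split; [apply PX_mul; auto|split; [apply PX_mul; auto|split]].
  - intros x; unfold fmul.
    transitivity (Cmul (Cmul (s x) (t x)) (Cmul (s x) (t x))); [ring|rewrite Hst; ring].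
  - intros x; apply Hps.
Qed.

Definition fsub {Y : C4 -> Prop} (f g : {x | Y x} -> C) : {x | Y x} -> C := fun x => Csub (f x) (g x).

Lemma fsub_eq Y (f g : {x | Y x} -> C) : fsub f g = fadd f (fscal (Copp C1) g).
Proof. apply functional_extensionality; intros x; unfold fsub, fadd, fscal; ring. Qed.

Lemma PX_fsub Y f g : bounded3 Y -> PX Y f -> PX Y g -> PX Y (fsub f g).
Proof. intros; rewrite fsub_eq; apply PX_add; auto; apply PX_scal; auto. Qed.

Lemma linear_fsub Y L f g : bounded3 Y -> linear_on_PX Y L -> PX Y f -> PX Y g ->
  L (fsub f g) = Csub (L f) (L g).
Proof.
  intros HB [H1 H2] Hf Hg; rewrite fsub_eq, H1, H2; auto; [ring|apply PX_scal; auto].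
Qed.

Lemma PX_fone Y : PX Y (fone Y).
Proof. apply PX_const. Qed.

Lemma neumann Y f rho : bounded3 Y -> PX Y f -> 0 <= rho < 1 -> (forall x, Cnorm (f x) <= rho) ->
  PX Y (fun x => Cinv (Csub C1 (f x))) /\ forall x, Cmul (Csub C1 (f x)) (Cinv (Csub C1 (f x))) = C1.
Proof.
  intros HB Hf Hr Hb.
  assert (Hlow : forall x, 1 - rho <= Cnorm (Csub C1 (f x))).
  { intros x; pose proof (Cnorm_le_sub C1 (f x)); rewrite Cnorm_1 in *; specialize (Hb x); lra. }
  assert (Hinv : forall x, Cmul (Csub C1 (f x)) (Cinv (Csub C1 (f x))) = C1).
  { intros x; apply Cinv_r; intros E; specialize (Hlow x); rewrite E, Cnorm_0 in Hlow; lra. }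
  split; auto.
  set (geo := nat_rect (fun _ => {x | Y x} -> C) (fone Y) (fun n g => fadd (fone Y) (fmul f g))).
  assert (Hgeo : forall n, PX Y (geo n)).
  { induction n; [apply PX_fone|]; apply PX_add; [apply PX_fone|apply PX_mul; auto]. }
  assert (Hrem : forall n x, Cnorm (Csub C1 (Cmul (Csub C1 (f x)) (geo n x))) <= rho ^ S n).
  { induction n; intros x.
    - change (geo 0%nat x) with C1; replace (Csub _ _) with (f x) by ring; specialize (Hb x); simpl; lra.
    - change (geo (S n) x) with (Cadd C1 (Cmul (f x) (geo n x))).
      replace (Csub _ _) with (Cmul (f x) (Csub C1 (Cmul (Csub C1 (f x)) (geo n x)))) by ring.
      rewrite Cnorm_mul. change (rho ^ S (S n)) with (rho * rho ^ S n).
      apply Rmult_le_compat; auto using Cnorm_ge0. }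
  apply PX_closed; intros eps He.
  destruct (pow_lt_1_zero rho) with (y := eps * (1 - rho)) as [N K].
  { rewrite Rabs_pos_eq; lra. }
  { apply Rmult_lt_0_compat; lra. }
  specialize (K (S N) ltac:(lia)); rewrite Rabs_pos_eq in K by (apply pow_le; lra).
  exists (geo N); split; auto; intros x.
  specialize (Hrem N x); specialize (Hlow x); specialize (Hinv x).
  set (a := Csub C1 (f x)) in *; set (k := Cinv a) in *.
  assert (E : Cmul a (Csub k (geo N x)) = Csub C1 (Cmul a (geo N x))) by (rewrite <- Hinv; ring).
  rewrite <- E, Cnorm_mul in Hrem.
  pose proof (Cnorm_ge0 (Csub k (geo N x))).
  apply Rmult_le_reg_l with (1 - rho); [lra|]. nra.
Qed.

(** Continuity of characters is automatic: if [|phi f|] exceeded the bound, [1 - f / phi f] would be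
    invertible by the Neumann series and yet annihilated by [phi]. *)
Lemma character_bound Y phi f M : bounded3 Y -> character Y phi -> PX Y f -> 0 <= M ->
  (forall x, Cnorm (f x) <= M) -> Cnorm (phi f) <= M.
Proof.
  intros HB [HL [Hm H1]] Hf HM Hb; apply Rnot_lt_le; intros Hlt.
  assert (Hn : phi f <> C0) by (intros E; rewrite E, Cnorm_0 in Hlt; lra).
  set (g := fscal (Cinv (phi f)) f).
  assert (Hg : PX Y g) by (apply PX_scal; auto).
  destruct (neumann Y g (M / Cnorm (phi f)) HB Hg) as [K1 K2].
  - split.
    + apply Rmult_le_pos; auto; apply Rlt_le, Rinv_0_lt_compat; lra.
    + apply Rmult_lt_reg_r with (Cnorm (phi f)); [lra|]; unfold Rdiv; rewrite Rmult_assoc, Rinv_l; lra.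
  - intros x; unfold g, fscal; rewrite Cnorm_mul, Cnorm_inv by auto.
    unfold Rdiv; rewrite Rmult_comm; apply Rmult_le_compat_r; auto.
    apply Rlt_le, Rinv_0_lt_compat; lra.
  - set (k := fun x => Cinv (Csub C1 (g x))) in *.
    assert (E : fmul (fsub (fone Y) g) k = fone Y).
    { apply functional_extensionality; intros x; apply K2. }
    assert (F : phi (fmul (fsub (fone Y) g) k) = C0).
    { rewrite Hm; auto; [|apply PX_fsub; auto; apply PX_fone].
      rewrite (linear_fsub Y phi); auto; [|apply PX_fone].
      unfold g; destruct HL as [_ HL2]; rewrite HL2, H1 by auto.
      replace (Cmul (Cinv (phi f)) (phi f)) with (Cmul (phi f) (Cinv (phi f))) by ring.
      rewrite Cinv_r by auto; ring. }
    rewrite E, H1 in F; apply C1_neq0; auto.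
Qed.

(** Approximate form of: some [s] in the unit ball has [psi s = 0] and [|phi s| >= k]. The slack is
    unavoidable because square roots exist only approximately. *)
Definition separates_at {Y : C4 -> Prop} (phi psi : ({x | Y x} -> C) -> C) (k : R) : Prop :=
  forall eta, 0 < eta -> exists s, PX Y s /\ (forall x, Cnorm (s x) <= 1 + eta) /\
    k - eta <= Cnorm (phi s) /\ Cnorm (psi s) <= eta.

Lemma separates_sqrt Y (phi psi : ({x | Y x} -> C) -> C) k : bounded3 Y -> dense_squares Y ->
  character Y phi -> character Y psi -> 0 <= k -> separates_at phi psi k -> separates_at phi psi (sqrt k).
Proof.
  intros HB HD Hphi Hpsi Hk H eta' Heta'.
  set (eta := Rmin eta' 1).
  assert (Heta : 0 < eta <= 1) by (split; [apply Rmin_pos; lra|apply Rmin_r]).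
  assert (Hee : eta <= eta') by apply Rmin_l.
  (* Taking square roots turns an error of order [eta * eta] into one of order [eta]. *)
  destruct (H (eta * eta / 2)) as [s0 [Hs0 [B0 [P0 Q0]]]]; [nra|].
  destruct (dense_squares_fun Y s0 (eta * eta / 2) HD Hs0) as [s [t [Hs [_ [_ Hss]]]]]; [nra|].
  assert (Hd : PX Y (fsub s0 (fmul s s))) by (apply PX_fsub; auto; apply PX_mul; auto).
  assert (Key : forall chi, character Y chi ->
     Cnorm (Csub (chi s0) (Cmul (chi s) (chi s))) <= eta * eta / 2).
  { intros chi Hc. destruct (Hc) as [HL [Hm _]].
    rewrite <- Hm, <- (linear_fsub Y chi) by (auto; apply PX_mul; auto).
    apply (character_bound Y); auto; [nra|]. intros x; apply Rlt_le, Hss. }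
  exists s; split; [auto|split; [|split]].
  - intros x; specialize (B0 x); specialize (Hss x).
    pose proof (Cnorm_le_sub (Cmul (s x) (s x)) (s0 x)) as T; rewrite Cnorm_sub_sym in T.
    rewrite Cnorm_mul in T; pose proof (Cnorm_ge0 (s x)).
    assert (Cnorm (s x) * Cnorm (s x) <= 1 + eta * eta) by lra. nra.
  - pose proof (Key phi Hphi) as T1.
    pose proof (Cnorm_le_sub (phi s0) (Cmul (phi s) (phi s))) as T; rewrite Cnorm_mul in T.
    pose proof (Cnorm_ge0 (phi s)); pose proof (sqrt_pos k); pose proof (sqrt_sqrt k Hk).
    apply Rnot_lt_le; intros Hlt.
    assert (Cnorm (phi s) < sqrt k - eta) by lra. nra.
  - pose proof (Key psi Hpsi) as T1.
    pose proof (Cnorm_le_sub (Cmul (psi s) (psi s)) (psi s0)) as T; rewrite Cnorm_mul, Cnorm_sub_sym in T.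
    pose proof (Cnorm_ge0 (psi s)). assert (Cnorm (psi s) <= eta) by nra. lra.
Qed.

Lemma separates_one Y (phi psi : ({x | Y x} -> C) -> C) k : bounded3 Y -> dense_squares Y ->
  character Y phi -> character Y psi -> 0 < k <= 1 -> separates_at phi psi k ->
  forall eta, 0 < eta -> exists s, PX Y s /\ (forall x, Cnorm (s x) <= 1) /\
    1 - eta <= Cnorm (phi s) /\ Cnorm (psi s) <= eta.
Proof.
  intros HB HD Hphi Hpsi Hk H eta Heta.
  set (kn := nat_rect (fun _ => R) k (fun _ x => sqrt x)).
  (* Geometric rate: [1 - sqrt x = (1 - x) / (1 + sqrt x)], and [sqrt x >= k] along the
     iteration. *)
  assert (Hkn : forall n, k <= kn n <= 1 /\ separates_at phi psi (kn n) /\ 1 - kn n <= (/ (1 + k)) ^ n).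
  { induction n.
    - simpl; repeat split; auto; lra.
    - destruct IHn as [[I1 I2] [I3 I4]].
      change (kn (S n)) with (sqrt (kn n)).
      pose proof (sqrt_pos (kn n)) as S0; pose proof (sqrt_sqrt (kn n) ltac:(lra)) as S1.
      set (r := sqrt (kn n)) in *.
      assert (r <= 1) by nra. assert (k <= r) by nra.
      repeat split; auto.
      + apply separates_sqrt; auto; lra.
      + simpl. apply Rmult_le_reg_l with (1 + k); [lra|].
        rewrite <- Rmult_assoc, Rinv_r, Rmult_1_l by lra. nra. }
  set (e1 := Rmin (eta / 4) 1).
  assert (He1 : 0 < e1 <= 1) by (split; [apply Rmin_pos; lra|apply Rmin_r]).
  assert (He2 : e1 <= eta / 4) by apply Rmin_l.
  destruct (pow_lt_1_zero (/ (1 + k))) with (y := e1) as [N K]; [|lra|].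
  { rewrite Rabs_pos_eq by (apply Rlt_le, Rinv_0_lt_compat; lra).
    rewrite <- Rinv_1; apply Rinv_lt_contravar; lra. }
  specialize (K N (le_n _)).
  rewrite Rabs_pos_eq in K by (apply pow_le, Rlt_le, Rinv_0_lt_compat; lra).
  destruct (Hkn N) as [[I1 I2] [I3 I4]].
  destruct (I3 e1) as [s [Hs [B [P Q]]]]; [lra|].
  assert (Hc : 0 < / (1 + e1) <= 1).
  { split; [apply Rinv_0_lt_compat; lra|]. rewrite <- Rinv_1; apply Rinv_le_contravar; lra. }
  assert (Hc2 : / (1 + e1) * (1 + e1) = 1) by (apply Rinv_l; lra).
  exists (fscal (RtoC (/ (1 + e1))) s); split; [apply PX_scal; auto|split; [|split]].
  - intros x; unfold fscal; rewrite Cnorm_mul, Cnorm_RtoC_pos by lra.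
    apply Rle_trans with (/ (1 + e1) * (1 + e1)); [|lra]; apply Rmult_le_compat_l; [lra|apply B].
  - destruct Hphi as [[_ HL] _]; rewrite HL, Cnorm_mul, Cnorm_RtoC_pos by (auto; lra).
    apply Rmult_le_reg_l with (1 + e1); [lra|].
    replace ((1 + e1) * (/ (1 + e1) * Cnorm (phi s))) with (/ (1 + e1) * (1 + e1) * Cnorm (phi s)) by ring.
    rewrite Hc2. nra.
  - destruct Hpsi as [[_ HL] _]; rewrite HL, Cnorm_mul, Cnorm_RtoC_pos by (auto; lra).
    pose proof (Cnorm_ge0 (psi s)). nra.
Qed.

(* Square roots push the separation of two characters up to 1, and composing with a Moebius
   transformation of the disc then brings their distance arbitrarily close to 2. *)
Lemma dense_squares_gleason Y phi psi : bounded3 Y -> dense_squares Y ->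
  character Y phi -> character Y psi -> dual_dist_lt2 Y phi psi -> forall f, PX Y f -> phi f = psi f.
Proof.
  intros HB HD Hphi Hpsi [r [Hr Hdist]] f Hf; apply NNPP; intros Hne.
  assert (Hf1 : PX Y (fsub f (fscal (psi f) (fone Y)))) by (apply PX_fsub; auto; apply PX_scal; auto; apply PX_fone).
  destruct (PX_bounded Y _ HB Hf1) as [A [HA HAb]].
  (* Normalized to lie in the unit ball and in the kernel of [psi]. *)
  set (f1 := fscal (RtoC (/ A)) (fsub f (fscal (psi f) (fone Y)))).
  assert (HiA : 0 < / A) by (apply Rinv_0_lt_compat; auto).
  assert (Hval : forall chi, character Y chi -> chi f1 = Cmul (RtoC (/ A)) (Csub (chi f) (psi f))).
  { intros chi [HL [_ H1]]; unfold f1; destruct (HL) as [_ HL2]; rewrite HL2 by auto; f_equal.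
    rewrite (linear_fsub Y chi); auto; [|apply PX_scal; auto; apply PX_fone].
    rewrite HL2, H1 by apply PX_fone; ring. }
  assert (Pf1 : PX Y f1) by (apply PX_scal; auto).
  assert (Bf1 : forall x, Cnorm (f1 x) <= 1).
  { intros x; unfold f1; unfold fscal at 1; rewrite Cnorm_mul, Cnorm_RtoC_pos by lra.
    apply Rmult_le_reg_l with A; auto.
    rewrite <- Rmult_assoc, Rinv_r, Rmult_1_l, Rmult_1_r by lra; apply HAb. }
  set (k := Cnorm (phi f1)).
  assert (Hk : 0 < k <= 1).
  { split; [|apply (character_bound Y); auto; lra].
    unfold k; rewrite (Hval phi Hphi), Cnorm_mul, Cnorm_RtoC_pos by lra.
    apply Rmult_lt_0_compat; auto; apply Cnorm_pos; intros E; apply Hne.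
    replace (phi f) with (Cadd (Csub (phi f) (psi f)) (psi f)) by ring; rewrite E; ring. }
  assert (Hsep : separates_at phi psi k).
  { intros eta Heta; exists f1; split; [auto|split; [|split]].
    - intros x; specialize (Bf1 x); lra.
    - unfold k; lra.
    - rewrite (Hval psi Hpsi); replace (Csub (psi f) (psi f)) with C0 by ring.
      rewrite Cnorm_mul, Cnorm_0; lra. }
  (* The Moebius image [h] of [s] will have [phi h] near [1] and [psi h] near [-b], at distance
     about [1 + b], which exceeds [r] because [r < 2]. *)
  set (b := Rmax (r / 2) (1 / 2)).
  assert (Hb : 1 / 2 <= b < 1) by (split; [apply Rmax_r|apply Rmax_lub_lt; lra]).
  assert (Hbr : r < 1 + b) by (assert (r / 2 <= b) by apply Rmax_l; lra).
  (* Makes each of the two errors [2 * eta / (1 - b)] a quarter of the gap [1 + b - r]. *)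
  set (eta := (1 + b - r) * (1 - b) / 8).
  assert (Heta : 0 < eta) by (unfold eta; apply Rdiv_lt_0_compat; [apply Rmult_lt_0_compat; lra|lra]).
  set (eta' := Rmin eta (1/2)).
  assert (Heta' : 0 < eta' <= 1/2) by (split; [apply Rmin_pos; lra|apply Rmin_r]).
  assert (Hee : eta' <= eta) by apply Rmin_l.
  destruct (separates_one Y phi psi k HB HD Hphi Hpsi Hk Hsep eta') as [s0 [Hs0 [B0 [P0 Q0]]]]; [lra|].
  set (l := Cnorm (phi s0)) in *.
  assert (Hl : l <= 1) by (apply (character_bound Y); auto; lra).
  assert (Hl0 : 0 < l) by lra.
  set (u := Cmul (RtoC (/ l)) (Cconj (phi s0))).
  assert (Nu : Cnorm u = 1).
  { unfold u; rewrite Cnorm_mul, Cnorm_RtoC_pos by (apply Rlt_le, Rinv_0_lt_compat; lra).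
    replace (Cnorm (Cconj (phi s0))) with l by (unfold l, Cnorm; f_equal; simpl; ring).
    apply Rinv_l; lra. }
  assert (Eu : Cmul u (phi s0) = RtoC l).
  { unfold u; transitivity (Cmul (RtoC (/ l)) (RtoC (l * l))).
    - replace (l * l) with (n2 (phi s0)) by (symmetry; apply Cnorm_sqr).
      unfold n2; ceq.
    - apply C_ext; simpl; field; lra. }
  set (s := fscal u s0).
  assert (Hs : PX Y s) by (apply PX_scal; auto).
  assert (Bs : forall x, Cnorm (s x) <= 1) by (intros x; unfold s, fscal; rewrite Cnorm_mul, Nu, Rmult_1_l; auto).
  assert (phis : phi s = RtoC l) by (unfold s; destruct Hphi as [[_ HL] _]; rewrite HL by auto; auto).
  assert (psis : Cnorm (psi s) <= eta').
  { unfold s; destruct Hpsi as [[_ HL] _]; rewrite HL, Cnorm_mul, Nu by auto; lra. }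
  destruct (neumann Y (fscal (RtoC b) s) b HB (PX_scal Y (RtoC b) s HB Hs)) as [K1 K2]; [lra| |].
  { intros x; unfold fscal; rewrite Cnorm_mul, Cnorm_RtoC_pos by lra. specialize (Bs x); pose proof (Cnorm_ge0 (s x)); nra. }
  set (g := fun x => Cinv (Csub C1 (fscal (RtoC b) s x))) in *.
  set (num := fsub s (fscal (RtoC b) (fone Y))).
  set (den := fsub (fone Y) (fscal (RtoC b) s)).
  assert (Hnum : PX Y num) by (apply PX_fsub; auto; apply PX_scal; auto; apply PX_fone).
  assert (Hden : PX Y den) by (apply PX_fsub; auto; [apply PX_fone|apply PX_scal; auto]).
  set (h := fmul num g).
  assert (Hh : PX Y h) by (apply PX_mul; auto).
  assert (Bh : normle Y h 1).
  { intros x; unfold h, fmul.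
    assert (E : n2 (num x) <= n2 (den x)).
    { pose proof (n2_le_Cnorm _ _ (Bs x)) as N.
      (* The identity showing that the Moebius map preserves the closed disc. *)
      assert (G : n2 (den x) - n2 (num x) = (1 - b * b) * (1 - n2 (s x))).
      { change (den x) with (Csub C1 (Cmul (RtoC b) (s x))); change (num x) with (Csub (s x) (Cmul (RtoC b) C1)).
        unfold n2; simpl; ring. }
      assert (0 <= (1 - b * b) * (1 - n2 (s x))) by (apply Rmult_le_pos; nra). lra. }
    assert (E2 : Cnorm (num x) <= Cnorm (den x)) by (rewrite !Cnorm_sqrt; apply sqrt_le_1_alt; auto).
    assert (E3 : Cmul (den x) (g x) = C1) by apply K2.
    rewrite Cnorm_mul, <- Cnorm_1, <- E3, Cnorm_mul; apply Rmult_le_compat_r; auto using Cnorm_ge0. }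
  assert (Hchi : forall chi, character Y chi ->
     Cmul (chi h) (Csub C1 (Cmul (RtoC b) (chi s))) = Csub (chi s) (RtoC b)).
  { intros chi [HL [Hm H1]]; pose proof HL as [_ HL2].
    assert (E1 : chi den = Csub C1 (Cmul (RtoC b) (chi s))).
    { unfold den; rewrite (linear_fsub Y chi), HL2, H1; auto; [apply PX_fone|apply PX_scal; auto]. }
    assert (E2 : chi num = Csub (chi s) (RtoC b)).
    { unfold num; rewrite (linear_fsub Y chi), HL2, H1; auto; [ring|apply PX_fone|apply PX_scal; auto; apply PX_fone]. }
    rewrite <- E1, <- E2, <- Hm by auto; f_equal.
    apply functional_extensionality; intros x; unfold h, fmul.
    assert (E3 : Cmul (den x) (g x) = C1) by apply K2.
    transitivity (Cmul (num x) (Cmul (den x) (g x))); [ring|rewrite E3; ring]. }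
  specialize (Hdist h Hh Bh).
  assert (A1 : Cnorm (Csub (phi h) C1) <= 2 * eta / (1 - b)).
  { pose proof (Hchi phi Hphi) as E; rewrite phis in E.
    assert (D0 : 0 < 1 - b * l) by nra.
    assert (E1 : Cmul (Csub (phi h) C1) (RtoC (1 - b * l)) = RtoC ((l - b) - (1 - b * l))).
    { transitivity (Csub (Cmul (phi h) (Csub C1 (Cmul (RtoC b) (RtoC l)))) (RtoC (1 - b * l))); [ceq|].
      rewrite E; ceq. }
    apply (f_equal Cnorm) in E1; rewrite Cnorm_mul, Cnorm_RtoC_pos, Cnorm_RtoC in E1 by lra.
    assert (E2 : Rabs (l - b - (1 - b * l)) <= 2 * eta)
      by (replace (l - b - (1 - b * l)) with (- ((1 - l) * (1 + b))) by ring; rewrite Rabs_Ropp, Rabs_pos_eq;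
          [apply Rle_trans with (eta * 2); [apply Rmult_le_compat; lra|lra]|apply Rmult_le_pos; lra]).
    pose proof (Cnorm_ge0 (Csub (phi h) C1)).
    apply Rmult_le_reg_r with (1 - b); [lra|].
    replace (2 * eta / (1 - b) * (1 - b)) with (2 * eta) by (field; lra).
    assert (b * l <= b * 1) by (apply Rmult_le_compat_l; lra).
    apply Rle_trans with (Cnorm (Csub (phi h) C1) * (1 - b * l)); [apply Rmult_le_compat_l; lra|lra]. }
  assert (A2 : Cnorm (Csub (psi h) (RtoC (- b))) <= 2 * eta / (1 - b)).
  { pose proof (Hchi psi Hpsi) as E.
    assert (E1 : Cmul (Csub (psi h) (RtoC (- b))) (Csub C1 (Cmul (RtoC b) (psi s))) = Cmul (RtoC (1 - b * b)) (psi s)).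
    { transitivity (Cadd (Cmul (psi h) (Csub C1 (Cmul (RtoC b) (psi s)))) (Cmul (RtoC b) (Csub C1 (Cmul (RtoC b) (psi s))))); [ceq|].
      rewrite E; ceq. }
    apply (f_equal Cnorm) in E1; rewrite !Cnorm_mul, (Cnorm_RtoC_pos (1 - b * b)) in E1 by nra.
    assert (Dn : 1 - b <= Cnorm (Csub C1 (Cmul (RtoC b) (psi s)))).
    { pose proof (Cnorm_le_sub C1 (Cmul (RtoC b) (psi s))) as T; rewrite Cnorm_1, Cnorm_mul, Cnorm_RtoC_pos in T by lra.
      pose proof (Cnorm_ge0 (psi s)). nra. }
    pose proof (Cnorm_ge0 (Csub (psi h) (RtoC (- b)))); pose proof (Cnorm_ge0 (psi s)).
    apply Rmult_le_reg_r with (1 - b); [lra|].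
    replace (2 * eta / (1 - b) * (1 - b)) with (2 * eta) by (field; lra).
    apply Rle_trans with (Cnorm (Csub (psi h) (RtoC (- b))) * Cnorm (Csub C1 (Cmul (RtoC b) (psi s))));
      [apply Rmult_le_compat_l; lra|]. rewrite E1. assert (0 <= b * b) by nra. nra. }
  assert (A3 : 2 * eta / (1 - b) = (1 + b - r) / 4) by (unfold eta; field; lra).
  assert (A4 : Cnorm (Csub C1 (RtoC (- b))) = 1 + b).
  { replace (Csub C1 (RtoC (- b))) with (RtoC (1 + b)) by ceq. apply Cnorm_RtoC_pos; lra. }
  pose proof (Cnorm_triang_sub C1 (phi h) (RtoC (- b))) as T1.
  pose proof (Cnorm_triang_sub (phi h) (psi h) (RtoC (- b))) as T2.
  rewrite (Cnorm_sub_sym C1 (phi h)) in T1. lra.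
Qed.

Lemma dense_squares_derivation Y phi psi : bounded3 Y -> dense_squares Y ->
  character Y phi -> point_derivation Y phi psi -> bounded_functional Y psi ->
  forall f, PX Y f -> psi f = C0.
Proof.
  intros HB HD Hphi [HL Hder] [K HK] f Hf.
  pose proof Hphi as [HLp [Hm H1]].
  pose proof HL as [HLa HLs].
  (* Apply the Leibniz rule to [1 = 1 * 1]. *)
  assert (P1 : psi (fone Y) = C0).
  { assert (E : fmul (fone Y) (fone Y) = fone Y) by (apply functional_extensionality; intros; unfold fmul, fone; ring).
    pose proof (Hder _ _ (PX_fone Y) (PX_fone Y)) as H; rewrite E, H1 in H.
    assert (F : psi (fone Y) = Cadd (psi (fone Y)) (psi (fone Y))) by (rewrite H at 1; ring).
    transitivity (Csub (Cadd (psi (fone Y)) (psi (fone Y))) (psi (fone Y))); [ring|rewrite <- F; ring]. }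
  set (f1 := fsub f (fscal (phi f) (fone Y))).
  assert (Hc : PX Y (fscal (phi f) (fone Y))) by (apply PX_scal; auto; apply PX_fone).
  assert (Hf1 : PX Y f1) by (apply PX_fsub; auto).
  assert (E1 : psi f1 = psi f).
  { unfold f1; rewrite (linear_fsub Y psi), HLs, P1; auto; [ring|apply PX_fone]. }
  assert (E2 : phi f1 = C0).
  { unfold f1; destruct HLp as [HLp1 HLp2]; rewrite (linear_fsub Y phi), HLp2, H1; auto; [ring|apply PX_fone|split; auto]. }
  destruct (PX_bounded Y f1 HB Hf1) as [A [HA HAb]].
  assert (HK0 : 0 <= K).
  { pose proof (HK f1 A Hf1 HAb) as H; pose proof (Cnorm_ge0 (psi f1)); nra. }
  apply NNPP; intros Hne; rewrite <- E1 in Hne.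
  pose proof (Cnorm_pos _ Hne) as Hp.
  (* With [s s] within [d * d] of [f1] one has [|phi s| <= d] and [|s| <= A + 2], so [|psi f1| <= K
     * d^2 + 2 * d * K * (A + 2) <= d * Q]; [d] makes this at most half of [|psi f1|]. *)
  set (Q := K + 2 * (K * (A + 2)) + 1).
  assert (HQ : 1 <= Q) by (unfold Q; assert (0 <= K * (A + 2)) by (apply Rmult_le_pos; lra); lra).
  set (d := Rmin 1 (Cnorm (psi f1) / (2 * Q))).
  assert (Hd : 0 < d <= 1) by (split; [apply Rmin_pos; [lra|apply Rdiv_lt_0_compat; lra]|apply Rmin_l]).
  assert (Hd2 : d * Q <= Cnorm (psi f1) / 2).
  { apply Rle_trans with (Cnorm (psi f1) / (2 * Q) * Q); [|right; field; lra].
    apply Rmult_le_compat_r; [lra|apply Rmin_r]. }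
  destruct (dense_squares_fun Y f1 (d * d) HD Hf1) as [s [t [Hs [_ [_ Hss]]]]]; [nra|].
  assert (Hs2 : PX Y (fmul s s)) by (apply PX_mul; auto).
  assert (Hdf : PX Y (fsub f1 (fmul s s))) by (apply PX_fsub; auto).
  assert (B1 : Cnorm (psi (fsub f1 (fmul s s))) <= K * (d * d)).
  { apply HK; auto; intros x; apply Rlt_le, Hss. }
  assert (B2 : Cnorm (phi s) <= d).
  { assert (H : Cnorm (phi (fsub f1 (fmul s s))) <= d * d).
    { apply (character_bound Y); auto; [nra|intros x; apply Rlt_le, Hss]. }
    rewrite (linear_fsub Y phi), Hm, E2 in H by auto.
    replace (Csub C0 (Cmul (phi s) (phi s))) with (Copp (Cmul (phi s) (phi s))) in H by ring.
    rewrite Cnorm_opp, Cnorm_mul in H; pose proof (Cnorm_ge0 (phi s)); nra. }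
  assert (B3 : Cnorm (psi s) <= K * (A + 2)).
  { apply HK; auto; intros x.
    pose proof (Cnorm_le_sub (Cmul (s x) (s x)) (f1 x)) as T; rewrite Cnorm_sub_sym, Cnorm_mul in T.
    specialize (Hss x); specialize (HAb x); pose proof (Cnorm_ge0 (s x)).
    assert (d * d <= 1) by nra. nra. }
  assert (E3 : psi f1 = Cadd (psi (fsub f1 (fmul s s))) (Cadd (Cmul (psi s) (phi s)) (Cmul (phi s) (psi s)))).
  { rewrite <- Hder, (linear_fsub Y psi) by auto; ring. }
  assert (T : Cnorm (psi f1) <= K * (d * d) + 2 * (d * (K * (A + 2)))).
  { rewrite E3. eapply Rle_trans; [apply Cnorm_triang|].
    pose proof (Cnorm_triang (Cmul (psi s) (phi s)) (Cmul (phi s) (psi s))) as T; rewrite !Cnorm_mul in T.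
    assert (Cnorm (phi s) * Cnorm (psi s) <= d * (K * (A + 2))) by (apply Rmult_le_compat; auto using Cnorm_ge0). lra. }
  assert (K * (d * d) + 2 * (d * (K * (A + 2))) <= d * Q).
  { unfold Q. assert (K * (d * d) <= K * d) by (apply Rmult_le_compat_l; nra). nra. }
  lra.
Qed.

(** * Extracting a Cantor set *)

Lemma dist4_coord (x y : C4) i : Cnorm (Csub (x i) (y i)) <= dist4 x y.
Proof.
  unfold dist4.
  pose proof (Rle_0_sqr (Cnorm (Csub (x i1) (y i1)))); pose proof (Rle_0_sqr (Cnorm (Csub (x i2) (y i2))));
  pose proof (Rle_0_sqr (Cnorm (Csub (x i3) (y i3)))); pose proof (Rle_0_sqr (Cnorm (Csub (x i4) (y i4)))).
  rewrite <- (sqrt_Rsqr (Cnorm (Csub (x i) (y i)))) by apply Cnorm_ge0.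
  apply sqrt_le_1_alt; destruct i; lra.
Qed.

Lemma dist4_le (x y : C4) e : 0 <= e -> (forall i, Cnorm (Csub (x i) (y i)) <= e) -> dist4 x y <= 2 * e.
Proof.
  intros He H; unfold dist4.
  rewrite <- (sqrt_Rsqr (2 * e)) by lra; apply sqrt_le_1_alt.
  assert (K : forall i, Rsqr (Cnorm (Csub (x i) (y i))) <= Rsqr e).
  { intros i; apply Rsqr_incr_1; auto using Cnorm_ge0. }
  pose proof (K i1); pose proof (K i2); pose proof (K i3); pose proof (K i4); unfold Rsqr in *; lra.
Qed.

Lemma cv4_dist4 Xs x : cv4 Xs x -> forall eps, 0 < eps -> exists N, forall n, (N <= n)%nat -> dist4 x (Xs n) < eps.
Proof.
  intros H eps He.
  destruct (H i1 (eps/3)) as [N1 K1]; [lra|]; destruct (H i2 (eps/3)) as [N2 K2]; [lra|];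
  destruct (H i3 (eps/3)) as [N3 K3]; [lra|]; destruct (H i4 (eps/3)) as [N4 K4]; [lra|].
  exists (N1 + N2 + N3 + N4)%nat; intros n Hn.
  apply Rle_lt_trans with (2 * (eps/3)); [|lra].
  apply dist4_le; [lra|]; intros i; rewrite Cnorm_sub_sym; apply Rlt_le.
  destruct i; [apply K1|apply K2|apply K3|apply K4]; lia.
Qed.

Definition compact4 (X : C4 -> Prop) : Prop := forall Xs : nat -> C4, (forall n, X (Xs n)) ->
  exists s x, (forall n, (n <= s n)%nat) /\ X x /\ cv4 (fun n => Xs (s n)) x.

(** Sequential form of: [d] is the indicator of a relatively clopen subset of [X]. *)
Definition cont_digit (X : C4 -> Prop) (d : C4 -> bool) : Prop :=
  forall Xs x, (forall n, X (Xs n)) -> X x -> cv4 Xs x -> exists N, forall n, (N <= n)%nat -> d (Xs n) = d x.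

Lemma cont_digits_upto X (d : nat -> C4 -> bool) : (forall k, cont_digit X (d k)) ->
  forall Xs x, (forall n, X (Xs n)) -> X x -> cv4 Xs x ->
  forall m, exists N, forall n, (N <= n)%nat -> forall k, (k < m)%nat -> d k (Xs n) = d k x.
Proof.
  intros Hd Xs x HX Hx Hcv; induction m.
  - exists O; intros; lia.
  - destruct IHm as [N1 K1]; destruct (Hd m Xs x HX Hx Hcv) as [N2 K2].
    exists (N1 + N2)%nat; intros n Hn k Hk.
    destruct (Nat.eq_dec k m) as [->|]; [apply K2; lia|apply K1; lia].
Qed.

(** Finite digit patterns are the binary digits of naturals, so the cylinders can be enumerated by
    pairs of a length and a code. *)
Lemma testbit_prescribe (b : nat -> bool) m : exists c, forall k, (k < m)%nat -> Nat.testbit c k = b k.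
Proof.
  revert b; induction m; intros b; [exists O; intros; lia|].
  destruct (IHm (fun k => b (S k))) as [c Hc].
  exists (2 * c + Nat.b2n (b O))%nat; intros [|k] Hk.
  - apply Nat.testbit_0_r.
  - rewrite Nat.testbit_succ_r; apply Hc; lia.
Qed.

Lemma poly_hull_mono (X Y : C4 -> Prop) z : (forall x, X x -> Y x) -> poly_hull X z -> poly_hull Y z.
Proof. intros H HX p M HM; apply HX; auto. Qed.

Fixpoint ppow (p : poly4) (m : nat) : poly4 :=
  match m with O => PConst C1 | S m => PMul p (ppow p m) end.

Lemma Cnorm_ppow p m x : Cnorm (peval (ppow p m) x) = Cnorm (peval p x) ^ m.
Proof. induction m; simpl; [apply Cnorm_1|rewrite Cnorm_mul, IHm; auto]. Qed.

(* Multiply a high power of p by an affine function vanishing at the removed point. *)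
Lemma poly_hull_remove (Y : C4 -> Prop) z x : bounded3 Y -> z <> x ->
  poly_hull Y z -> poly_hull (fun y => Y y /\ y <> x) z.
Proof.
  intros HB Hzx HY p M HM.
  assert (Hi : exists i, z i <> x i).
  { apply NNPP; intros Hn; apply Hzx, functional_extensionality; intros i.
    apply NNPP; intros Hi; apply Hn; eauto. }
  destruct Hi as [i Hi].
  set (l := PAdd (PVar i) (PConst (Copp (x i)))).
  assert (Hl : 0 < Cnorm (peval l z)).
  { apply Cnorm_pos; simpl; intros E; apply Hi.
    replace (z i) with (Cadd (Cadd (z i) (Copp (x i))) (x i)) by ring; rewrite E; ring. }
  assert (Hlx : peval l x = C0) by (simpl; ring).
  destruct (classic (exists y, Y y /\ y <> x)) as [[y0 Hy0]|Hemp].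
  - assert (HM0 : 0 <= M) by (eapply Rle_trans; [apply Cnorm_ge0|apply (HM y0 Hy0)]).
    apply Rnot_lt_le; intros Hlt.
    set (a := Cnorm (peval p z)) in *.
    set (B := pbound l + 1).
    assert (HB0 : 1 <= B) by (unfold B; pose proof (pbound_ge0 l); lra).
    assert (Hm : forall m, a ^ m * Cnorm (peval l z) <= M ^ m * B).
    { intros m.
      assert (Hh := HY (PMul (ppow p m) l) (M ^ m * B)); cbn [peval] in Hh.
      rewrite Cnorm_mul, Cnorm_ppow in Hh; apply Hh; clear Hh.
      intros y Hy; rewrite Cnorm_mul, Cnorm_ppow.
      destruct (classic (y = x)) as [->|Hyx].
      - rewrite Hlx, Cnorm_0, Rmult_0_r; apply Rmult_le_pos; [apply pow_le; auto|lra].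
      - apply Rmult_le_compat; auto using Cnorm_ge0.
        + apply pow_le, Cnorm_ge0.
        + apply pow_incr; split; [apply Cnorm_ge0|apply HM; auto].
        + pose proof (peval_bound l y (HB y Hy)); unfold B; lra. }
    assert (Ha : 0 < a) by lra.
    assert (Hr : Rabs (M / a) < 1).
    { rewrite Rabs_pos_eq by (apply Rmult_le_pos; [lra|apply Rlt_le, Rinv_0_lt_compat; lra]).
      apply Rmult_lt_reg_r with a; auto; unfold Rdiv; rewrite Rmult_assoc, Rinv_l; lra. }
    destruct (pow_lt_1_zero (M / a) Hr (Cnorm (peval l z) / B)) as [N K].
    { apply Rdiv_lt_0_compat; lra. }
    specialize (K N (le_n _)); specialize (Hm N).
    apply Rle_lt_trans with (r1 := (M / a) ^ N) in K; [|apply Rle_abs].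
    unfold Rdiv in K; rewrite Rpow_mult_distr, pow_inv in K.
    assert (Han : 0 < a ^ N) by (apply pow_lt; auto).
    apply (Rmult_lt_compat_r (a ^ N * B)) in K; [|apply Rmult_lt_0_compat; lra].
    replace (M ^ N * / a ^ N * (a ^ N * B)) with (M ^ N * B) in K by (field; lra).
    replace (Cnorm (peval l z) * / B * (a ^ N * B)) with (a ^ N * Cnorm (peval l z)) in K by (field; lra).
    lra.
  - exfalso. assert (Cnorm (peval l z) <= 0); [|lra].
    apply HY; intros y Hy; destruct (classic (y = x)) as [->|Hyx].
    + rewrite Hlx, Cnorm_0; lra.
    + exfalso; apply Hemp; eauto.
Qed.

(* A closed subset minimal among those obtained by discarding cylinders while keeping z in the hull
   has no isolated point. *)
Lemma perfect_hull_subset (X : C4 -> Prop) (d : nat -> C4 -> bool) z :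
  bounded3 X -> compact4 X -> (forall k, cont_digit X (d k)) -> poly_hull X z -> ~ X z ->
  exists Y, (forall x, Y x -> X x) /\ compact4 Y /\ poly_hull Y z /\
    forall x m, Y x -> exists y, Y y /\ y <> x /\ forall k, (k < m)%nat -> d k y = d k x.
Proof.
  intros HB HC Hd Hz HzX.
  set (cyl := fun (n : nat) (x : C4) => forall k, (k < fst (of_nat n))%nat -> d k x = Nat.testbit (snd (of_nat n)) k).
  (* Greedy: cylinder [n] is discarded exactly if [z] stays in the hull of the rest. *)
  set (Yn := fix Yn (n : nat) : C4 -> Prop :=
    match n with
    | O => X
    | S n => fun x => Yn n x /\ (poly_hull (fun y => Yn n y /\ ~ cyl n y) z -> ~ cyl n x)
    end).
  assert (Ydec : forall q n x, Yn (q + n)%nat x -> Yn n x).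
  { induction q; intros n x H; auto; apply IHq, H. }
  assert (YX : forall n x, Yn n x -> X x).
  { intros n x H; apply (Ydec n 0%nat); rewrite Nat.add_0_r; auto. }
  assert (Ycl : forall n Xs x, (forall k, Yn n (Xs k)) -> X x -> cv4 Xs x -> Yn n x).
  { induction n; intros Xs x HXs Hx Hcv; auto.
    split; [apply (IHn Xs); auto; intros; apply HXs|].
    intros Hh Hc.
    destruct (cont_digits_upto X d Hd Xs x) with (m := fst (of_nat n)) as [N K]; auto.
    { intros k; apply (YX (S n)), HXs. }
    destruct (HXs N) as [_ Hn]; apply (Hn Hh); intros k Hk; rewrite K by auto; apply Hc; auto. }
  assert (Yh : forall n, poly_hull (Yn n) z).
  { induction n; auto.
    destruct (classic (poly_hull (fun y => Yn n y /\ ~ cyl n y) z)) as [Hh|Hh].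
    - apply (poly_hull_mono (fun y => Yn n y /\ ~ cyl n y)); auto; intros x [H1 H2]; split; auto.
    - apply (poly_hull_mono (Yn n)); auto; intros x H; split; auto; tauto. }
  set (Y := fun x => forall n, Yn n x).
  (* Diagonal compactness for the decreasing sets [Yn]; it yields both the hull property and the
     compactness of the intersection. *)
  assert (Yc : forall Xs : nat -> C4, (forall n, Yn n (Xs n)) -> exists s x,
     (forall n, (n <= s n)%nat) /\ Y x /\ cv4 (fun n => Xs (s n)) x).
  { intros Xs HXs; destruct (HC Xs) as [s [x [Hs [Hx Hcv]]]].
    { intros n; apply (YX n), HXs. }
    exists s, x; split; [auto|split; auto].
    intros n; apply (Ycl n (fun k => Xs (s (k + n)%nat))); auto.
    - intros k; specialize (Hs (k + n)%nat).
      apply (Ydec (s (k + n) - n)%nat n). replace (s (k + n) - n + n)%nat with (s (k + n)%nat) by lia; apply HXs.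
    - intros i; apply (Ccv_sub (fun k => Xs (s k) i) (x i) (fun k => (k + n)%nat)); [intros; lia|apply Hcv]. }
  assert (HYz : poly_hull Y z).
  { intros p M HM; apply Rnot_lt_le; intros Hlt.
    set (M' := (M + Cnorm (peval p z)) / 2).
    assert (Sx : forall n, exists x, Yn n x /\ M' < Cnorm (peval p x)).
    { intros n'; apply NNPP; intros Hn'.
      assert (Cnorm (peval p z) <= M'); [|unfold M' in *; lra].
      apply (Yh n'); intros x' Hx'; apply Rnot_lt_le; intros H; apply Hn'; eauto. }
    destruct (choice _ Sx) as [Xs HXs].
    destruct (Yc Xs) as [s [x' [Hs [Hx' Hcv]]]]; [apply HXs|].
    specialize (HM x' Hx').
    destruct (Ccv_Cnorm_lt _ _ M' (peval_cv4 p _ _ Hcv)) as [N K]; [unfold M'; lra|].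
    specialize (K N (le_n _)); destruct (HXs (s N)) as [_ H]; lra. }
  exists Y; split; [|split; [|split]].
  - intros x Hx; apply (YX 0%nat), Hx.
  - intros Xs HXs; apply Yc; intros n; apply HXs.
  - exact HYz.
  (* If [x] were alone in its cylinder of length [m], then [z] would be in the hull of [Y] without
     [x], hence of [Yn n] without that cylinder, and the greedy step at its number [n] would have
     discarded [x]. *)
  - intros x m Hx; apply NNPP; intros Hn.
    destruct (testbit_prescribe (fun k => d k x) m) as [c Hc].
    set (n := to_nat (m, c)).
    assert (Ecyl : forall y, cyl n y <-> forall k, (k < m)%nat -> d k y = d k x).
    { intros y; unfold cyl, n; rewrite cancel_of_to; cbn [fst snd]; split; intros H k Hk.
      - rewrite H, Hc; auto.
      - rewrite H, Hc; auto. }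
    destruct (Hx (S n)) as [_ Hr].
    apply Hr; [|apply Ecyl; auto].
    apply (poly_hull_mono (fun y => Y y /\ y <> x)).
    + intros y [Hy1 Hy2]; split; [apply Hy1|].
      rewrite Ecyl; intros H; apply Hn; eauto.
    + apply poly_hull_remove; auto.
      * intros y Hy; apply HB, (YX 0%nat), Hy.
      * intros ->; apply HzX, (YX 0%nat), Hx.
Qed.

Lemma least_nat (P : nat -> Prop) : (exists n, P n) -> exists n, P n /\ forall k, (k < n)%nat -> ~ P k.
Proof.
  intros [n Hn]; induction n as [n IH] using (well_founded_induction Wf_nat.lt_wf).
  destruct (classic (exists k, (k < n)%nat /\ P k)) as [[k [Hk HP]]|H].
  - apply (IH k); auto.
  - exists n; split; auto; intros k Hk HP; apply H; eauto.
Qed.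

(** The digit sequences of points of [Y] form the branches of a tree in which every node splits
    further down. The parametrization skips the forced digits and lets [s] decide at the splitting
    positions. *)
Lemma perfect_is_Cantor (Y : C4 -> Prop) (d : nat -> C4 -> bool) :
  compact4 Y -> (forall k, cont_digit Y (d k)) ->
  (forall x y, Y x -> Y y -> (forall k, d k x = d k y) -> x = y) ->
  (exists x, Y x) ->
  (forall x m, Y x -> exists y, Y y /\ y <> x /\ forall k, (k < m)%nat -> d k y = d k x) ->
  is_Cantor_set Y.
Proof.
  intros HC Hd Hsep [xs Hxs] Hperf.
  set (agr := fun m x y => forall k, (k < m)%nat -> d k y = d k x).
  (* [fst q] is the first position from [m] on at which the cylinder of [x] splits, [snd q] gives a
     point for either digit there. The last clause, that the digits before it are forced, is what
     makes the parametrization surjective. Outside [Y] the value is arbitrary. *)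
  assert (St : forall xm : C4 * nat, exists q : nat * (bool -> C4), Y (fst xm) ->
     (snd xm <= fst q)%nat /\ (forall b, Y (snd q b) /\ agr (fst q) (fst xm) (snd q b) /\ d (fst q) (snd q b) = b) /\
     forall y, Y y -> agr (snd xm) (fst xm) y -> agr (fst q) (fst xm) y).
  { intros [x m]; simpl; destruct (classic (Y x)) as [Hx|Hx]; [|exists (O, fun _ => x); tauto].
    destruct (least_nat (fun K => exists y, Y y /\ agr m x y /\ d K y <> d K x)) as [K [[y [Hy [Ha HK]]] Hleast]].
    { destruct (Hperf x m Hx) as [y [Hy [Hne Ha]]].
      apply NNPP; intros Hn; apply Hne, Hsep; auto; intros k; apply NNPP; intros Hk; apply Hn.
      exists k, y; auto. }
    assert (Hall : forall y', Y y' -> agr m x y' -> agr K x y').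
    { intros y' Hy' Ha' k Hk; apply NNPP; intros Hne; apply (Hleast k Hk); exists y'; auto. }
    assert (HmK : (m <= K)%nat).
    { destruct (Nat.le_gt_cases m K); auto; exfalso; apply HK, Ha; auto. }
    exists (K, fun b => if Bool.eqb (d K x) b then x else y); simpl; intros _; split; auto; split; auto.
    intros b; destruct (Bool.eqb (d K x) b) eqn:E.
    - apply Bool.eqb_prop in E; repeat split; auto; intros k Hk; reflexivity.
    - apply Bool.eqb_false_iff in E; repeat split; auto.
      destruct (d K y), (d K x), b; congruence. }
  destruct (choice _ St) as [F HF].
  set (next := fun (xm : C4 * nat) (b : bool) => (snd (F xm) b, S (fst (F xm)))).
  set (node := fix node (s : nat -> bool) (n : nat) : C4 * nat :=
     match n with O => (xs, O) | S n => next (node s n) (s n) end).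
  assert (Hnode : forall s n, Y (fst (node s n))).
  { intros s; induction n; auto; simpl; apply (HF (node s n) IHn). }
  assert (Hm : forall s n, (snd (node s n) < snd (node s (S n)))%nat).
  { intros s n; simpl; destruct (HF (node s n) (Hnode s n)) as [H _]; lia. }
  assert (Hmn : forall s n, (n <= snd (node s n))%nat).
  { intros s; induction n; [simpl; lia|]; specialize (Hm s n); lia. }
  assert (Hmono : forall s (q n : nat), (snd (node s n) <= snd (node s (q + n)))%nat).
  { intros s; induction q; intros n; auto; specialize (IHq n); specialize (Hm s (q + n)%nat); change (S q + n)%nat with (S (q + n)); lia. }
  assert (Hstep : forall s n, agr (snd (node s n)) (fst (node s n)) (fst (node s (S n)))).
  { intros s n k Hk; simpl; destruct (HF (node s n) (Hnode s n)) as [H1 [H2 _]].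
    destruct (H2 (s n)) as [_ [H3 _]]; apply H3; lia. }
  assert (Hchain : forall s (q n : nat), agr (snd (node s n)) (fst (node s n)) (fst (node s (q + n)%nat))).
  { intros s; induction q; intros n k Hk; auto.
    change (S q + n)%nat with (S (q + n)).
    rewrite (Hstep s (q + n)%nat); [apply IHq; auto|specialize (Hmono s q n); lia]. }
  assert (Hdig : forall s n, d (fst (F (node s n))) (fst (node s (S n))) = s n).
  { intros s n; simpl; destruct (HF (node s n) (Hnode s n)) as [_ [H2 _]]; apply H2. }
  assert (Hh : forall s, exists y, Y y /\ forall n, agr (snd (node s n)) (fst (node s n)) y).
  { intros s; destruct (HC (fun n => fst (node s n))) as [r [y [Hr [Hy Hcv]]]]; [apply Hnode|].
    exists y; split; auto; intros n.
    destruct (cont_digits_upto Y d Hd (fun j => fst (node s (r j))) y) with (m := snd (node s n)) as [N K]; auto.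
    intros k Hk; rewrite <- (K (N + n)%nat ltac:(lia) k Hk).
    specialize (Hr (N + n)%nat). replace (r (N + n)%nat) with (r (N + n) - n + n)%nat by lia.
    apply Hchain; auto. }
  destruct (choice _ Hh) as [h Hhs].
  assert (Huniq : forall s y, Y y -> (forall n, agr (snd (node s n)) (fst (node s n)) y) -> y = h s).
  { intros s y Hy Ha; apply Hsep; auto; [apply Hhs|].
    intros k; rewrite (Ha (S k) k), (proj2 (Hhs s) (S k) k); auto; specialize (Hmn s (S k)); lia. }
  assert (Hlocal : forall n s t, agree_upto n s t -> node s n = node t n).
  { induction n; intros s t H; auto; simpl; rewrite (IHn s t), (H n); auto.
    intros k Hk; apply H; lia. }
  assert (Hdh : forall s n, d (fst (F (node s n))) (h s) = s n).
  { intros s n; rewrite (proj2 (Hhs s) (S n)); [apply Hdig|simpl; lia]. }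
  (* The [n]-th splitting position depends only on the first [n] bits, so the bits can be recovered
     from the digits of [h s] one after another. *)
  assert (Hrec : forall s t n, agr (snd (node s n)) (h s) (h t) -> agree_upto n s t).
  { intros s t; induction n; intros H k Hk; [lia|].
    assert (Hn : agree_upto n s t).
    { apply IHn; intros j Hj; apply H; specialize (Hm s n); lia. }
    destruct (Nat.eq_dec k n) as [->|]; [|apply Hn; lia].
    rewrite <- (Hdh s n), <- (Hdh t n), <- (Hlocal n s t Hn); symmetry; apply H; simpl; lia. }
  exists h; split; [|split; [|split]].
  - intros s t E; apply functional_extensionality; intros n.
    apply (Hrec s t (S n)); [|lia]; rewrite E; intros k Hk; reflexivity.
  - intros y; split; [intros Hy|intros [s <-]; apply Hhs].
    (* The preimage of [y] reads off the digits of [y] at the splitting positions, which themselves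
       depend on the digits already read. *)
    set (path := fix path (n : nat) : C4 * nat :=
      match n with O => (xs, O) | S n => next (path n) (d (fst (F (path n))) y) end).
    set (s := fun n => d (fst (F (path n))) y).
    assert (Ep : forall n, node s n = path n).
    { induction n; auto; simpl; rewrite IHn; reflexivity. }
    exists s; symmetry; apply Huniq; auto.
    induction n; [intros k Hk; simpl in Hk; lia|].
    destruct (HF (node s n) (Hnode s n)) as [H1 [H2 H3]].
    pose proof (H3 y Hy IHn) as Ha.
    intros k Hk; simpl in Hk |- *.
    destruct (H2 (s n)) as [_ [H4 H5]].
    destruct (Nat.eq_dec k (fst (F (node s n)))) as [->|Hne].
    + rewrite H5; unfold s; rewrite <- Ep; reflexivity.
    + rewrite (Ha k), (H4 k) by lia; reflexivity.
  - intros s eps He; apply NNPP; intros Hn.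
    assert (S1 : forall n, exists t, agree_upto n s t /\ eps <= dist4 (h s) (h t)).
    { intros n; apply NNPP; intros Hk; apply Hn; exists n; intros t Ht.
      apply Rnot_le_lt; intros Hl; apply Hk; eauto. }
    destruct (choice _ S1) as [t Ht].
    destruct (HC (fun n => h (t n))) as [r [y [Hr [Hy Hcv]]]]; [intros; apply Hhs|].
    assert (Ey : y = h s).
    { apply Huniq; auto; intros n.
      destruct (cont_digits_upto Y d Hd (fun j => h (t (r j))) y) with (m := snd (node s n)) as [N K]; auto.
      { intros; apply Hhs. }
      intros k Hk; rewrite <- (K (N + n)%nat ltac:(lia) k Hk).
      destruct (Ht (r (N + n)%nat)) as [Ht1 _].
      assert (E : node s n = node (t (r (N + n)%nat)) n).
      { apply Hlocal; intros j Hj; apply Ht1; specialize (Hr (N + n)%nat); lia. }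
      rewrite E in Hk |- *; apply (proj2 (Hhs _)); auto. }
    rewrite Ey in Hcv; destruct (cv4_dist4 _ _ Hcv eps He) as [N K].
    specialize (K N (le_n _)); destruct (Ht (r N)) as [_ H]; lra.
  - intros s n; apply NNPP; intros Hn.
    assert (S1 : forall j : nat, exists t, dist4 (h s) (h t) < / (INR j + 1) /\ ~ agree_upto n s t).
    { intros j; apply NNPP; intros Hk; apply Hn; exists (/ (INR j + 1)); split.
      - apply Rinv_0_lt_compat; pose proof (pos_INR j); lra.
      - intros t Ht; apply NNPP; intros Ha; apply Hk; eauto. }
    destruct (choice _ S1) as [t Ht].
    assert (Hcv : cv4 (fun j => h (t j)) (h s)).
    { intros i eps He; destruct (archimed_cor1 eps He) as [N [HN1 HN2]]; exists N; intros j Hj.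
      rewrite Cnorm_sub_sym; eapply Rle_lt_trans; [apply dist4_coord|].
      eapply Rlt_trans; [apply Ht|]; apply Rle_lt_trans with (2 := HN1).
      apply Rinv_le_contravar; [apply lt_0_INR; lia|]; apply le_INR in Hj; lra. }
    destruct (cont_digits_upto Y d Hd (fun j => h (t j)) (h s)) with (m := snd (node s n)) as [N K];
      [intros; apply Hhs|apply Hhs|exact Hcv|].
    destruct (Ht N) as [_ H]; apply H, Hrec; intros k Hk; apply K; auto.
Qed.

(** * Clopen sets separating the points of X *)

Definition seq_cont (X : C4 -> Prop) (f : C4 -> R) : Prop :=
  forall Xs x, (forall n, X (Xs n)) -> X x -> cv4 Xs x -> Un_cv (fun n => f (Xs n)) (f x).

Definition decide (P : Prop) : bool := if excluded_middle_informative P then true else false.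

Lemma decide_iff P : decide P = true <-> P.
Proof. unfold decide; destruct (excluded_middle_informative P); split; auto; discriminate. Qed.

Lemma decide_ext (P Q : Prop) : (P <-> Q) -> decide P = decide Q.
Proof. intros H; f_equal; apply propositional_extensionality; auto. Qed.

Lemma seq_cont_cut X f a r x Xs : seq_cont X f -> 0 < r ->
  (forall n, X (Xs n)) -> X x -> cv4 Xs x -> r <= Rabs (f x - a) ->
  exists N, forall n, (N <= n)%nat -> (f (Xs n) < a <-> f x < a).
Proof.
  intros Hf Hr HXs Hx Hcv Hx1; destruct (Hf Xs x HXs Hx Hcv r Hr) as [N K].
  exists N; intros n Hn; specialize (K n Hn); unfold Rdist in K; apply Rabs_def2 in K.
  unfold Rabs in Hx1; destruct (Rcase_abs (f x - a)); split; intros; lra.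
Qed.

Lemma rdec_avoid (L : list R) : forall r1 r2, r1 < r2 -> exists n, r1 < rdec n < r2 /\ ~ In (rdec n) L.
Proof.
  induction L as [|l L IH]; intros r1 r2 Hr.
  - destruct (rdec_between r1 r2 Hr) as [n Hn]; exists n; split; auto.
  - destruct (Rle_dec l r1) as [H1|H1]; [|destruct (Rle_dec r2 l) as [H2|H2]].
    + destruct (IH r1 r2 Hr) as [n [Hn Hi]]; exists n; split; auto; intros [E|E]; auto; lra.
    + destruct (IH r1 r2 Hr) as [n [Hn Hi]]; exists n; split; auto; intros [E|E]; auto; lra.
    + destruct (IH r1 l ltac:(lra)) as [n [Hn Hi]]; exists n; split; [lra|]; intros [E|E]; auto; lra.
Qed.

(* On a cylinder of the S-digits where f i stays away from a, the set where f i < a is clopen; finiteness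
   of f i over each intersection of cylinders provides enough such levels a. *)
Lemma separating_digits (X : C4 -> Prop) (S : nat -> C4 -> bool) (f : nat -> C4 -> R) :
  compact4 X -> (forall w, cont_digit X (S w)) -> (forall i, seq_cont X (f i)) ->
  (forall x y, X x -> X y -> (forall w, S w x = S w y) -> x <> y -> exists i L, f i x <> f i y /\
     forall eta, X eta -> (forall w, S w eta = S w x) -> In (f i eta) L) ->
  exists d : nat -> C4 -> bool, (forall k, cont_digit X (d k)) /\
    forall x y, X x -> X y -> (forall k, d k x = d k y) -> x = y.
Proof.
  intros HC HS Hf Hsep.
  (* This property of [x] depends only on its first [m] digits, hence is itself locally constant;
     where it holds, the side of [a] on which [f i] lies is locally constant too. *)
  set (good := fun i m a x => exists r, 0 < r /\
    forall eta, X eta -> (forall w, (w < m)%nat -> S w eta = S w x) -> r <= Rabs (f i eta - a)).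
  set (d := fun n => match of_nat n with
    | (O, w) => S w
    | (Datatypes.S i, k) => fun x => decide (good i (fst (of_nat k)) (rdec (snd (of_nat k))) x /\
                           f i x < rdec (snd (of_nat k))) end).
  assert (dS : forall w, d (to_nat (O, w)) = S w) by (intros; unfold d; rewrite cancel_of_to; auto).
  assert (df : forall i m c, d (to_nat (Datatypes.S i, to_nat (m, c))) =
     fun x => decide (good i m (rdec c) x /\ f i x < rdec c)).
  { intros; unfold d; rewrite cancel_of_to, cancel_of_to; auto. }
  exists d; split.
  - intros k Xs x HXs Hx Hcv; rewrite <- (cancel_to_of k); destruct (of_nat k) as [[|i] e].
    { rewrite dS; apply HS; auto. }
    rewrite <- (cancel_to_of e); destruct (of_nat e) as [m c]; rewrite df.
    destruct (cont_digits_upto X S HS Xs x HXs Hx Hcv m) as [N1 K1].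
    destruct (classic (good i m (rdec c) x)) as [[r [Hr Hg]]|Hg].
    + destruct (seq_cont_cut X (f i) (rdec c) r x Xs) as [N2 K2]; auto.
      exists (N1 + N2)%nat; intros n Hn; apply decide_ext.
      rewrite (K2 n) by lia; split; intros [_ H]; split; auto; exists r; split; auto.
      intros eta He Hs; apply Hg; auto; intros w Hw; rewrite Hs, K1; auto; lia.
    + exists N1; intros n Hn; apply decide_ext; split; intros [H _]; [|tauto].
      exfalso; apply Hg; destruct H as [r [Hr H]]; exists r; split; auto.
      intros eta He Hs; apply H; auto; intros w Hw; rewrite Hs, K1; auto.
  - intros x y Hx Hy Hd; apply NNPP; intros Hne.
    assert (ES : forall w, S w x = S w y) by (intros w; rewrite <- dS; apply Hd).
    destruct (Hsep x y Hx Hy ES Hne) as [i [L [Hi HL]]].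
    assert (Ha : exists c, (f i x < rdec c < f i y \/ f i y < rdec c < f i x) /\ ~ In (rdec c) L).
    { destruct (Rtotal_order (f i x) (f i y)) as [H|[H|H]]; [|tauto|].
      - destruct (rdec_avoid L _ _ H) as [c Hc]; exists c; tauto.
      - destruct (rdec_avoid L _ _ H) as [c Hc]; exists c; tauto. }
    destruct Ha as [c [Hc HcL]].
    (* Otherwise points in ever smaller cylinders have [f i] tending to the level; a limit point
       shares all [S]-digits of [x] and takes the level as value, although the level was chosen
       outside [L]. *)
    assert (Hg : exists m, good i m (rdec c) x).
    { apply NNPP; intros Hn.
      assert (S1 : forall m : nat, exists eta, X eta /\ (forall w, (w < m)%nat -> S w eta = S w x) /\
         Rabs (f i eta - rdec c) < / (INR m + 1)).
      { intros m; apply NNPP; intros Hm; apply Hn; exists m, (/ (INR m + 1)); split.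
        - apply Rinv_0_lt_compat; pose proof (pos_INR m); lra.
        - intros eta He Hs; apply Rnot_lt_le; intros Hl; apply Hm; eauto. }
      destruct (choice _ S1) as [E HE].
      destruct (HC E) as [s [eta [Hs [He Hcv]]]]; [intros; apply HE|].
      apply HcL; replace (rdec c) with (f i eta).
      - apply HL; auto; intros w.
        destruct (HS w (fun n => E (s n)) eta) as [N K]; auto; [intros; apply HE|].
        rewrite <- (K (N + Datatypes.S w)%nat) by lia; apply HE; specialize (Hs (N + Datatypes.S w)%nat); lia.
      - apply (UL_sequence (fun n => f i (E (s n)))).
        + apply (Hf i); auto; intros; apply HE.
        + intros eps Heps; destruct (archimed_cor1 eps Heps) as [N [HN1 HN2]]; exists N; intros n Hn'.
          unfold Rdist; eapply Rlt_trans; [apply HE|]; apply Rle_lt_trans with (2 := HN1).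
          apply Rinv_le_contravar; [apply lt_0_INR; lia|].
          specialize (Hs n); assert (Hle : (N <= s n)%nat) by lia; apply le_INR in Hle; lra. }
    destruct Hg as [m Hg].
    assert (Hgy : good i m (rdec c) y).
    { destruct Hg as [r [Hr H]]; exists r; split; auto; intros eta He Hs; apply H; auto.
      intros w Hw; rewrite Hs, ES; auto. }
    pose proof (Hd (to_nat (Datatypes.S i, to_nat (m, c)))) as E; rewrite df in E.
    assert (Q : f i x < rdec c <-> f i y < rdec c).
    { pose proof (decide_iff (good i m (rdec c) x /\ f i x < rdec c)) as I1.
      pose proof (decide_iff (good i m (rdec c) y /\ f i y < rdec c)) as I2.
      rewrite E in I1; tauto. }
    destruct Hc as [Hc|Hc]; [assert (f i y < rdec c) by (apply Q; lra)|assert (f i x < rdec c) by (apply Q; lra)]; lra.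
Qed.

Definition xpart (xi : C4) (k : nat) : C :=
  match k with O => xi i1 | 1%nat => xi i2 | 2%nat => xi i3 | _ => C0 end.

Lemma xpart_mk4 z w i : (i < 3)%nat -> xpart (mk4 z w) i = z i.
Proof. intros Hi; destruct i as [|[|[|i]]]; auto; lia. Qed.

Lemma Qd_ext c z z' : (forall i, (i < 3)%nat -> z i = z' i) -> Qd c z = Qd c z'.
Proof. intros H; unfold Qd; rewrite !H by lia; reflexivity. Qed.

Lemma xpart_pcv Xs x : cv4 Xs x -> pcv (fun n => xpart (Xs n)) (xpart x).
Proof. intros H [|[|[|k]]]; simpl; auto; apply Ccv_const. Qed.

Definition side (w : nat) (xi : C4) : bool := decide (Qd (wall_center w) (xpart xi) < wall_level w).

Lemma xpart_inK D xi : Xfull D xi -> inK (xpart xi).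
Proof.
  intros [z [v [[[H1 H2] _] [_ ->]]]]; split.
  - intros i Hi; rewrite xpart_mk4; auto.
  - intros n; rewrite (Qd_ext _ _ z); auto; intros; apply xpart_mk4; auto.
Qed.

(** The shell removed around the sphere keeps [Qd] off the level, so the side cannot change in a
    limit. *)
Lemma side_cont D w : cont_digit (Xfull D) (side w).
Proof.
  intros Xs x HXs Hx Hcv.
  destruct (seq_cont_cut (Xfull D) (fun xi => Qd (wall_center w) (xpart xi)) (wall_level w)
    (weps w * weps w / 4) x Xs) as [N K]; auto.
  - intros Ys y _ _ H; apply (Qd_pcv (wall_center w) (fun n => xpart (Ys n)) (xpart y)), xpart_pcv, H.
  - pose proof (weps_bounds w); nra.
  - apply (xpart_inK D x Hx).
  - exists N; intros n Hn; apply decide_ext, K; auto.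
Qed.

(** Between two distinct squared distances to a centre lies a wall level, and these distances
    determine the point of C^3. *)
Lemma side_separates x y : (forall w, side w x = side w y) -> forall i, (i < 3)%nat -> xpart x i = xpart y i.
Proof.
  assert (W : forall u v c, Qd c (xpart u) < Qd c (xpart v) -> exists w, side w u <> side w v).
  { intros u v c H; destruct (wall_exists c (Qd c (xpart u)) (Qd c (xpart v))) as [w [Hw1 Hw2]].
    { split; auto; unfold Qd; apply Rplus_le_le_0_compat; [apply Rplus_le_le_0_compat|]; apply n2_ge0. }
    exists w; intros E.
    pose proof (decide_iff (Qd (wall_center w) (xpart u) < wall_level w)) as I1.
    pose proof (decide_iff (Qd (wall_center w) (xpart v) < wall_level w)) as I2.
    fold (side w u) in I1; fold (side w v) in I2; rewrite E in I1; rewrite Hw1 in *.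
    assert (Qd c (xpart v) < wall_level w) by (apply I2, I1; lra); lra. }
  intros H; apply Qd_injective; intros c.
  destruct (Rtotal_order (Qd c (xpart x)) (Qd c (xpart y))) as [L|[L|L]]; auto;
    destruct (W _ _ _ L) as [w Hw]; exfalso; apply Hw; auto.
Qed.

Lemma inv_sqrt_finite (L : list C) (q : C -> C) : exists M, forall v t, In v L ->
  Cmul (q v) (Cmul t t) = C1 -> In t M.
Proof.
  induction L as [|v L [M HM]]; [exists nil; intros v t []|].
  destruct (classic (exists r, Cmul (q v) (Cmul r r) = C1)) as [[r Hr]|Hr].
  - exists (r :: Copp r :: M); intros v' t [<-|Hv] Ht; [|simpl; right; right; eapply HM; eauto].
    assert (E : Cmul (q v) (Cmul (Csub t r) (Cadd t r)) = C0).
    { transitivity (Csub (Cmul (q v) (Cmul t t)) (Cmul (q v) (Cmul r r))); [ring|rewrite Ht, Hr; ring]. }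
    apply Cmul_eq0 in E; destruct E as [E|E].
    + exfalso; apply C1_neq0; rewrite <- Ht, E; ring.
    + apply Cmul_eq0 in E; destruct E as [E|E]; [left|right; left].
      * replace t with (Cadd (Csub t r) r) by ring; rewrite E; ring.
      * replace t with (Csub (Cadd t r) r) by ring; rewrite E; ring.
  - exists M; intros v' t [<-|Hv] Ht; [exfalso; eauto|eapply HM; eauto].
Qed.

(** Over a fixed [x], each value of [w_j] admits at most two roots [t_j], so the number of values at
    most doubles from stage to stage. It may grow with [j], but every single [t_j] has finite range
    on the fibre. *)
Lemma fibre_finite D x j : exists L M, forall z, solves D z -> (forall i, (i < 3)%nat -> z i = x i) ->
  In (neval (wpoly D j) z) L /\ In (z (3 + j)%nat) M.
Proof.
  assert (Roots : forall j L, exists M, forall z, solves D z -> (forall i, (i < 3)%nat -> z i = x i) ->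
    In (neval (wpoly D j) z) L -> In (z (3 + j)%nat) M).
  { intros k L; destruct (inv_sqrt_finite L (fun v => peval (tp D k) (mk4 x v))) as [M HM].
    exists M; intros z Hz Hx Hin; apply (HM _ _ Hin).
    rewrite <- (mk4_ext z x) by auto; rewrite <- neval_sub4; apply (solves_root D z k Hz). }
  induction j as [|j [L [M H]]].
  - destruct (Roots O (C0 :: nil)) as [M HM]; exists (C0 :: nil), M.
    intros z Hz Hx; assert (In (neval (wpoly D 0) z) (C0 :: nil)) by (left; reflexivity); auto.
  - set (L' := flat_map (fun v => map (fun t => Cadd v (Cmul (RtoC (tc D j)) t)) M) L).
    destruct (Roots (S j) L') as [M' HM']; exists L', M'.
    intros z Hz Hx; destruct (H z Hz Hx) as [H1 H2].
    assert (In (neval (wpoly D (S j)) z) L'); auto.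
    apply in_flat_map; exists (neval (wpoly D j) z); split; auto.
    apply in_map_iff; exists (z (3 + j)%nat); split; auto.
Qed.

Lemma wpoly_ext D z z' : (forall i, (i < 3)%nat -> z i = z' i) -> (forall j, z (3 + j)%nat = z' (3 + j)%nat) ->
  forall j, neval (wpoly D j) z = neval (wpoly D j) z'.
Proof. intros H1 H2; induction j; auto; cbn [wpoly neval]; rewrite IHj, H2; auto. Qed.

(** Total functions on [C4] fit the digit lemmas; the value outside [Y] is never evaluated along
    sequences in [Y]. *)
Definition extend0 {Y : C4 -> Prop} (g : {x | Y x} -> C) (xi : C4) : C :=
  match excluded_middle_informative (Y xi) with left H => g (exist _ xi H) | right _ => C0 end.

Lemma extend0_eq {Y : C4 -> Prop} (g : {x | Y x} -> C) xi : Y xi -> exists H, extend0 g xi = g (exist _ xi H).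
Proof. intros H; unfold extend0; destruct (excluded_middle_informative (Y xi)); [eauto|tauto]. Qed.

Lemma PX_cv (Y : C4 -> Prop) g : PX Y g -> forall Xs x, (forall n, Y (Xs n)) -> Y x -> cv4 Xs x ->
  Ccv (fun n => extend0 g (Xs n)) (extend0 g x).
Proof.
  intros Hg Xs x HXs Hx Hcv eps He.
  destruct (Hg (eps/3)) as [p Hp]; [lra|].
  assert (Hp' : forall xi, Y xi -> Cnorm (Csub (extend0 g xi) (peval p xi)) < eps/3).
  { intros xi H; destruct (extend0_eq g xi H) as [H' ->]; apply (Hp (exist _ xi H')). }
  destruct (peval_cv4 p Xs x Hcv (eps/3)) as [N K]; [lra|].
  exists N; intros n Hn; specialize (K n Hn).
  pose proof (Hp' _ (HXs n)) as A1; pose proof (Hp' _ Hx) as A2.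
  rewrite Cnorm_sub_sym in A2.
  pose proof (Cnorm_triang_sub (extend0 g (Xs n)) (peval p (Xs n)) (extend0 g x)) as T1.
  pose proof (Cnorm_triang_sub (peval p (Xs n)) (peval p x) (extend0 g x)) as T2. lra.
Qed.

Lemma Ccv_re u l : Ccv u l -> Un_cv (fun n => re (u n)) (re l).
Proof.
  intros H eps He; destruct (H eps He) as [N K]; exists N; intros n Hn; specialize (K n Hn).
  unfold Rdist; eapply Rle_lt_trans; [|apply K]; apply (Rabs_re_le (Csub (u n) l)).
Qed.

Lemma Ccv_im u l : Ccv u l -> Un_cv (fun n => im (u n)) (im l).
Proof.
  intros H eps He; destruct (H eps He) as [N K]; exists N; intros n Hn; specialize (K n Hn).
  unfold Rdist; eapply Rle_lt_trans; [|apply K]; apply (Rabs_im_le (Csub (u n) l)).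
Qed.

(** The sides determine [x]; over fixed [x] the functions [t_j] determine [w], and their real and
    imaginary parts take finitely many values, as [separating_digits] requires. *)
Lemma Xfull_digits D : exists d : nat -> C4 -> bool, (forall k, cont_digit (Xfull D) (d k)) /\
  forall x y, Xfull D x -> Xfull D y -> (forall k, d k x = d k y) -> x = y.
Proof.
  destruct (lifts_exist D (Xfull D) (fun _ H => H)) as [zs Hl].
  set (t := fun j => extend0 (fun x => zs x (3 + j)%nat)).
  assert (HB : bounded3 (Xfull D)) by (intros xi H; apply (Xfull_bound D); auto).
  set (f := fun i => match of_nat i with (O, j) => fun xi => re (t j xi) | (_, j) => fun xi => im (t j xi) end).
  apply (separating_digits (Xfull D) side f).
  - intros Xs; apply Xfull_compact.
  - intros w; apply side_cont.
  - intros i Xs x HXs Hx Hcv; unfold f; destruct (of_nat i) as [[|b] j];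
      [apply Ccv_re|apply Ccv_im]; apply PX_cv; auto; apply (PX_tfun D); auto.
  - intros x y Hx Hy HS Hne.
    assert (Hlift : forall xi, Xfull D xi -> exists z w, solves D z /\ wlim D z w /\ xi = mk4 z w /\
       forall j, t j xi = z (3 + j)%nat).
    { intros xi H; destruct (Hl (exist _ xi H)) as [H1 [w [H2 H3]]]; exists (zs (exist _ xi H)), w.
      split; [auto|split; [auto|split; [auto|]]]; intros j.
      unfold t; destruct (extend0_eq (fun x => zs x (3 + j)%nat) xi H) as [H' ->].
      rewrite (proof_irrelevance _ H' H); reflexivity. }
    assert (Hj : exists j, t j x <> t j y).
    { apply NNPP; intros Hn; apply Hne.
      destruct (Hlift x Hx) as [z [w [A1 [A2 [A3 A4]]]]]; destruct (Hlift y Hy) as [z' [w' [B1 [B2 [B3 B4]]]]].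
      assert (E : forall i, (i < 3)%nat -> z i = z' i).
      { intros i Hi; rewrite <- (xpart_mk4 z w), <- (xpart_mk4 z' w'), <- A3, <- B3 by auto.
        apply side_separates; auto. }
      rewrite A3, B3, (mk4_ext z z') by auto; f_equal.
      apply (Ccv_unique (fun j => neval (wpoly D j) z)); auto.
      apply (Ccv_ext (fun j => neval (wpoly D j) z')); auto; intros j; symmetry; apply wpoly_ext; auto.
      intros k; rewrite <- A4, <- B4; apply NNPP; intros Hk; apply Hn; eauto. }
    destruct Hj as [j Hj].
    destruct (fibre_finite D (xpart x) j) as [L [M HM]].
    assert (HM' : forall eta, Xfull D eta -> (forall w, side w eta = side w x) -> In (t j eta) M).
    { intros eta He Hs; destruct (Hlift eta He) as [z [w [A1 [A2 [A3 A4]]]]].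
      rewrite A4; apply HM; auto; intros i Hi.
      rewrite <- (xpart_mk4 z w), <- A3 by auto; apply side_separates; auto. }
    destruct (Req_dec (re (t j x)) (re (t j y))) as [Hr|Hr].
    + exists (to_nat (1%nat, j)), (map im M); unfold f; rewrite cancel_of_to; split.
      * intros Hi; apply Hj, C_ext; auto.
      * intros eta He Hs; apply in_map; auto.
    + exists (to_nat (0%nat, j)), (map re M); unfold f; rewrite cancel_of_to; split; auto.
      intros eta He Hs; apply in_map; auto.
Qed.

(** Over an empty set the constant 1 would satisfy the bound 0. *)
Lemma poly_hull_nonempty X z : poly_hull X z -> exists x, X x.
Proof.
  intros H; apply NNPP; intros Hn.
  assert (E : Cnorm (peval (PConst C1) z) <= 0) by (apply H; intros x Hx; exfalso; eauto).
  simpl in E; rewrite Cnorm_1 in E; lra.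
Qed.

Theorem theorem7p2 :
  exists X : C4 -> Prop,
    is_Cantor_set X /\
    (* (i) the polynomial hull is strictly bigger than X *)
    (exists z, poly_hull X z /\ ~ X z) /\
    (* (ii) P(X) has dense invertibles *)
    dense_invertibles X /\
    (* (iii) every Gleason part is a single point *)
    (forall phi psi, character X phi -> character X psi ->
       dual_dist_lt2 X phi psi -> forall f, PX X f -> phi f = psi f) /\
    (* (iv) no nonzero bounded point derivations *)
    (forall phi psi, character X phi -> point_derivation X phi psi ->
       bounded_functional X psi -> forall f, PX X f -> psi f = C0).
Proof.
  destruct tower_exists as [D].
  destruct (wlim_exists D (zinf D) (zinf_tbounded D)) as [w Hw].
  assert (HB : bounded3 (Xfull D)) by (intros xi H; apply (Xfull_bound D); auto).
  destruct (Xfull_digits D) as [d [Hd1 Hd2]].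
  destruct (perfect_hull_subset (Xfull D) d (mk4 czero w) HB (Xfull_compact D) Hd1
    (base_in_hull D w Hw) (base_notin_X D w)) as [Y [HYX [HYc [HYh HYp]]]].
  assert (HBY : bounded3 Y) by (intros xi H; apply HB; auto).
  (* Density of squares holds on every subset of [Xfull D], so passing to the perfect subset [Y]
     loses nothing. *)
  assert (HQ : dense_squares Y) by (apply (Xfull_dense_squares D); auto).
  exists Y; split; [|split; [|split; [|split]]].
  - apply (perfect_is_Cantor Y d); auto.
    + intros k Xs x HXs Hx; apply Hd1; auto.
    + apply (poly_hull_nonempty Y (mk4 czero w)); auto.
  - exists (mk4 czero w); split; auto; intros H; apply (base_notin_X D w); auto.
  - apply dense_squares_invertibles; auto.
  - intros phi psi H1 H2 H3 f Hf; apply (dense_squares_gleason Y phi psi); auto.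
  - intros phi psi H1 H2 H3 f Hf; apply (dense_squares_derivation Y phi psi); auto.
Qed.
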